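(* Let $M$ be a connected smooth surface immersed in Euclidean $3$-space $\mathbb{R}^3$. Then the normal bundle $T^{\perp}M$, regarded as a Lagrangian submanifold of $\mathbb{C}^3$, is Maslovian if and only if $M$ is a part of a round sphere, a part of a circular cylinder, or a part of a circular cone.
   Context: **Normal bundle as a Lagrangian submanifold.** Let $M$ be a surface in $\mathbb{R}^3$ (points of $M$ are identified with their images under the immersion). The normal bundle $T^{\perp}M$ is a $3$-dimensional manifold, immersed in $\mathbb{R}^3\times\mathbb{R}^3$ by $f(\xi_x)=(x,\xi_x)$ for $x\in M$ and $\xi_x\in T_x^{\perp}M$; locally, if $N$ is a unit normal vector field along $M$, then $f(x,t)=(x,tN(x))$ for $t\in\mathbb{R}$. $T^{\perp}M$ is equipped with the Riemannian metric induced by $f$ from the standard Euclidean metric. Identify $\mathbb{C}^3=\mathbb{R}^3\times\mathbb{R}^3$ with complex structure $J(X,Y)=(-Y,X)$. An $n$-dimensional submanifold of a Kähler manifold of complex dimension $n$ is Lagrangian if $J$ interchanges its tangent and normal spaces. With this immersion, $T^{\perp}M$ is a Lagrangian submanifold of $\mathbb{C}^3$. **Second fundamental form, shape operator, mean curvature.** For a submanifold with Levi-Civita connection $\nabla$ in an ambient Riemannian manifold with Levi-Civita connection $\tilde\nabla$, the second fundamental form $h$, shape operator $A$ and normal connection $D$ are defined by $\tilde\nabla_XY=\nabla_XY+h(X,Y)$ and $\tilde\nabla_X\xi=-A_\xi X+D_X\xi$, for $X,Y$ tangent and $\xi$ normal. The mean curvature vector field is $H=\operatorname{trace} h$ (no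 averaging factor). **Maslovian.** A Lagrangian submanifold is called Maslovian if its mean curvature vector field $H$ vanishes nowhere and the tangent vector field $JH$ is a principal direction of $A_H$, i.e. $A_H(JH)$ is parallel to (a pointwise scalar multiple of) $JH$ everywhere. In the theorem, $H$ and $A_H$ are those of $T^{\perp}M$ in $\mathbb{C}^3$. **The model surfaces.** A ''part of'' a model surface means that the image of $M$ lies in that model surface. A circular cylinder is a right circular cylinder. A circular cone is a surface congruent, for some constant $r\neq 0$, to $$x(u,v)=\frac{u}{\sqrt{r^2+1}}\left(r\cos\left(\frac{\sqrt{r^2+1}}{r}v\right),\ r\sin\left(\frac{\sqrt{r^2+1}}{r}v\right),\ 1\right),$$ where the vertex ($u=0$) is excluded. In particular, planes are not circular cones. *)

(* Defs.v *)
From HB Require Import structures.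
From mathcomp Require Import all_boot all_order all_algebra.
From mathcomp Require Import all_classical all_reals all_analysis.
From mathcomp Require Import ring lra.
Set Implicit Arguments.
Unset Strict Implicit.
Unset Printing Implicit Defensive.
Import Order.TTheory GRing.Theory Num.Theory.
Import numFieldNormedType.Exports.
Local Open Scope classical_set_scope.
Local Open Scope ring_scope.

Section Euclidean.
Context {R : realType}.

Definition dotv {n} (v w : 'rV[R]_n) : R := (v *m w^T) 0 0.

(* The library norm `|v| on 'rV[R]_n is the sup norm, hence this one. *)
Definition enorm {n} (v : 'rV[R]_n) : R := Num.sqrt (dotv v v).

Definition unitv {n} (i : 'I_n) : 'rV[R]_n := delta_mx 0 i.

Definition vec3 (a b c : R) : 'rV[R]_3 := \row_j [:: a; b; c]`_j.

Definition crossv (v w : 'rV[R]_3) : 'rV[R]_3 :=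
  vec3 (v 0 1 * w 0 2 - v 0 2 * w 0 1)
       (v 0 2 * w 0 0 - v 0 0 * w 0 2)
       (v 0 0 * w 0 1 - v 0 1 * w 0 0).

(* C^n = R^n * R^n, with J (X, Y) = (- Y, X). *)
Definition complexJ {n} (w : 'rV[R]_(n + n)) : 'rV[R]_(n + n) :=
  row_mx (- rsubmx w) (lsubmx w).

Definition congruent {n} (S S' : set 'rV[R]_n) : Prop :=
  exists (Q : 'M[R]_n) (c : 'rV[R]_n),
    Q *m Q^T = 1%:M /\ S' = [set y *m Q + c | y in S].

End Euclidean.

Section Smooth.
Context {R : realType} {V W : normedModType R}.

Fixpoint iter_derive (s : seq V) (f : V -> W) : V -> W :=
  if s is v :: s' then 'D_v (iter_derive s' f) else f.

(* C^oo on an open subset U of a finite-dimensional V: all iterated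
   directional derivatives exist and are differentiable on U. *)
Definition smooth_on (U : set V) (f : V -> W) : Prop :=
  forall (s : seq V) (p : V), U p -> differentiable (iter_derive s f) p.

End Smooth.

Section Manifold.
Context {R : realType}.

(* A local parametrization, i.e. the inverse of a chart; only the restriction
   of lp_map to lp_dom is relevant. *)
Record local_param (n : nat) (T : Type) := LocalParam {
  lp_dom : set 'rV[R]_n ;
  lp_map :> 'rV[R]_n -> T }.

Definition lp_image n T (phi : local_param n T) : set T :=
  phi @` lp_dom phi.

Definition lp_coord n T (phi : local_param n T) : T -> 'rV[R]_n :=
  'pinv_(cst 0) (lp_dom phi) phi.

Record smooth_atlas (n : nat) (M : topologicalType)
    (A : set (local_param n M)) : Prop := SmoothAtlas {
  atlas_cover : \bigcup_(phi in A) lp_image phi = [set: M] ;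
  atlas_open_dom : forall phi, A phi -> open (lp_dom phi) ;
  atlas_open_image : forall phi, A phi -> open (lp_image phi) ;
  atlas_inj : forall phi, A phi -> set_inj (lp_dom phi) phi ;
  atlas_continuous : forall phi, A phi ->
    {within lp_dom phi, continuous phi} ;
  atlas_coord_continuous : forall phi, A phi ->
    {within lp_image phi, continuous (lp_coord phi)} ;
  atlas_transition : forall phi psi, A phi -> A psi ->
    smooth_on (lp_dom phi `&` phi @^-1` lp_image psi) (lp_coord psi \o phi) }.

Record smooth_manifold (n : nat) (M : topologicalType)
    (A : set (local_param n M)) : Prop := SmoothManifold {
  manifold_hausdorff : hausdorff_space M ;
  manifold_second_countable : @second_countable M ;
  manifold_atlas : smooth_atlas A }.

Definition immersion (n N : nat) (M : topologicalType)
    (A : set (local_param n M)) (x : M -> 'rV[R]_N) : Prop :=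
  forall phi, A phi ->
    smooth_on (lp_dom phi) (x \o phi) /\
    forall p, lp_dom phi p -> row_free ('J (x \o phi) p).

End Manifold.

(* Geometry of an immersion F of an open subset of R^n in R^N.  A tangent
   vector at p is given by its coordinates X : 'rV_n, its image in R^N being
   X *m 'J F p; the rows of 'J F p are the partial derivatives of F. *)
Section Submanifold.
Context {R : realType} {n N : nat}.
Implicit Types (F xi : 'rV[R]_n -> 'rV[R]_N) (p : 'rV[R]_n).
Implicit Types (X Y : 'rV[R]_n -> 'rV[R]_n).

Definition tangent F p : set 'rV[R]_N := [set v | (v <= 'J F p)%MS].

Definition normal F p : set 'rV[R]_N :=
  [set v | forall w, tangent F p w -> dotv v w = 0].

Definition metric F p : 'M[R]_n := 'J F p *m ('J F p)^T.

Definition christoffel F p (k i j : 'I_n) : R :=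
  2^-1 * \sum_l invmx (metric F p) k l *
    ('D_(unitv i) (fun q => metric F q j l) p
     + 'D_(unitv j) (fun q => metric F q i l) p
     - 'D_(unitv l) (fun q => metric F q i j) p).

(* nabla_X Y *)
Definition levi_civita F X Y p : 'rV[R]_n :=
  'D_(X p) Y p +
  \row_k \sum_i \sum_j christoffel F p k i j * X p 0 i * Y p 0 j.

(* Gauss formula: h(X, Y) = tilde nabla_X Y - nabla_X Y. *)
Definition second_fundamental_form F X Y p : 'rV[R]_N :=
  'D_(X p) (fun q => Y q *m 'J F q) p - levi_civita F X Y p *m 'J F p.

Definition mean_curvature F p : 'rV[R]_N :=
  \sum_i \sum_j invmx (metric F p) i j *:
    second_fundamental_form F (cst (unitv i)) (cst (unitv j)) p.

(* Coordinates of the tangential component of a vector of R^N. *)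
Definition tangential F p (w : 'rV[R]_N) : 'rV[R]_n :=
  w *m ('J F p)^T *m invmx (metric F p).

(* Weingarten formula: - A_xi X is the tangential component of
   tilde nabla_X xi, for a normal field xi along F. *)
Definition shape_operator F xi p (X : 'rV[R]_n) : 'rV[R]_n :=
  - tangential F p ('D_X xi p).

End Submanifold.

Section Maslovian.
Context {R : realType} {n : nat}.

Definition lagrangian_at (F : 'rV[R]_n -> 'rV[R]_(n + n)) p : Prop :=
  complexJ @` tangent F p = normal F p /\
  complexJ @` normal F p = tangent F p.

Definition maslovian_at (F : 'rV[R]_n -> 'rV[R]_(n + n)) p : Prop :=
  let H := mean_curvature F in
  [/\ lagrangian_at F p,
      H p != 0 &
      exists X : 'rV[R]_n, X *m 'J F p = complexJ (H p) /\
        exists lambda : R, shape_operator F H p X = lambda *: X].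

Definition maslovian (T : Type) (A : set (local_param n T))
    (f : T -> 'rV[R]_(n + n)) : Prop :=
  forall phi, A phi -> forall p, lp_dom phi p -> maslovian_at (f \o phi) p.

End Maslovian.

Section NormalLine.
Context {R : realType}.

Lemma dotvE3 (v w : 'rV[R]_3) : dotv v w = v 0 0 * w 0 0 + v 0 1 * w 0 1 + v 0 2 * w 0 2.
Proof.
rewrite /dotv mxE !big_ord_recl big_ord0 !mxE addr0 addrA.
by congr (_ + _ * _ + _ * _); congr (_ 0 _) => //; apply/val_inj.
Qed.
Lemma dotvZl n a (v w : 'rV[R]_n) : dotv (a *: v) w = a * dotv v w.
Proof. by rewrite /dotv -scalemxAl mxE. Qed.

Lemma row3P (v w : 'rV[R]_3) : v 0 0 = w 0 0 -> v 0 1 = w 0 1 -> v 0 2 = w 0 2 -> v = w.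
Proof.
move=> h0 h1 h2; apply/rowP => i.
case: i => -[|[|[|//]]] hi.
- by rewrite (_ : Ordinal hi = 0) //; apply/val_inj.
- by rewrite (_ : Ordinal hi = 1) //; apply/val_inj.
- by rewrite (_ : Ordinal hi = 2) //; apply/val_inj.
Qed.
Lemma cross0 v w : crossv v w 0 0 = v 0 1 * w 0 2 - v 0 2 * w 0 1 :> R.
Proof. by rewrite !mxE. Qed.
Lemma cross1 v w : crossv v w 0 1 = v 0 2 * w 0 0 - v 0 0 * w 0 2 :> R.
Proof. by rewrite !mxE. Qed.
Lemma cross2 v w : crossv v w 0 2 = v 0 0 * w 0 1 - v 0 1 * w 0 0 :> R.
Proof. by rewrite !mxE. Qed.
Lemma dotv_crossl v w : dotv (crossv v w) v = 0 :> R.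
Proof. by rewrite dotvE3 cross0 cross1 cross2; ring. Qed.
Lemma dotv_crossr v w : dotv (crossv v w) w = 0 :> R.
Proof. by rewrite dotvE3 cross0 cross1 cross2; ring. Qed.


Lemma dotv_sumr n m (A : 'M[R]_(m, n)) (v : 'rV[R]_n) (u : 'rV[R]_m) :
  dotv v (u *m A) = \sum_i u 0 i * dotv v (row i A).
Proof.
rewrite /dotv trmx_mul mulmxA mxE; apply: eq_bigr => i _.
rewrite mulrC mxE; congr (_ * _).
by rewrite !mxE; apply: eq_bigr => k _; rewrite !mxE.
Qed.

Lemma dotv_eq0 (v : 'rV[R]_3) : dotv v v = 0 -> v = 0.
Proof.
rewrite dotvE3 => h; apply: row3P; rewrite mxE; nra.
Qed.

Lemma sub_row2 (A : 'M[R]_(2, 3)) (u : 'rV[R]_2) :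
  u *m A = u 0 0 *: row 0 A + u 0 1 *: row 1 A.
Proof.
rewrite mulmx_sum_row !big_ord_recl big_ord0 addr0.
by rewrite (_ : lift ord0 ord0 = 1 :> 'I_2) //; apply/val_inj.
Qed.

Lemma cross_neq0 (A : 'M[R]_(2, 3)) :
  row_free A -> crossv (row 0 A) (row 1 A) != 0.
Proof.
move=> /row_freeP [B AB]; apply/eqP.
have inj (u : 'rV_2) : u *m A = 0 -> u = 0.
  by move=> uA; rewrite -(mulmx1 u) -AB mulmxA uA mul0mx.
set a := row 0 A; set b := row 1 A => c0.
have := congr1 (fun v : 'rV[R]_3 => v 0 0) c0; rewrite cross0 [RHS]mxE => c00.
have := congr1 (fun v : 'rV[R]_3 => v 0 1) c0; rewrite cross1 [RHS]mxE => c01.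
have := congr1 (fun v : 'rV[R]_3 => v 0 2) c0; rewrite cross2 [RHS]mxE => c02.
pose u : 'rV[R]_2 := \row_j [:: - dotv a b; dotv a a]`_j.
have /inj/(congr1 (fun v : 'rV[R]_2 => v 0 1)) : u *m A = 0.
  rewrite sub_row2 -/a -/b [u 0 0]mxE [u 0 1]mxE /= !dotvE3.
  apply: row3P; rewrite ![(_ + _ : 'rV_3) _ _]mxE ![(_ *: _ : 'rV_3) _ _]mxE [RHS]mxE.
  - transitivity (a 0 2 * (a 0 2 * b 0 0 - a 0 0 * b 0 2)
      - a 0 1 * (a 0 0 * b 0 1 - a 0 1 * b 0 0)); first by ring.
    by rewrite c01 c02; ring.
  - transitivity (a 0 0 * (a 0 0 * b 0 1 - a 0 1 * b 0 0)
      - a 0 2 * (a 0 1 * b 0 2 - a 0 2 * b 0 1)); first by ring.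
    by rewrite c00 c02; ring.
  - transitivity (a 0 1 * (a 0 1 * b 0 2 - a 0 2 * b 0 1)
      - a 0 0 * (a 0 2 * b 0 0 - a 0 0 * b 0 2)); first by ring.
    by rewrite c00 c01; ring.
rewrite [u 0 1]mxE [RHS]mxE /= => /dotv_eq0 a0.
have /inj/(congr1 (fun v : 'rV[R]_2 => v 0 0)) : unitv 0 *m A = 0 :> 'rV_3.
  by rewrite -rowE -/a a0.
by rewrite !mxE /= => /eqP; rewrite oner_eq0.
Qed.

Lemma normal_line (A : 'M[R]_(2, 3)) (v : 'rV[R]_3) :
  let c := crossv (row 0 A) (row 1 A) in
  row_free A -> dotv v (row 0 A) = 0 -> dotv v (row 1 A) = 0 ->
  v = (dotv v c / enorm c) *: ((enorm c)^-1 *: c).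
Proof.
move=> c /cross_neq0; rewrite -/c => cn va vb.
have c2 : dotv c c != 0 by apply: contra_neq cn => /dotv_eq0.
have c2p : 0 <= dotv c c by rewrite dotvE3; nra.
have e2 : enorm c * enorm c = dotv c c by rewrite -expr2 sqr_sqrtr.
rewrite scalerA -mulrA -invfM e2.
apply: (@scalerI _ _ (dotv c c)) => //.
rewrite scalerA mulrCA divff // mulr1.
suff -> : dotv c c *: v = dotv v c *: c
    + (dotv v (row 0 A) *: crossv (row 1 A) c - dotv v (row 1 A) *: crossv (row 0 A) c).
  by rewrite va vb !scale0r subr0 addr0.
rewrite /c !dotvE3 cross0 cross1 cross2.
move: (row 0 A) (row 1 A) => a b.
by apply: row3P; rewrite ![(_ + _ : 'rV_3) _ _]mxE ![(_ *: _ : 'rV_3) _ _]mxE ![(- _ : 'rV_3) _ _]mxE ![(_ *: _ : 'rV_3) _ _]mxE ?cross0 ?cross1 ?cross2 ?(cross0 b) ?cross0 ?cross1 ?cross2; ring.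
Qed.

End NormalLine.

Section NormalBundle.
Context {R : realType} {M : topologicalType}.
Implicit Types (A : set (@local_param R 2 M)) (x : M -> 'rV[R]_3).

Definition normal_bundle A x : set (M * 'rV[R]_3) :=
  [set xi | exists2 phi, A phi &
     exists2 p, lp_dom phi p & phi p = xi.1 /\ normal (x \o phi) p xi.2].

Definition normal_bundle_immersion x (xi : M * 'rV[R]_3) : 'rV[R]_(3 + 3) :=
  row_mx (x xi.1) xi.2.

Definition unit_normal (y : 'rV[R]_2 -> 'rV[R]_3) (p : 'rV[R]_2) :=
  let c := crossv (row 0 ('J y p)) (row 1 ('J y p)) in (enorm c)^-1 *: c.

(* (p, t) |-> (phi p, t N(p)), with N the unit normal of x \o phi. *)
Definition normal_param x (phi : local_param 2 M) :
    local_param 3 (M * 'rV[R]_3) :=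
  @LocalParam R (2 + 1) (M * 'rV[R]_3)
    [set w | lp_dom phi (lsubmx w)]
    (fun w => (phi (lsubmx w),
               rsubmx w 0 0 *: unit_normal (x \o phi) (lsubmx w))).

Definition normal_bundle_atlas A x : set (local_param 3 (M * 'rV[R]_3)) :=
  [set normal_param x phi | phi in A].

Lemma normal_bundle_atlas_image A x : immersion A x ->
  \bigcup_(psi in normal_bundle_atlas A x) lp_image psi = normal_bundle A x.
Proof.
move=> immx; apply/seteqP; split.
  move=> _ [_ [phi Aphi <-]] [w domw <-]; exists phi => //.
  exists (@lsubmx R 1 2 1 w) => //; split => //= v /submxP [u ->].
  rewrite dotv_sumr big1 // => i _; rewrite !dotvZl.
  have [->|->] : i = 0 \/ i = 1.
    by case: i => -[|[|//]] hi; [left|right]; apply/val_inj.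
  - by rewrite dotv_crossl !mulr0.
  - by rewrite dotv_crossr !mulr0.
move=> [m xi] [phi Aphi [p domp [/= <- nxi]]].
have [_ /(_ p domp) rf] := immx phi Aphi.
have nr i : dotv xi (row i ('J (x \o phi) p)) = 0 by apply/nxi/row_sub.
set c := crossv (row 0 ('J (x \o phi) p)) (row 1 ('J (x \o phi) p)).
exists (normal_param x phi); first by exists phi.
exists (row_mx p (dotv xi c / enorm c)%:M : 'rV_(2 + 1)) => /=.
  by rewrite row_mxKl.
by rewrite row_mxKl row_mxKr mxE eqxx mulr1n -normal_line.
Qed.

End NormalBundle.

Section Models.
Context {R : realType}.

Definition round_sphere (c : 'rV[R]_3) (rho : R) : set 'rV[R]_3 :=
  [set y | enorm (y - c) = rho].

Definition model_cylinder (rho : R) : set 'rV[R]_3 :=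
  [set y | y 0 0 ^+ 2 + y 0 1 ^+ 2 = rho ^+ 2].

Definition cone_param (r u v : R) : 'rV[R]_3 :=
  (u / Num.sqrt (r ^+ 2 + 1)) *:
  vec3 (r * cos (Num.sqrt (r ^+ 2 + 1) / r * v))
       (r * sin (Num.sqrt (r ^+ 2 + 1) / r * v))
       1.

Definition model_cone (r : R) : set 'rV[R]_3 :=
  [set y | exists u v, u != 0 /\ y = cone_param r u v].

Definition is_round_sphere (S : set 'rV[R]_3) : Prop :=
  exists c rho, 0 < rho /\ S = round_sphere c rho.

Definition is_circular_cylinder (S : set 'rV[R]_3) : Prop :=
  exists rho, 0 < rho /\ congruent (model_cylinder rho) S.

Definition is_circular_cone (S : set 'rV[R]_3) : Prop :=
  exists r, r != 0 /\ congruent (model_cone r) S.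

Definition part_of (M : Type) (x : M -> 'rV[R]_3)
    (P : set 'rV[R]_3 -> Prop) : Prop :=
  exists2 S, P S & range x `<=` S.

End Models.

(* Main.v *)
Require Import Defs.
From HB Require Import structures.
From mathcomp Require Import all_boot all_order all_algebra.
From mathcomp Require Import all_classical all_reals all_analysis.
From mathcomp Require Import perm ring lra.
Set Implicit Arguments.
Unset Strict Implicit.
Unset Printing Implicit Defensive.
Import Order.TTheory GRing.Theory Num.Theory.
Import numFieldNormedType.Exports.
Local Open Scope classical_set_scope.
Local Open Scope ring_scope.

(** Write N for the unit normal of a local parametrization y of the surface, g
    and h for its fundamental forms, m for the trace of its shape operator and K
    for its Gauss curvature.

    For a Lagrangian immersion F the second fundamental form amounts to the
    cubic form <F_ab, J F_c>, and the Maslovian condition becomes a polynomial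
    system in the metric, the cubic form and the coordinates of JH
    (maslovian_cubic).  For F(p, t) = (y p, t N p) the metric is
    (1 - t^2 K) g + t^2 m h along the surface and 1 along the fibre, and the
    cubic form only involves h and its covariant derivative c, which is
    totally symmetric by Codazzi.  The system is written out in
    maslovian_normal_map.

    Necessity.  At t = 0 the system says that m does not vanish.  When JH and
    the factor of proportionality are eliminated, there remains an identity
    between polynomials in t, divisible by a power of t; its lowest coefficient
    says that h annihilates the gradient of m (second_form_grad_mean2) and, if m
    is constant, that h annihilates the gradient of K (second_form_grad_gauss).
    Hence dm = 0 wherever K <> 0.  On an open set where K = 0, let e be the unit
    principal direction of curvature 0.  The gradient of m is along e, say
    dm = s m^2 <dy, e>, and the Codazzi equations give d(e / m) = - s dy,
    whence ds = 0 and de = s dN (developable_ruling).  So the function gradnorm,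
    which is |grad m|^2 / m^4 and equals s^2 there, has zero derivative
    everywhere, and is constant on M by connectedness.
    - If this constant is not 0, then K = 0 and both the axis e - s N and the
      apex y + e / (m s) are locally constant: a cone.
    - If it is 0, then m is constant, so K dK = 0 and K^2 is constant too.  If
      K = 0, then s = 0 and the axis of curvature is locally constant: a
      cylinder.  If K <> 0, then the principal curvatures are constant, and the
      structure equations do not allow them to be distinct
      (constant_curvatures_flat); at umbilics the centre y + (2 / m) N is
      locally constant: a sphere.
    In each case the osculating model does not depend on the chart and is
    locally constant, so that a single model contains the connected surface
    (chart_glue, maslovian_classification).

    Sufficiency.  Each model lies on a quadric <B (z - a), z - a> = const with
    B = id - beta w w^T, and B (y - a) = nu N for some function nu.
    Differentiating twice shows that c is minus the symmetrization of
    h (x) dnu / nu (quadric_cubic).  On the models h annihilates the gradient of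
    nu, and then the system is solved explicitly (maslovian_sufficient). *)

(** * Smooth maps on open sets *)

Section SmoothCalculus.
Context {R : realType} {V : normedModType R}.

Lemma near_eq_differentiable (W : normedModType R) (f g : V -> W) (x : V) :
  (\near x, f x = g x) -> differentiable f x -> differentiable g x.
Proof.
move=> fg /diff_locallyP [cdf df].
have gx : g x = f x by rewrite (nbhs_singleton fg).
have dg : g \o shift x = cst (g x) + 'd f x +o_ 0 id.
  apply/eqaddoP => e e0; move/eqaddoP/(_ e e0): df => df.
  have fg0 : \forall h \near (0 : V), f (h + x) = g (h + x).
    by have := fg; rewrite (near_shift 0 x) subr0; apply.
  apply: filterS2 df fg0 => h /= + fgh.
  by rewrite !fctE /= fgh gx.
by apply/diff_locallyP; rewrite (diff_unique cdf dg).
Qed.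

(** The iterated derivatives of a product or of an inverse are sums of products,
    so the closure properties of smooth maps are proved by induction on the
    order n, for all maps at once. *)
Fixpoint Ck {W : normedModType R} n (U : set V) (f : V -> W) : Prop :=
  (forall p, U p -> differentiable f p) /\
  (if n is m.+1 then forall v, Ck m U ('D_v f) else True).

Section General.
Context {W : normedModType R}.
Implicit Types (f g : V -> W) (U : set V).

Lemma iter_derive_rcons s v f :
  iter_derive (rcons s v) f = iter_derive s ('D_v f).
Proof. by elim: s => //= w s ->. Qed.

Lemma Ck_iterP n U f : Ck n U f <->
  forall s, (size s <= n)%N -> forall p, U p -> differentiable (iter_derive s f) p.
Proof.
elim: n f => [|n IHn] f /=; split.
- by move=> [df _] [|].
- by move=> df; split=> //; exact: (df [::]).
- move=> [df Df] s; case/lastP: s => [_|s v]; first exact: df.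
  rewrite size_rcons ltnS => sn p Up; rewrite iter_derive_rcons.
  by have /IHn := Df v; apply.
- move=> h; split; first by exact: (h [::]).
  by move=> v; apply/IHn => s sn p Up; rewrite -iter_derive_rcons;
    apply: h => //; rewrite size_rcons.
Qed.

Lemma smooth_onP U f : smooth_on U f <-> forall n, Ck n U f.
Proof.
split=> [sf n|Cf s p Up]; first by apply/Ck_iterP => s _ p; exact: sf.
by have /Ck_iterP := Cf (size s); apply.
Qed.

Lemma CkW n U f : Ck n.+1 U f -> Ck n U f.
Proof.
by elim: n f => [|n IHn] f [df Df]; split=> // v; apply: IHn; exact: Df.
Qed.

Lemma Ck_eq n U f g : open U -> (forall p, U p -> f p = g p) ->
  Ck n U f -> Ck n U g.
Proof.
move=> oU; elim: n f g => [|n IHn] f g fg [df Df]; split.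
- move=> p Up; apply: near_eq_differentiable (df p Up).
  by near=> q; apply: fg; near: q; exact: open_nbhs_nbhs.
- by [].
- move=> p Up; apply: near_eq_differentiable (df p Up).
  by near=> q; apply: fg; near: q; exact: open_nbhs_nbhs.
- move=> v; apply: IHn (Df v) => p Up; apply: near_eq_derive.
  by near=> q; apply: fg; near: q; exact: open_nbhs_nbhs.
Unshelve. all: by end_near. Qed.

Lemma Ck_cst n U (c : W) : Ck n U (cst c).
Proof.
elim: n c => [|n IHn] c; split=> // v.
by rewrite (_ : 'D_v (cst c) = cst 0) //; apply/funext => p; rewrite derive_cst.
Qed.

Lemma CkD n U f g : open U -> Ck n U f -> Ck n U g ->
  Ck n U (fun p => f p + g p).
Proof.
move=> oU; elim: n f g => [|n IHn] f g [df Df] [dg Dg]; split=> //.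
- by move=> p Up; apply: differentiableD; [exact: df|exact: dg].
- by move=> p Up; apply: differentiableD; [exact: df|exact: dg].
- move=> v; apply: Ck_eq (IHn _ _ (Df v) (Dg v)) => // p Up.
  by rewrite -deriveD //; apply: diff_derivable; [exact: df|exact: dg].
Qed.

Lemma CkN n U f : open U -> Ck n U f -> Ck n U (fun p => - f p).
Proof.
move=> oU; elim: n f => [|n IHn] f [df Df]; split=> //.
- by move=> p Up; apply: differentiableN; exact: df.
- by move=> p Up; apply: differentiableN; exact: df.
- move=> v; apply: Ck_eq (IHn _ (Df v)) => // p Up.
  by rewrite [RHS]deriveN //; exact/diff_derivable/df.
Qed.

End General.

Lemma CkM n U (f g : V -> R) : open U -> Ck n U f -> Ck n U g ->
  Ck n U (fun p => f p * g p).
Proof.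
move=> oU; elim: n f g => [|n IHn] f g [df Df] [dg Dg]; split=> //.
- by move=> p Up; apply: differentiableM; [exact: df|exact: dg].
- by move=> p Up; apply: differentiableM; [exact: df|exact: dg].
- move=> v.
  have cf : Ck n.+1 U f by split.
  have cg : Ck n.+1 U g by split.
  have := CkD oU (IHn _ _ (CkW cf) (Dg v)) (IHn _ _ (CkW cg) (Df v)).
  apply: Ck_eq => // p Up.
  rewrite [RHS]deriveM //; first exact/diff_derivable/df.
  exact/diff_derivable/dg.
Qed.

Lemma CkV n U (f : V -> R) : open U -> (forall p, U p -> f p != 0) ->
  Ck n U f -> Ck n U (fun p => (f p)^-1).
Proof.
move=> oU f0; elim: n => [|n IHn] [df Df]; split=> //.
- by move=> p Up; apply: differentiableV; [exact: df|exact: f0].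
- by move=> p Up; apply: differentiableV; [exact: df|exact: f0].
- move=> v.
  have cf : Ck n.+1 U f by split.
  have cV := IHn (CkW cf).
  have := CkM oU (CkM oU (@Ck_cst _ n U (-1 : R)) (CkM oU cV cV)) (Df v).
  apply: Ck_eq => // p Up.
  rewrite [RHS]deriveV ?f0 //; last exact/diff_derivable/df.
  by rewrite /cst /= mulN1r expr2 invfM.
Qed.

Lemma is_diff_sqrt (x : R) : 0 < x -> differentiable (@Num.sqrt R) x.
Proof.
by move=> x0; apply/derivable1_diffP; have [] := is_derive1_sqrt x0.
Qed.

Lemma derive_sqrt_comp (f : V -> R) p v : 0 < f p -> differentiable f p ->
  'D_v (fun q => Num.sqrt (f q)) p = (2 * Num.sqrt (f p))^-1 * 'D_v f p.
Proof.
move=> fp df.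
have ds : differentiable (fun q => Num.sqrt (f q)) p.
  by apply: differentiable_comp => //; exact: is_diff_sqrt.
have fp' : 0 < Num.sqrt (f p) by rewrite sqrtr_gt0.
have np : \forall q \near p, 0 < f q.
  apply: (cvgr_gt (f p)) => //; exact: differentiable_continuous.
have : 'D_v f p = 'D_v ((fun q => Num.sqrt (f q)) * (fun q => Num.sqrt (f q))) p.
  apply: near_eq_derive; near=> q.
  by rewrite /GRing.mul /= -expr2 sqr_sqrtr // ltW //; near: q.
rewrite deriveM; [|exact: diff_derivable..].
rewrite /GRing.scale /= => ->; field; exact: lt0r_neq0.
Unshelve. all: by end_near. Qed.

Lemma Ck_sqrt n U (f : V -> R) : open U -> (forall p, U p -> 0 < f p) ->
  Ck n U f -> Ck n U (fun p => Num.sqrt (f p)).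
Proof.
move=> oU f0; elim: n => [|n IHn] [df Df].
  split=> // p Up; apply: differentiable_comp; first exact: df.
  exact/is_diff_sqrt/f0.
split=> [p Up|v].
  by apply: differentiable_comp; [exact: df|exact/is_diff_sqrt/f0].
have cf : Ck n.+1 U f by split.
have cS := IHn (CkW cf).
have := CkM oU (CkV oU _ (CkM oU (@Ck_cst _ n U (2 : R)) cS)) (Df v).
move=> h; apply: Ck_eq (h _) => // p Up.
- by rewrite [RHS]derive_sqrt_comp ?f0 //; exact: df.
- by rewrite /cst /= mulf_neq0 // sqrtr_eq0 -ltNge f0.
Qed.

Section Smooth.
Context {W : normedModType R}.
Implicit Types (F G : V -> W) (f g : V -> R) (U : set V).

Lemma smooth_diff U F p : smooth_on U F -> U p -> differentiable F p.
Proof. by move=> sF; exact: (sF [::]). Qed.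

Lemma smooth_deriv U F v : smooth_on U F -> smooth_on U ('D_v F).
Proof. by move=> sF s p Up; rewrite -iter_derive_rcons; exact: sF. Qed.

Lemma smooth_eq U F G : open U -> (forall p, U p -> F p = G p) ->
  smooth_on U F -> smooth_on U G.
Proof. by move=> oU FG /smooth_onP sF; apply/smooth_onP => n; apply: Ck_eq (sF n). Qed.

Lemma smoothS U U' F : U' `<=` U -> smooth_on U F -> smooth_on U' F.
Proof. by move=> UU' sF s p /UU'; exact: sF. Qed.

Lemma smooth_cst U (c : W) : smooth_on U (fun=> c).
Proof. by apply/smooth_onP => n; exact: Ck_cst. Qed.

Lemma smoothD U F G : open U -> smooth_on U F -> smooth_on U G ->
  smooth_on U (fun p => F p + G p).
Proof. by move=> oU /smooth_onP sF /smooth_onP sG; apply/smooth_onP => n; apply: CkD. Qed.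

Lemma smoothN U F : open U -> smooth_on U F -> smooth_on U (fun p => - F p).
Proof. by move=> oU /smooth_onP sF; apply/smooth_onP => n; apply: CkN. Qed.

Lemma smoothB U F G : open U -> smooth_on U F -> smooth_on U G ->
  smooth_on U (fun p => F p - G p).
Proof. by move=> oU sF sG; apply: smoothD => //; exact: smoothN. Qed.

Lemma smooth_sum U (I : Type) (r : seq I) (P : pred I) (F : I -> V -> W) :
  open U -> (forall i, P i -> smooth_on U (F i)) ->
  smooth_on U (fun p => \sum_(i <- r | P i) F i p).
Proof.
move=> oU sF; elim: r => [|i r IHr].
  by apply: (smooth_eq oU _ (@smooth_cst U 0)) => // p _; rewrite big_nil.
have [Pi|Pi] := boolP (P i); last first.
  by apply: (smooth_eq oU _ IHr) => // p _; rewrite big_cons (negbTE Pi).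
by apply: (smooth_eq oU _ (smoothD oU (sF i Pi) IHr)) => // p _; rewrite big_cons Pi.
Qed.

Lemma smoothM U f g : open U -> smooth_on U f -> smooth_on U g ->
  smooth_on U (fun p => f p * g p).
Proof. by move=> oU /smooth_onP sf /smooth_onP sg; apply/smooth_onP => n; apply: CkM. Qed.

Lemma smoothV U f : open U -> (forall p, U p -> f p != 0) ->
  smooth_on U f -> smooth_on U (fun p => (f p)^-1).
Proof. by move=> oU f0 /smooth_onP sf; apply/smooth_onP => n; apply: CkV. Qed.

Lemma smooth_sqrt U f : open U -> (forall p, U p -> 0 < f p) ->
  smooth_on U f -> smooth_on U (fun p => Num.sqrt (f p)).
Proof. by move=> oU f0 /smooth_onP sf; apply/smooth_onP => n; apply: Ck_sqrt. Qed.

End Smooth.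

Arguments smooth_cst {W} U c.

Section SmoothReal.
Implicit Types (f g : V -> R) (U : set V).

Lemma smoothX U f n : open U -> smooth_on U f -> smooth_on U (fun p => f p ^+ n).
Proof.
move=> oU sf; elim: n => [|n IHn]; first exact: smooth_cst.
by apply: (smooth_eq oU _ (smoothM oU sf IHn)) => // p _; rewrite exprS.
Qed.

Lemma smooth_prod U (I : Type) (r : seq I) (P : pred I) (f : I -> V -> R) :
  open U -> (forall i, P i -> smooth_on U (f i)) ->
  smooth_on U (fun p => \prod_(i <- r | P i) f i p).
Proof.
move=> oU sf; elim: r => [|i r IHr].
  by apply: (smooth_eq oU _ (smooth_cst U (1 : R))) => // p _; rewrite big_nil.
have [Pi|Pi] := boolP (P i); last first.
  by apply: (smooth_eq oU _ IHr) => // p _; rewrite big_cons (negbTE Pi).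
by apply: (smooth_eq oU _ (smoothM oU (sf i Pi) IHr)) => // p _; rewrite big_cons Pi.
Qed.

End SmoothReal.

Section Rows.
Context {n : nat}.
Implicit Types (F G : V -> 'rV[R]_n) (U : set V).

Lemma derive_row F p v k : derivable F p v ->
  ('D_v F p) 0 k = 'D_v (fun q => F q 0 k) p.
Proof. by move=> dF; rewrite derive_mx // mxE. Qed.

Lemma differentiable_row F p :
  (forall k, differentiable (fun q => F q 0 k) p) <-> differentiable F p.
Proof.
split=> [dF|dF k]; last first.
  apply: (@differentiable_comp _ _ _ _ F (fun v : 'rV_n => v 0 k)) => //.
  exact: differentiable_coord.
suff -> : F = \sum_k (fun q => F q 0 k *: delta_mx 0 k).
  by apply: differentiable_sum => k; apply: differentiableZl.
apply/funext => q; rewrite fct_sumE {1}[F q]matrix_sum_delta big_ord1.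
by [].
Qed.

Lemma smooth_row U F : open U ->
  (forall k, smooth_on U (fun q => F q 0 k)) <-> smooth_on U F.
Proof.
move=> oU; split=> [/(_ _)/smooth_onP sF|/smooth_onP sF k];
  apply/smooth_onP => m.
  elim: m F {sF}(fun k => sF k m) => [|m IHm] F sF; split=> //.
  - by move=> p Up; apply/differentiable_row => k; have [df _] := sF k; exact: df.
  - by move=> p Up; apply/differentiable_row => k; have [df _] := sF k; exact: df.
  - move=> v; apply: IHm => k; have [_ /(_ v)] := sF k.
    apply: Ck_eq => // p Up; rewrite derive_row //.
    apply/diff_derivable/differentiable_row => i; have [df _] := sF i.
    exact: df.
elim: m F {sF}(sF m) => [|m IHm] F [dF DF]; split=> //.
- by move=> p Up; have /differentiable_row df := dF p Up; exact: df.
- by move=> p Up; have /differentiable_row df := dF p Up; exact: df.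
- move=> v; apply: Ck_eq (IHm _ (DF v)) => // p Up; rewrite derive_row //.
  exact/diff_derivable/dF.
Qed.

End Rows.

End SmoothCalculus.

(** * Mean values along lines and the symmetry of second derivatives *)

Section Lines.
Context {R : realType} {V : normedModType R}.
Implicit Types (f : V -> R) (U : set V).

Lemma is_derive_line f (p v : V) (t : R) : differentiable f (p + t *: v) ->
  is_derive t 1 (fun s : R => f (p + s *: v)) ('D_v f (p + t *: v)).
Proof.
move=> /(diff_derivable (v := v)) df.
have E : (fun h : R => h^-1 *: (f (p + (h *: 1 + t) *: v) - f (p + t *: v)))
       = (fun h : R => h^-1 *: (f (h *: v + (p + t *: v)) - f (p + t *: v))).
  apply/funext => h; congr (_ *: (f _ - _)).
  by rewrite scalerDl addrCA [h *: 1]mulr1.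
by apply: DeriveDef; [rewrite /derivable E|rewrite /derive E].
Qed.

Lemma line_MVT f (p v : V) (h : R) : 0 < h ->
  (forall t, 0 <= t <= h -> differentiable f (p + t *: v)) ->
  exists2 t, 0 < t < h & f (p + h *: v) - f p = h * 'D_v f (p + t *: v).
Proof.
move=> h0 df.
have dl t : 0 <= t <= h ->
    is_derive t 1 (fun s : R => f (p + s *: v)) ('D_v f (p + t *: v)).
  by move=> /df; exact: is_derive_line.
have [||t] := @MVT _ (fun s : R => f (p + s *: v)) (fun t => 'D_v f (p + t *: v)) _ _ h0.
- move=> t; rewrite in_itv /= => /andP[t0 th]; apply: dl.
  by rewrite !ltW.
- apply: derivable_within_continuous => t; rewrite in_itv /= => /dl dt.
  by case: dt.
- rewrite in_itv /= => t0h; rewrite scale0r addr0 subr0 mulrC => ->.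
  by exists t.
Qed.

(** Balls contain the segments to their centre, where line_MVT applies. *)
Lemma locally_constant f U p : open U -> U p ->
  (forall q, U q -> differentiable f q) ->
  (forall q v, U q -> 'D_v f q = 0) -> \forall q \near p, f q = f p.
Proof.
move=> oU Up df Df.
have /nbhs_ballP[r r0 rU] : nbhs p U by exact: open_nbhs_nbhs.
apply/nbhs_ballP; exists r => // q pq.
have inU t : 0 <= t <= 1 -> U (p + t *: (q - p)).
  move=> /andP[t0 t1]; apply: rU; move: pq; rewrite -ball_normE /=.
  rewrite opprD addrA subrr add0r normrN normrZ ger0_norm // distrC.
  by apply: le_lt_trans; rewrite ler_piMl.
have [t ht|t /andP[t0 t1]] := @line_MVT f p (q - p) 1 ltr01.
  exact/df/inU.
rewrite scale1r [p + (q - p)]addrC subrK Df; last by apply: inU; rewrite !ltW.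
by rewrite mulr0 => /eqP; rewrite subr_eq0 => /eqP.
Qed.

(** The second difference is symmetric in u and v, and approximates both mixed
    derivatives. *)
Let second_difference f U p u v e : open U -> U p -> Ck 2 U f -> 0 < e ->
  exists2 r : R, 0 < r & forall h, 0 < h < r ->
    `| (f (p + h *: u + h *: v) - f (p + h *: u) - f (p + h *: v) + f p)
       - h * (h * 'D_v ('D_u f) p) | <= h * (h * e).
Proof.
move=> oU Up [df D1f] e0.
have [dDu /(_ v) [dDvu _]] := D1f u.
have /cvgrPdist_le/(_ _ e0) near_e := differentiable_continuous (dDvu p Up).
have nU : nbhs p U by exact: open_nbhs_nbhs.
have /nbhs_ballP[r r0 rU] :
    nbhs p ((fun q => `|'D_v ('D_u f) p - 'D_v ('D_u f) q| <= e) `&` U).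
  exact: filterI.
pose N := `|u| + `|v| + 1.
have N0 : 0 < N by rewrite ltr_wpDl // addr_ge0.
exists (r / N); first by rewrite divr_gt0.
move=> h /andP[h0 hr].
have inB s t : 0 <= s <= h -> 0 <= t <= h -> ball p r (p + s *: u + t *: v).
  move=> /andP[s0 sh] /andP[t0 th]; rewrite -ball_normE /=.
  rewrite -addrA opprD addrA subrr add0r normrN.
  apply: le_lt_trans (ler_normD _ _) _; rewrite !normrZ !ger0_norm //.
  apply: le_lt_trans (_ : _ <= h * N) _; last by rewrite -ltr_pdivlMr.
  rewrite /N !mulrDr mulr1 ler_wpDr ?(ltW h0) //.
  by apply: lerD; apply: ler_wpM2r.
have inU s t : 0 <= s <= h -> 0 <= t <= h -> U (p + s *: u + t *: v).
  by move=> hs ht; have [] := rU _ (inB s t hs ht).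
have hh : 0 <= h <= h by rewrite lexx ltW.
have zh : (0 : R) <= 0 <= h by rewrite lexx ltW.
have [t /andP[t0 th] gE] : exists2 t, 0 < t < h &
    (f (p + h *: v + h *: u) - f (p + h *: u)) - (f (p + h *: v) - f p)
    = h * ('D_u f (p + t *: u + h *: v) - 'D_u f (p + t *: u)).
  have dl t : 0 <= t <= h ->
      is_derive t 1 (fun s : R => f (p + h *: v + s *: u) - f (p + s *: u))
      ('D_u f (p + t *: u + h *: v) - 'D_u f (p + t *: u)).
    move=> ht; rewrite [p + t *: u + h *: v]addrAC.
    apply: is_deriveB; apply: is_derive_line; apply: df.
      by rewrite addrAC; exact: inU.
    by have := inU t 0 ht zh; rewrite scale0r addr0.
  have [||t] := @MVT _ (fun s : R => f (p + h *: v + s *: u) - f (p + s *: u))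
    (fun t => 'D_u f (p + t *: u + h *: v) - 'D_u f (p + t *: u)) _ _ h0.
  - move=> t; rewrite in_itv /= => /andP[t0 th]; apply: dl.
    by rewrite !ltW.
  - apply: derivable_within_continuous => t; rewrite in_itv /= => /dl dt.
    by case: dt.
  - rewrite in_itv /= => t0h; rewrite scale0r !addr0 subr0 => E.
    by exists t => //; rewrite E mulrC.
have ht : 0 <= t <= h by rewrite !ltW.
have [s0|s /andP[s0 sh] DE] := @line_MVT ('D_u f) (p + t *: u) v h h0.
  by move=> hs; apply: dDu; exact: inU.
rewrite [p + h *: u + h *: v]addrAC.
have -> : f (p + h *: v + h *: u) - f (p + h *: u) - f (p + h *: v) + f p
   = h * (h * 'D_v ('D_u f) (p + t *: u + s *: v)).
  by rewrite -DE -gE; ring.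
rewrite -!mulrBr !normrM gtr0_norm // !ler_pM2l //.
rewrite distrC; have hs : 0 <= s <= h by rewrite !ltW.
by have [] := rU _ (inB t s ht hs).
Qed.

Lemma schwarz f U p u v : open U -> U p -> smooth_on U f ->
  'D_v ('D_u f) p = 'D_u ('D_v f) p.
Proof.
move=> oU Up /smooth_onP/(_ 2) C2; apply/eqP; rewrite -subr_eq0.
apply/negPn/negP; rewrite -normr_gt0; set d := _ - _ => d0.
(* An error of |d| / 4 on either side leaves a gap of at most |d| / 2. *)
have e0 : 0 < `|d| / 4 by rewrite divr_gt0.
have [r1 r10 h1] := second_difference u v oU Up C2 e0.
have [r2 r20 h2] := second_difference v u oU Up C2 e0.
have [h hh0 /andP[hr1 hr2]] : exists2 h : R, 0 < h & (h < r1) && (h < r2).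
  exists (Num.min r1 r2 / 2); first by rewrite divr_gt0 // lt_min r10.
  by rewrite -lt_min ltr_pdivrMr // ltr_pMr ?ltr1n // lt_min r10.
have {}h1 := h1 h; have {}h2 := h2 h; rewrite hh0 in h1 h2.
have {}h1 := h1 hr1; have {}h2 := h2 hr2.
have : `|h * (h * d)| <= h * (h * (`|d| / 4)) + h * (h * (`|d| / 4)).
  move: (`|d| / 4) h1 h2 => k; rewrite /d [p + h *: v + h *: u]addrAC.
  move: (f _) (f _) (f _) (f _) ('D_v _ _) ('D_u _ _) => A B C D x y.
  rewrite !ler_norml => /andP[h1 h2] /andP[h3 h4]; apply/andP.
  by split; lra.
rewrite !normrM gtr0_norm // -!mulrDr !ler_pM2l //.
by move: `|d| d0; clear => k; lra.
Qed.

End Lines.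

(** * Dot products and partial derivatives *)

Section Dot.
Context {R : realType}.
Implicit Types n : nat.

Lemma dotvE n (v w : 'rV[R]_n) : dotv v w = \sum_i v 0 i * w 0 i.
Proof. by rewrite /dotv mxE; apply: eq_bigr => i _; rewrite mxE. Qed.

Lemma dotvC n (v w : 'rV[R]_n) : dotv v w = dotv w v.
Proof. by rewrite !dotvE; apply: eq_bigr => i _; rewrite mulrC. Qed.

Lemma dotvDl n (u v w : 'rV[R]_n) : dotv (u + v) w = dotv u w + dotv v w.
Proof. by rewrite /dotv mulmxDl mxE. Qed.

Lemma dotvDr n (u v w : 'rV[R]_n) : dotv w (u + v) = dotv w u + dotv w v.
Proof. by rewrite ![dotv w _]dotvC dotvDl. Qed.

Lemma dotvZr n a (v w : 'rV[R]_n) : dotv v (a *: w) = a * dotv v w.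
Proof. by rewrite ![dotv v _]dotvC dotvZl. Qed.

Lemma dotvNl n (v w : 'rV[R]_n) : dotv (- v) w = - dotv v w.
Proof. by rewrite -scaleN1r dotvZl mulN1r. Qed.

Lemma dotvNr n (v w : 'rV[R]_n) : dotv v (- w) = - dotv v w.
Proof. by rewrite dotvC dotvNl dotvC. Qed.

Lemma dotvBl n (u v w : 'rV[R]_n) : dotv (u - v) w = dotv u w - dotv v w.
Proof. by rewrite dotvDl dotvNl. Qed.

Lemma dotvBr n (u v w : 'rV[R]_n) : dotv w (u - v) = dotv w u - dotv w v.
Proof. by rewrite dotvDr dotvNr. Qed.

Lemma dotv0l n (w : 'rV[R]_n) : dotv 0 w = 0.
Proof. by rewrite /dotv mul0mx mxE. Qed.

Lemma dotv0r n (w : 'rV[R]_n) : dotv w 0 = 0.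
Proof. by rewrite dotvC dotv0l. Qed.

Definition dotvL := (@dotvDl, @dotvDr, @dotvBl, @dotvBr, @dotvZl R, @dotvZr,
  @dotvNl, @dotvNr, @dotv0l, @dotv0r).

Lemma dotv_ge0 n (v : 'rV[R]_n) : 0 <= dotv v v.
Proof. by rewrite dotvE sumr_ge0 // => i _; rewrite -expr2 sqr_ge0. Qed.

Lemma dotvv_eq0 n (v : 'rV[R]_n) : (dotv v v == 0) = (v == 0).
Proof.
apply/eqP/eqP => [|->]; last exact: dotv0l.
rewrite dotvE => /psumr_eq0P h; apply/rowP => i; rewrite mxE; apply/eqP.
rewrite -sqrf_eq0 expr2; apply/eqP/h => // j _; exact: sqr_ge0.
Qed.

Lemma dotv_gt0 n (v : 'rV[R]_n) : (0 < dotv v v) = (v != 0).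
Proof. by rewrite lt_neqAle dotv_ge0 andbT eq_sym dotvv_eq0. Qed.

Lemma dotv_row_mx n m (a c : 'rV[R]_n) (b d : 'rV[R]_m) :
  dotv (row_mx a b) (row_mx c d) = dotv a c + dotv b d.
Proof. by rewrite /dotv tr_row_mx mul_row_col mxE. Qed.

Lemma dotv_mulmx n m (u : 'rV[R]_m) (A : 'M[R]_(m, n)) (v : 'rV[R]_n) :
  dotv (u *m A) v = \sum_i u 0 i * dotv (row i A) v.
Proof. by rewrite dotvC dotv_sumr; apply: eq_bigr => i _; rewrite dotvC. Qed.

Lemma dotv_suml (I : Type) (r : seq I) (P : pred I) n (f : I -> 'rV[R]_n) v :
  dotv (\sum_(i <- r | P i) f i) v = \sum_(i <- r | P i) dotv (f i) v.
Proof.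
by elim/big_rec2: _ => [|i x y _ <-]; rewrite ?dotv0l ?dotvDl.
Qed.

End Dot.

Section Rules.
Context {R : realType} {V : normedModType R} {n : nat}.
Implicit Types (F G : V -> 'rV[R]_n) (f g : V -> R) (U : set V).

Lemma derive_mulr f g p v : differentiable f p -> differentiable g p ->
  'D_v (fun q => f q * g q) p = 'D_v f p * g p + f p * 'D_v g p.
Proof.
move=> df dg; rewrite [LHS]deriveM; [|exact: diff_derivable..].
by rewrite addrC [X in X + _]mulrC.
Qed.

Lemma derive_dotv F G p v : differentiable F p -> differentiable G p ->
  'D_v (fun q => dotv (F q) (G q)) p = dotv ('D_v F p) (G p) + dotv (F p) ('D_v G p).
Proof.
move=> dF dG; have dFk k := (differentiable_row F p).2 dF k.
have dGk k := (differentiable_row G p).2 dG k.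
rewrite (_ : (fun q => dotv (F q) (G q)) =
  \sum_k ((fun q => F q 0 k) * (fun q => G q 0 k))); last first.
  by apply/funext => q; rewrite dotvE fct_sumE.
rewrite derive_sum => [|k]; last by apply/diff_derivable/differentiableM.
rewrite !dotvE -big_split; apply: eq_bigr => k _ /=.
rewrite [LHS]derive_mulr // !derive_row //; exact: diff_derivable.
Qed.

Lemma differentiable_dotv F G p : differentiable F p -> differentiable G p ->
  differentiable (fun q => dotv (F q) (G q)) p.
Proof.
move=> dF dG; have dFk k := (differentiable_row F p).2 dF k.
have dGk k := (differentiable_row G p).2 dG k.
rewrite (_ : (fun q => dotv (F q) (G q)) =
  \sum_k ((fun q => F q 0 k) * (fun q => G q 0 k))); last first.
  by apply/funext => q; rewrite dotvE fct_sumE.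
by apply: differentiable_sum => k; apply: differentiableM.
Qed.

Lemma derive_scalev f F p v : differentiable f p -> differentiable F p ->
  'D_v (fun q => f q *: F q) p = 'D_v f p *: F p + f p *: 'D_v F p.
Proof.
move=> df dF; have dFk k := (differentiable_row F p).2 dF k.
apply/rowP => k; rewrite derive_row; last first.
  apply/diff_derivable/differentiable_row => j; under eq_fun do rewrite mxE.
  exact: differentiableM.
under eq_fun do rewrite mxE.
by rewrite derive_mulr // !mxE derive_row //; exact: diff_derivable.
Qed.

Lemma derive_addr (W : normedModType R) (f g : V -> W) p v :
  differentiable f p -> differentiable g p ->
  'D_v (fun q => f q + g q) p = 'D_v f p + 'D_v g p.
Proof. by move=> df dg; rewrite [LHS]deriveD //; exact: diff_derivable. Qed.

Lemma derive_eq_on (W : normedModType R) (F G : V -> W) U p v :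
  open U -> U p -> (forall q, U q -> F q = G q) -> 'D_v F p = 'D_v G p.
Proof.
move=> oU Up FG; apply: near_eq_derive; near=> q; apply: FG.
by near: q; exact: open_nbhs_nbhs.
Unshelve. all: by end_near. Qed.

Lemma smooth_dotv U F G : open U -> smooth_on U F -> smooth_on U G ->
  smooth_on U (fun q => dotv (F q) (G q)).
Proof.
move=> oU /smooth_row sF /smooth_row sG.
rewrite (_ : (fun q => _) = fun q => \sum_i F q 0 i * G q 0 i); last first.
  by apply/funext => q; rewrite dotvE.
apply: smooth_sum => // i _.
by apply: smoothM => //; [exact: sF|exact: sG].
Qed.

Lemma smooth_scalev U f F : open U -> smooth_on U f -> smooth_on U F ->
  smooth_on U (fun q => f q *: F q).
Proof.
move=> oU sf /smooth_row sF; apply/smooth_row => // k.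
by under eq_fun do rewrite mxE; apply: smoothM => //; exact: sF.
Qed.

Lemma schwarz_row U F p u v : open U -> U p -> smooth_on U F ->
  'D_v ('D_u F) p = 'D_u ('D_v F) p.
Proof.
move=> oU Up sF; have sFk k : smooth_on U (fun q => F q 0 k).
  by move: k; apply/(smooth_row F oU).
have dD w1 w2 : derivable ('D_w1 F) p w2.
  by apply/diff_derivable/(smooth_diff _ Up)/smooth_deriv.
have DE w k q : U q -> ('D_w F q) 0 k = 'D_w (fun q => F q 0 k) q.
  by move=> Uq; rewrite derive_row //; exact/diff_derivable/(smooth_diff sF).
apply/rowP => k.
apply: etrans (derive_row k (dD u v)) _.
apply: etrans (derive_eq_on v oU Up (DE u k)) _.
apply: etrans _ (esym (derive_row k (dD v u))).
apply: etrans _ (esym (derive_eq_on u oU Up (DE v k))).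
exact: (schwarz u v oU Up (sFk k)).
Qed.

Lemma locally_constant_row U F p : open U -> U p -> smooth_on U F ->
  (forall q v, U q -> 'D_v F q = 0) -> \forall q \near p, F q = F p.
Proof.
move=> oU Up sF DF.
have : \forall q \near p, forall k, F q 0 k = F p 0 k.
  apply: filter_forall => k; apply: (locally_constant oU Up).
    by move=> q Uq; exact: (differentiable_row F q).2 (smooth_diff sF Uq) k.
  move=> q v Uq; rewrite -derive_row ?DF ?mxE //.
  exact/diff_derivable/(smooth_diff sF).
by apply: filterS => q Fq; apply/rowP.
Qed.

End Rules.

Section Cross.
Context {R : realType} {V : normedModType R}.

Lemma smooth_vec3 (U : set V) (a b c : V -> R) : open U ->
  smooth_on U a -> smooth_on U b -> smooth_on U c ->
  smooth_on U (fun q => vec3 (a q) (b q) (c q)).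
Proof.
move=> oU sa sb sc; apply/smooth_row => // -[[|[|[|//]]] i] /=;
  by under eq_fun do rewrite mxE.
Qed.

Lemma smooth_crossv (U : set V) (F G : V -> 'rV[R]_3) : open U ->
  smooth_on U F -> smooth_on U G -> smooth_on U (fun q => crossv (F q) (G q)).
Proof.
move=> oU /smooth_row sF /smooth_row sG.
by apply: smooth_vec3 => //; apply: smoothB => //; apply: smoothM => //;
  [exact: sF|exact: sG|exact: sF|exact: sG|exact: sF|exact: sG
  |exact: sF|exact: sG|exact: sF|exact: sG|exact: sF|exact: sG].
Qed.

End Cross.

Section SmoothMatrix.
Context {R : realType} {V : normedModType R}.
Implicit Types (U : set V).

Lemma smooth_det n U (A : V -> 'M[R]_n) : open U ->
  (forall i j, smooth_on U (fun q => A q i j)) ->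
  smooth_on U (fun q => \det (A q)).
Proof.
move=> oU sA; rewrite /determinant.
apply: (@smooth_sum _ _ _ U _ _ _ (fun s q => (-1) ^+ odd_perm s * \prod_i A q i (s i))) => //.
move=> s _; apply: smoothM => //; first exact: smooth_cst.
by apply: (@smooth_prod _ _ U _ _ _ (fun i q => A q i (s i))) => // i _; exact: sA.
Qed.

Lemma smooth_invmx n U (A : V -> 'M[R]_n) i j : open U ->
  (forall i j, smooth_on U (fun q => A q i j)) ->
  (forall q, U q -> A q \in unitmx) ->
  smooth_on U (fun q => invmx (A q) i j).
Proof.
move=> oU sA uA.
have sadj : smooth_on U (fun q => \adj (A q) i j).
  under eq_fun do rewrite mxE /cofactor.
  apply: smoothM => //; first exact: smooth_cst.
  by apply: smooth_det => // k l; under eq_fun do rewrite !mxE; exact: sA.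
have d0 q : U q -> \det (A q) != 0 by move=> /uA; rewrite unitmxE unitfE.
apply: (smooth_eq oU _ (smoothM oU (smoothV oU d0 (smooth_det oU sA)) sadj)).
by move=> q Uq; rewrite /invmx uA // [RHS]mxE.
Qed.

End SmoothMatrix.

(** Locked, because unification would otherwise unfold partial derivatives to
    limits of difference quotients. *)
HB.lock Definition partial (R : realType) (W : normedModType R) (n : nat)
  (i : 'I_n) (F : 'rV[R]_n -> W) (p : 'rV[R]_n) : W := 'D_(unitv i) F p.
Arguments partial {R W n} i F p.

Section Partial.
Context {R : realType} {n : nat}.
Implicit Types (f g : 'rV[R]_n -> R) (U : set 'rV[R]_n).

Lemma partialE (W : normedModType R) i (F : 'rV[R]_n -> W) p :
  'D_(unitv i) F p = partial i F p.
Proof. by rewrite unlock. Qed.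

Lemma partialE_fun (W : normedModType R) i (F : 'rV[R]_n -> W) :
  'D_(unitv i) F = partial i F.
Proof. by rewrite unlock. Qed.

Lemma smooth_partial (W : normedModType R) U i (F : 'rV[R]_n -> W) :
  smooth_on U F -> smooth_on U (partial i F).
Proof. by rewrite -partialE_fun; exact: smooth_deriv. Qed.

Lemma partial_mul f g p i : differentiable f p -> differentiable g p ->
  partial i (fun q => f q * g q) p = partial i f p * g p + f p * partial i g p.
Proof. by rewrite -!partialE; exact: derive_mulr. Qed.

Lemma partial_sqr f p i : differentiable f p ->
  partial i (fun q => f q ^+ 2) p = 2 * f p * partial i f p.
Proof.
move=> df; under eq_fun do rewrite expr2.
by rewrite partial_mul //; ring.
Qed.

Lemma differentiable_sqr f p : differentiable f p ->
  differentiable (fun q => f q ^+ 2) p.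
Proof.
by move=> df; under eq_fun do rewrite expr2; exact: differentiableM.
Qed.

Lemma partial_inv f p i : f p != 0 -> differentiable f p ->
  partial i (fun q => (f q)^-1) p = - ((f p)^-1) ^+ 2 * partial i f p.
Proof.
move=> f0 df; rewrite -!partialE [LHS]deriveV //; last exact: diff_derivable.
by rewrite exprVn.
Qed.

Lemma partial_dotv m (F G : 'rV[R]_n -> 'rV[R]_m) p i :
  differentiable F p -> differentiable G p ->
  partial i (fun q => dotv (F q) (G q)) p =
    dotv (partial i F p) (G p) + dotv (F p) (partial i G p).
Proof. by rewrite -!partialE; exact: derive_dotv. Qed.

Lemma partial_scalev m f (F : 'rV[R]_n -> 'rV[R]_m) p i :
  differentiable f p -> differentiable F p ->
  partial i (fun q => f q *: F q) p = partial i f p *: F p + f p *: partial i F p.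
Proof. by rewrite -!partialE; exact: derive_scalev. Qed.

Lemma partial_add (W : normedModType R) (F G : 'rV[R]_n -> W) p i :
  differentiable F p -> differentiable G p ->
  partial i (fun q => F q + G q) p = partial i F p + partial i G p.
Proof. by rewrite -!partialE; exact: derive_addr. Qed.

Lemma partial_sub (W : normedModType R) (F G : 'rV[R]_n -> W) p i :
  differentiable F p -> differentiable G p ->
  partial i (fun q => F q - G q) p = partial i F p - partial i G p.
Proof.
by move=> dF dG; rewrite -!partialE [LHS]deriveB //; exact: diff_derivable.
Qed.

Lemma partial_offset m U f (F G : 'rV[R]_n -> 'rV[R]_m) p i : U p ->
  smooth_on U F -> smooth_on U f -> smooth_on U G ->
  partial i (fun q => F q + f q *: G q) p =
    partial i F p + (partial i f p *: G p + f p *: partial i G p).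
Proof.
move=> Up sF sf sG; have df := smooth_diff sf Up; have dG := smooth_diff sG Up.
rewrite partial_add ?partial_scalev //; first exact: smooth_diff sF Up.
apply/differentiable_row => k; under eq_fun do rewrite mxE.
by apply: differentiableM => //; exact: (differentiable_row G p).2 dG k.
Qed.

Lemma partial_cst (W : normedModType R) (c : W) p (i : 'I_n) :
  partial i (fun=> c) p = 0.
Proof. by rewrite -partialE; exact: derive_cst. Qed.

Lemma partial_eq_on (W : normedModType R) (F G : 'rV[R]_n -> W) U p i :
  open U -> U p -> (forall q, U q -> F q = G q) -> partial i F p = partial i G p.
Proof. by rewrite -!partialE; exact: derive_eq_on. Qed.

Lemma partial_cst_on (W : normedModType R) (F : 'rV[R]_n -> W) (c : W) U p i :
  open U -> U p -> (forall q, U q -> F q = c) -> partial i F p = 0.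
Proof.
by move=> oU Up Fc; rewrite (partial_eq_on i oU Up (G := fun=> c)) ?partial_cst.
Qed.

Lemma partialC m U (F : 'rV[R]_n -> 'rV[R]_m) p i j : open U -> U p ->
  smooth_on U F -> partial i (partial j F) p = partial j (partial i F) p.
Proof. by rewrite -!partialE -!partialE_fun; exact: schwarz_row. Qed.

Lemma row_jacobian N (F : 'rV[R]_n -> 'rV[R]_N) p i : differentiable F p ->
  row i ('J F p) = partial i F p.
Proof. by move=> dF; rewrite -partialE deriveEjacobian // rowE. Qed.

Lemma derive_partial (W : normedModType R) (F : 'rV[R]_n -> W) p v :
  differentiable F p -> 'D_v F p = \sum_j v 0 j *: partial j F p.
Proof.
move=> dF; rewrite deriveE // {1}[v]row_sum_delta linear_sum.
by apply: eq_bigr => j _; rewrite linearZ -partialE deriveE.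
Qed.

Lemma constant_near m U (F : 'rV[R]_n -> 'rV[R]_m) p : open U -> U p ->
  smooth_on U F -> (forall q j, U q -> partial j F q = 0) ->
  \forall q \near p, F q = F p.
Proof.
move=> oU Up sF DF; apply: (locally_constant_row oU Up sF) => q v Uq.
rewrite derive_partial; last exact: smooth_diff sF Uq.
by rewrite big1 // => j _; rewrite DF // scaler0.
Qed.

Lemma constant_near_real U f p : open U -> U p ->
  smooth_on U f -> (forall q j, U q -> partial j f q = 0) ->
  \forall q \near p, f q = f p.
Proof.
move=> oU Up sf Df; apply: (locally_constant oU Up).
  by move=> q Uq; exact: smooth_diff sf Uq.
move=> q v Uq; rewrite derive_partial; last exact: smooth_diff sf Uq.
by rewrite big1 // => j _; rewrite Df // scaler0.
Qed.

End Partial.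

Lemma partial_chain (R : realType) k n (W : normedModType R) (tau : 'rV[R]_k -> 'rV[R]_n)
    (F : 'rV[R]_n -> W) p i :
  differentiable tau p -> differentiable F (tau p) ->
  partial i (fun q => F (tau q)) p =
    \sum_j (partial i tau p) 0 j *: partial j F (tau p).
Proof.
move=> dt dF; rewrite -derive_partial // -!partialE deriveE; last first.
  exact: differentiable_comp.
by rewrite (diff_comp (f := tau)) //= !deriveE.
Qed.

(** * The second fundamental form of an immersion *)

Section Submanifold.
Context {R : realType} {n N : nat}.
Variables (F : 'rV[R]_n -> 'rV[R]_N) (U : set 'rV[R]_n).
Hypotheses (oU : open U) (sF : smooth_on U F).
Hypothesis (freeF : forall p, U p -> row_free ('J F p)).

Local Notation DF i := (partial i F).
Local Notation F2 i j := (partial i (partial j F)).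

Lemma partial2C p i j : U p -> F2 i j p = F2 j i p.
Proof. by move=> Up; exact: partialC oU Up sF. Qed.

Lemma mulmx_jacobian p u : U p -> u *m 'J F p = \sum_i u 0 i *: DF i p.
Proof.
move=> Up; rewrite mulmx_sum_row; apply: eq_bigr => i _.
by rewrite row_jacobian //; exact: smooth_diff sF Up.
Qed.

Lemma metricE p i j : U p -> metric F p i j = dotv (DF i p) (DF j p).
Proof.
move=> Up; have dF := smooth_diff sF Up.
by rewrite -!row_jacobian // /metric /dotv tr_row -row_mul !mxE;
  apply: eq_bigr => k _; rewrite !mxE.
Qed.

Lemma metric_unit p : U p -> metric F p \in unitmx.
Proof.
move=> Up; rewrite -row_free_unit; apply: inj_row_free => v vg.
have /eqP : dotv (v *m 'J F p) (v *m 'J F p) = 0.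
  by rewrite /dotv trmx_mul mulmxA -[v *m _ *m _]mulmxA -/(metric F p) vg mul0mx mxE.
rewrite dotvv_eq0 => /eqP vJ; apply: (row_free_inj (freeF Up)).
by rewrite vJ mul0mx.
Qed.

Lemma smooth_metric i j : smooth_on U (fun q => metric F q i j).
Proof.
apply: (smooth_eq oU _ (smooth_dotv oU (smooth_partial i sF) (smooth_partial j sF))).
by move=> p Up; rewrite metricE.
Qed.

Lemma derive_metric p k i j : U p -> partial k (fun q => metric F q i j) p =
  dotv (F2 k i p) (DF j p) + dotv (DF i p) (F2 k j p).
Proof.
move=> Up.
apply: etrans (partial_eq_on k oU Up (fun q Uq => metricE i j Uq)) _.
by apply: partial_dotv; apply: (smooth_diff (smooth_partial _ sF) Up).
Qed.

(** The derivatives of the metric coefficients are sums of products of second and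
    first derivatives of F; all but one cancel in the Christoffel combination. *)
Lemma christoffelE p i j l : U p ->
  \sum_k christoffel F p k i j * metric F p k l = dotv (F2 i j p) (DF l p).
Proof.
move=> Up; pose w : 'rV[R]_n := \row_l (2^-1 * (
    partial i (fun q => metric F q j l) p
     + partial j (fun q => metric F q i l) p
     - partial l (fun q => metric F q i j) p)).
have gT : (metric F p)^T = metric F p by rewrite /metric trmx_mul trmxK.
have -> : \sum_k christoffel F p k i j * metric F p k l
    = (w *m (invmx (metric F p))^T *m metric F p) 0 l.
  rewrite [RHS]mxE; apply: eq_bigr => k _; congr (_ * _).
  rewrite [RHS]mxE /christoffel mulr_sumr; apply: eq_bigr => m _.
  by rewrite !mxE !partialE; ring.
rewrite trmx_inv gT -mulmxA mulVmx ?metric_unit // mulmx1 mxE.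
rewrite !derive_metric //.
rewrite (partial2C l i Up) (partial2C l j Up) (partial2C j i Up).
rewrite [dotv (DF j p) _]dotvC [dotv (DF i p) _]dotvC.
by field.
Qed.

Lemma second_fundamental_formE i j p : U p ->
  second_fundamental_form F (cst (unitv i)) (cst (unitv j)) p =
  F2 i j p - \sum_k christoffel F p k i j *: DF k p.
Proof.
move=> Up; rewrite /second_fundamental_form; congr (_ - _).
  rewrite partialE; apply: (partial_eq_on _ oU Up) => q Uq.
  by rewrite /cst -rowE row_jacobian //; exact: smooth_diff sF Uq.
rewrite mulmx_jacobian //; apply: eq_bigr => k _; congr (_ *: _).
rewrite /levi_civita [X in X + _]derive_cst add0r mxE.
rewrite (bigD1 i) //= (bigD1 j) //= !mxE !eqxx !mulr1 big1 ?addr0; last first.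
  by move=> l lj; rewrite !mxE (negbTE lj) mulr0.
rewrite big1 ?addr0 // => l li; rewrite big1 // => m _.
by rewrite !mxE (negbTE li) mulr0 mul0r.
Qed.

Lemma second_fundamental_form_normal i j l p : U p ->
  dotv (second_fundamental_form F (cst (unitv i)) (cst (unitv j)) p) (DF l p) = 0.
Proof.
move=> Up; rewrite second_fundamental_formE // dotvBl -christoffelE //.
rewrite [X in _ - X](_ : _ = \sum_k christoffel F p k i j * metric F p k l) ?subrr //.
rewrite dotvC; pose v := \row_k christoffel F p k i j.
transitivity (dotv (DF l p) (v *m 'J F p)).
  by rewrite mulmx_jacobian //; congr dotv; apply: eq_bigr => k _; rewrite mxE.
rewrite dotv_sumr; apply: eq_bigr => k _.
by rewrite metricE // row_jacobian ?mxE 1?dotvC //; exact: smooth_diff sF Up.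
Qed.

Lemma mean_curvature_normal l p : U p -> dotv (mean_curvature F p) (DF l p) = 0.
Proof.
move=> Up; rewrite dotv_suml big1 // => i _; rewrite dotv_suml big1 // => j _.
by rewrite dotvZl second_fundamental_form_normal // mulr0.
Qed.

Lemma smooth_christoffel k i j : smooth_on U (fun q => christoffel F q k i j).
Proof.
apply: smoothM => //; first exact: smooth_cst.
apply: smooth_sum => // l _; apply: smoothM => //.
  by apply: smooth_invmx => // [i' j'|q]; [exact: smooth_metric|exact: metric_unit].
by apply: smoothB => //; [apply: smoothD => //|];
  rewrite partialE_fun; apply: smooth_partial; exact: smooth_metric.
Qed.

Lemma smooth_mean_curvature : smooth_on U (mean_curvature F).
Proof.
apply: (@smooth_eq _ _ _ _ (fun q => \sum_i \sum_j invmx (metric F q) i j *: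
    (F2 i j q - \sum_k christoffel F q k i j *: DF k q))) => //.
  move=> q Uq; apply: eq_bigr => i _; apply: eq_bigr => j _.
  by rewrite second_fundamental_formE.
apply: smooth_sum => // i _; apply: smooth_sum => // j _; apply: smooth_scalev => //.
  by apply: smooth_invmx => // [i' j'|q]; [exact: smooth_metric|exact: metric_unit].
apply: smoothB => //; first by do 2! apply: smooth_partial.
apply: smooth_sum => // k _; apply: smooth_scalev => //.
  exact: smooth_christoffel.
by apply: smooth_partial.
Qed.

(** Differentiating <H, F_c> = 0 moves the derivative from H to F, so that the
    shape operator along H is expressed by H itself. *)
Lemma shape_operator_metric p X c : U p ->
  (shape_operator F (mean_curvature F) p X *m metric F p) 0 c =
  \sum_a X 0 a * dotv (mean_curvature F p) (F2 a c p).
Proof.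
move=> Up; rewrite /shape_operator /tangential mulNmx -[_ *m invmx _ *m _]mulmxA.
rewrite mulVmx ?metric_unit // mulmx1.
have dH := smooth_diff smooth_mean_curvature Up.
have -> : (- ('D_X (mean_curvature F) p *m ('J F p)^T)) 0 c
   = - dotv ('D_X (mean_curvature F) p) (DF c p).
  rewrite -row_jacobian; last exact: smooth_diff sF Up.
  rewrite mxE dotvE; congr (- _); rewrite mxE.
  by apply: eq_bigr => k _; rewrite [_^T _ _]mxE [row _ _ _ _]mxE.
rewrite (derive_partial X dH) dotv_suml -sumrN; apply: eq_bigr => a _.
rewrite dotvZl -mulrN; congr (_ * _).
have : partial a (fun q => dotv (mean_curvature F q) (DF c q)) p = 0.
  by apply: (partial_cst_on (c := 0) _ oU Up) => q; exact: mean_curvature_normal.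
rewrite partial_dotv //; last exact: (smooth_diff (smooth_partial _ sF) Up).
by move/eqP; rewrite addrC addr_eq0 => /eqP ->.
Qed.

End Submanifold.

(** * Lagrangian immersions and their cubic forms *)

Section ComplexJ.
Context {R : realType} {n : nat}.
Implicit Types u v w : 'rV[R]_(n + n).

Lemma complexJ_row_mx (a b : 'rV[R]_n) : complexJ (row_mx a b) = row_mx (- b) a.
Proof. by rewrite /complexJ row_mxKl row_mxKr. Qed.

Lemma complexJD u v : complexJ (u + v) = complexJ u + complexJ v.
Proof. by rewrite /complexJ !linearD /= add_row_mx. Qed.

Lemma complexJZ a u : complexJ (a *: u) = a *: complexJ u.
Proof. by rewrite /complexJ !linearZ /= scale_row_mx scalerN. Qed.

Lemma complexJ0 : complexJ (0 : 'rV[R]_(n + n)) = 0.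
Proof. by rewrite -[0 in LHS](scale0r 0) complexJZ scale0r. Qed.

Lemma complexJK u : complexJ (complexJ u) = - u.
Proof. by rewrite -[u]hsubmxK !complexJ_row_mx -opp_row_mx. Qed.

Lemma complexJ_inj : injective (@complexJ R n).
Proof. by move=> u v /(congr1 complexJ); rewrite !complexJK => /oppr_inj. Qed.

Lemma dotv_complexJ u v : dotv (complexJ u) v = - dotv u (complexJ v).
Proof.
rewrite -[u]hsubmxK -[v]hsubmxK !complexJ_row_mx !dotv_row_mx.
by rewrite dotvNl dotvNr opprD opprK addrC.
Qed.

Lemma complexJ_sum (I : Type) (r : seq I) (P : pred I) (f : I -> 'rV[R]_(n + n)) :
  complexJ (\sum_(i <- r | P i) f i) = \sum_(i <- r | P i) complexJ (f i).
Proof. by elim/big_rec2: _ => [|i x y _ <-]; rewrite ?complexJ0 ?complexJD. Qed.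

(** Each F_i is orthogonal to each J F_j, so that together they form a basis of
    the ambient space, and a normal vector is a combination of the J F_j. *)
Lemma lagrangian_criterion (F : 'rV[R]_n -> 'rV[R]_(n + n)) p :
  row_free ('J F p) ->
  (forall i j, dotv (row i ('J F p)) (complexJ (row j ('J F p))) = 0) ->
  lagrangian_at F p.
Proof.
set A := 'J F p => fA LA.
pose B := \matrix_i complexJ (row i A).
have JA (u : 'rV[R]_n) : complexJ (u *m A) = u *m B.
  rewrite !mulmx_sum_row complexJ_sum; apply: eq_bigr => i _.
  by rewrite complexJZ rowK.
have AB (u w : 'rV[R]_n) : dotv (u *m A) (w *m B) = 0.
  rewrite dotv_mulmx big1 // => i _; rewrite dotv_sumr big1 ?mulr0 // => j _.
  by rewrite rowK LA mulr0.
have fAB : row_free (col_mx A B).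
  apply: inj_row_free => v; rewrite -[v]hsubmxK mul_row_col.
  set a := lsubmx v; set b := rsubmx v => ab0.
  have a0 : a *m A = 0.
    apply/eqP; rewrite -dotvv_eq0 -[X in dotv _ X]addr0.
    have -> : dotv (a *m A) (a *m A + 0) = dotv (a *m A) (a *m A + b *m B).
      by rewrite !dotvDr dotv0r AB.
    by rewrite ab0 dotv0r.
  have b0 : b *m A = 0 by apply: complexJ_inj; rewrite JA complexJ0 -ab0 a0 add0r.
  rewrite (row_free_inj fA (etrans a0 (esym (mul0mx _ _)))).
  by rewrite (row_free_inj fA (etrans b0 (esym (mul0mx _ _)))) row_mx0.
have normB v : (forall u : 'rV[R]_n, dotv v (u *m A) = 0) -> exists w : 'rV[R]_n, v = w *m B.
  move=> nv; have : (v <= col_mx A B)%MS by apply: submx_full; rewrite row_full_unit -row_free_unit.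
  move=> /submxP[w]; rewrite -[w]hsubmxK mul_row_col => vE.
  have : dotv (lsubmx w *m A) (lsubmx w *m A) = 0.
    by rewrite -(nv (lsubmx w)) vE dotvDl [X in _ = _ + X]dotvC AB addr0.
  by move/eqP; rewrite dotvv_eq0 => /eqP w0; exists (rsubmx w); rewrite vE w0 add0r.
have tanN v : normal F p v <-> forall u : 'rV[R]_n, dotv v (u *m A) = 0.
  split=> [nv u|nv w /submxP[u ->]]; last exact: nv.
  by apply: nv; rewrite /tangent /= submxMl.
split; apply/seteqP; split.
- move=> _ [w /submxP[u ->] <-]; apply/tanN => u'.
  by rewrite JA dotvC AB.
- move=> v /tanN/normB[w ->]; exists (w *m A); first by rewrite /tangent /= submxMl.
  exact: JA.
- move=> _ [v /tanN/normB[w ->] <-].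
  by rewrite -JA complexJK -mulNmx /tangent /= submxMl.
- move=> _ /submxP[u ->]; exists (- u *m B); last first.
    by rewrite -JA complexJK mulNmx opprK.
  by apply/tanN => u'; rewrite dotvC AB.
Qed.

End ComplexJ.

(** For a Lagrangian immersion the second fundamental form is determined by the
    cubic form C(a, b, c) = <F_ab, J F_c>, so that being Maslovian is a system
    of equations for the coordinates of JH. *)
Section CubicForm.
Context {R : realType} {n : nat}.
Variables (F : 'rV[R]_n -> 'rV[R]_(n + n)) (U : set 'rV[R]_n).
Hypotheses (oU : open U) (sF : smooth_on U F).
Hypothesis (freeF : forall p, U p -> row_free ('J F p)).

Definition cubic_form p a b c :=
  dotv (partial a (partial b F) p) (complexJ (partial c F p)).

Lemma maslovian_cubic p : U p -> lagrangian_at F p ->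
  maslovian_at F p <->
  exists X : 'rV[R]_n, [/\ X != 0,
    forall c, (X *m metric F p) 0 c =
      - \sum_a \sum_b invmx (metric F p) a b * cubic_form p a b c &
    exists lambda, forall c, - \sum_a \sum_b X 0 a * X 0 b * cubic_form p a c b =
      lambda * (X *m metric F p) 0 c].
Proof.
move=> Up lagF; have dF := smooth_diff sF Up; set H := mean_curvature F.
have tanP X : tangent F p (X *m 'J F p) by rewrite /tangent /= submxMl.
have nH : normal F p (H p).
  move=> w /submxP[u ->]; rewrite (mulmx_jacobian sF) // dotvC dotv_suml big1 // => i _.
  by rewrite dotvZl dotvC (mean_curvature_normal oU sF) ?mulr0.
have [X XE] : exists X, X *m 'J F p = complexJ (H p).
  have [_ /seteqP[JN _]] := lagF.
  have /submxP[X XE] : tangent F p (complexJ (H p)) by apply: JN; exists (H p).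
  by exists X.
have gE (Y : 'rV[R]_n) c : (Y *m metric F p) 0 c = dotv (Y *m 'J F p) (partial c F p).
  rewrite -row_jacobian // /metric mulmxA mxE dotvE; apply: eq_bigr => k _.
  by rewrite [_^T _ _]mxE [row _ _ _ _]mxE.
have injY (Y Z : 'rV[R]_n) : (forall c, (Y *m metric F p) 0 c = (Z *m metric F p) 0 c) -> Y = Z.
  move=> YZ; have fg : row_free (metric F p).
    by rewrite row_free_unit (metric_unit freeF).
  by apply: (row_free_inj fg); apply/rowP.
have FJF k c : dotv (partial k F p) (complexJ (partial c F p)) = 0.
  have [/seteqP[JT _] _] := lagF.
  rewrite dotvC; apply: JT; last by rewrite -row_jacobian // /tangent /= row_sub.
  by exists (partial c F p) => //; rewrite -row_jacobian // /tangent /= row_sub.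
have XC c : (X *m metric F p) 0 c =
      - \sum_a \sum_b invmx (metric F p) a b * cubic_form p a b c.
  rewrite gE XE dotv_complexJ dotv_suml; congr (- _); apply: eq_bigr => a _.
  rewrite dotv_suml; apply: eq_bigr => b _; rewrite dotvZl; congr (_ * _).
  rewrite (second_fundamental_formE oU sF) // dotvBl dotv_suml big1 ?subr0 // => k _.
  by rewrite dotvZl FJF mulr0.
have HE : H p = - complexJ (X *m 'J F p) by rewrite XE complexJK opprK.
have X0 : (X == 0) = (H p == 0).
  apply/eqP/eqP => [X0|H0]; first by rewrite HE X0 mul0mx complexJ0 oppr0.
  apply: (row_free_inj (freeF Up)); rewrite mul0mx XE H0; exact: complexJ0.
have SE c : (shape_operator F H p X *m metric F p) 0 c =
    - \sum_a \sum_b X 0 a * X 0 b * cubic_form p a c b.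
  rewrite (shape_operator_metric oU sF) // -sumrN; apply: eq_bigr => a _.
  rewrite -/H HE dotvNl mulrN; congr (- _); rewrite dotvC (mulmx_jacobian sF) //.
  rewrite complexJ_sum dotvC dotv_suml mulr_sumr; apply: eq_bigr => b _.
  by rewrite complexJZ dotvZl dotvC mulrA.
split.
- move=> [_ H0 [Y [YE [l SY]]]].
  have YX : Y = X by apply: (row_free_inj (freeF Up)); rewrite YE XE.
  exists X; split; [by rewrite X0|exact: XC|].
  by exists l => c; rewrite -SE -YX SY -scalemxAl [LHS]mxE.
- move=> [Y [Y0 YC [l YS]]].
  have YX : Y = X by apply: injY => c; rewrite YC XC.
  rewrite YX in Y0 YS; split=> //; first by rewrite -X0.
  exists X; split=> //; exists l; apply: injY => c.
  by rewrite SE YS -scalemxAl [RHS]mxE.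
Qed.

End CubicForm.

(** * Maps that are affine along the fibres *)

Section SmoothCoordinates.
Context {R : realType}.

Lemma smooth_coord n k (U : set 'rV[R]_n) : smooth_on U (fun w : 'rV[R]_n => w 0 k).
Proof.
apply/smooth_onP => m.
have dk p : differentiable (fun w : 'rV[R]_n => w 0 k) p by exact: differentiable_coord.
case: m => [|m]; split=> // v.
have -> : 'D_v (fun w : 'rV[R]_n => w 0 k) = cst (v 0 k); last exact: Ck_cst.
apply/funext => p; rewrite -(derive_row k (F := id)) ?derive_id //.
Qed.

Lemma derive_lsubmx (W : normedModType R) n m (A : 'rV[R]_n -> W) v (w : 'rV[R]_(n + m)) :
  'D_v (fun w => A (lsubmx w)) w = 'D_(lsubmx v) A (lsubmx w).
Proof.
rewrite /derive (_ : (fun h => _) =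
  (fun h => h^-1 *: (A (h *: lsubmx v + lsubmx w) - A (lsubmx w)))) //.
apply/funext => h; congr (_ *: (A _ - _)).
by rewrite linearD linearZ.
Qed.

Lemma smooth_lsubmx (W : normedModType R) n m (A : 'rV[R]_n -> W) (U : set 'rV[R]_n) :
  smooth_on U A -> smooth_on [set w : 'rV[R]_(n + m) | U (lsubmx w)] (fun w => A (lsubmx w)).
Proof.
move=> sA s; have -> : iter_derive s (fun w : 'rV[R]_(n + m) => A (lsubmx w))
    = (fun w => iter_derive (map lsubmx s) A (lsubmx w)).
  by elim: s => //= v s ->; apply/funext => w; rewrite derive_lsubmx.
move=> w Uw; apply: differentiable_comp; first exact: differentiable_lsubmx.
exact: sA.
Qed.

Lemma open_lsubmx n m (U : set 'rV[R]_n) : open U ->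
  open [set w : 'rV[R]_(n + m) | U (lsubmx w)].
Proof.
move=> oU; apply: (@open_comp _ _ (fun w : 'rV[R]_(n + m) => lsubmx w)) => // w _.
exact/differentiable_continuous/differentiable_lsubmx.
Qed.

End SmoothCoordinates.

Section NormalForm.
Context {R : realType}.
Implicit Types (A B C : 'rV[R]_2 -> 'rV[R]_3) (U : set 'rV[R]_2) (w : 'rV[R]_(2 + 1)).

(** A class of maps that contains (p, t) |-> (y p, t N p) and is stable under
    partial differentiation: the term C is needed because the derivative of
    t N p along the fibre is N p. *)
Definition affine_fibre A C B w : 'rV[R]_(3 + 3) :=
  row_mx (A (lsubmx w)) (C (lsubmx w) + rsubmx w 0 0 *: B (lsubmx w)).

Definition base_index (i : 'I_2) : 'I_(2 + 1) := lshift 1 i.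
Definition fibre_index : 'I_(2 + 1) := rshift 2 0.

Lemma lsubmx_base i : lsubmx (unitv (base_index i)) = unitv i :> 'rV[R]_2.
Proof. by apply/rowP => j; rewrite !mxE eqxx /= (inj_eq (@lshift_inj _ _)). Qed.

Lemma lsubmx_fibre : lsubmx (unitv fibre_index) = 0 :> 'rV[R]_2.
Proof. by apply/rowP => j; rewrite !mxE eqxx /= eq_lrshift. Qed.

Lemma rsubmx_coord w : rsubmx w 0 0 = w 0 fibre_index.
Proof. by rewrite mxE; congr (w 0 _); apply/val_inj. Qed.

Variables (A C B : 'rV[R]_2 -> 'rV[R]_3) (U : set 'rV[R]_2).
Hypotheses (oU : open U) (sA : smooth_on U A) (sC : smooth_on U C) (sB : smooth_on U B).
Let U' : set 'rV[R]_(2 + 1) := [set w | U (lsubmx w)].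

Let oU' : open U'. Proof. exact: open_lsubmx. Qed.

Lemma smooth_affine_fibre : smooth_on U' (affine_fibre A C B).
Proof.
apply/smooth_row => // k; case: (splitP k) => j kj.
  apply: (@smooth_eq _ _ _ _ (fun w => (A (lsubmx w)) 0 j)) => // [w _|].
    by rewrite /affine_fibre (_ : k = lshift 3 j) ?row_mxEl //; apply/val_inj.
  by move: j {kj}; apply/smooth_row => //; exact: smooth_lsubmx.
apply: (@smooth_eq _ _ _ _ (fun w => (C (lsubmx w)) 0 j +
    w 0 fibre_index * (B (lsubmx w)) 0 j)) => // [w _|].
  rewrite /affine_fibre (_ : k = rshift 3 j) ?row_mxEr //; last exact/val_inj.
  by rewrite [RHS]mxE [X in _ = _ + X]mxE rsubmx_coord.
apply: smoothD => //; last (apply: smoothM => //; first exact: smooth_coord).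
  by move: j {kj}; apply/smooth_row => //; exact: smooth_lsubmx.
by move: j {kj}; apply/smooth_row => //; exact: smooth_lsubmx.
Qed.

Lemma derive_affine_fibre w v : U' w -> 'D_v (affine_fibre A C B) w =
  row_mx ('D_(lsubmx v) A (lsubmx w))
    ('D_(lsubmx v) C (lsubmx w) + (v 0 fibre_index *: B (lsubmx w)
      + rsubmx w 0 0 *: 'D_(lsubmx v) B (lsubmx w))).
Proof.
move=> Uw; have dA := smooth_diff sA Uw.
have dC := smooth_diff sC Uw; have dB := smooth_diff sB Uw.
have dt : differentiable (fun w : 'rV[R]_(2 + 1) => w 0 fibre_index) w.
  exact: differentiable_coord.
have Dt : 'D_v (fun w : 'rV[R]_(2 + 1) => w 0 fibre_index) w = v 0 fibre_index.
  by rewrite -(derive_row fibre_index (F := id)) ?derive_id.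
have dl (D : 'rV[R]_2 -> R) : differentiable D (lsubmx w) ->
   differentiable (fun w : 'rV[R]_(2 + 1) => D (lsubmx w)) w.
  by move=> dD; apply: differentiable_comp => //; exact: differentiable_lsubmx.
apply/rowP => k; rewrite derive_row; last exact/diff_derivable/(smooth_diff smooth_affine_fibre).
case: (splitP k) => j kj.
  have -> : k = lshift 3 j by exact/val_inj.
  have -> : (fun w => affine_fibre A C B w 0 (lshift 3 j)) = (fun w => A (lsubmx w) 0 j).
    by apply/funext => q; rewrite /affine_fibre row_mxEl.
  rewrite (derive_lsubmx (fun p => A p 0 j)) row_mxEl derive_row //.
  exact: diff_derivable.
have -> : k = rshift 3 j by exact/val_inj.
have -> : (fun w => affine_fibre A C B w 0 (rshift 3 j)) =
    (fun w => C (lsubmx w) 0 j + w 0 fibre_index * B (lsubmx w) 0 j).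
  by apply/funext => q; rewrite /affine_fibre row_mxEr mxE [X in _ + X]mxE rsubmx_coord.
have dBj := dl _ ((differentiable_row _ _).2 dB j).
rewrite derive_addr; [|exact: dl _ ((differentiable_row _ _).2 dC j)|exact: differentiableM].
rewrite derive_mulr // Dt.
rewrite (derive_lsubmx (fun p => C p 0 j)) (derive_lsubmx (fun p => B p 0 j)).
rewrite row_mxEr rsubmx_coord !mxE.
by rewrite !derive_row //; exact: diff_derivable.
Qed.

Lemma partial_affine_base i w : U' w -> partial (base_index i) (affine_fibre A C B) w =
  affine_fibre (partial i A) (partial i C) (partial i B) w.
Proof.
move=> Uw; rewrite -partialE derive_affine_fibre // lsubmx_base !partialE.
by rewrite mxE eqxx /= eq_rlshift /= scale0r add0r.
Qed.

Lemma partial_affine_fibre w : U' w -> partial fibre_index (affine_fibre A C B) w =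
  affine_fibre (fun=> 0) B (fun=> 0) w.
Proof.
move=> Uw; rewrite -partialE derive_affine_fibre // lsubmx_fibre !derive0.
by rewrite /affine_fibre mxE !eqxx /= scale1r !scaler0 add0r.
Qed.

End NormalForm.

(** * The fundamental forms of a surface *)

Lemma ord2P (i : 'I_2) : i = 0 \/ i = 1.
Proof. by case: i => -[|[|//]] hi; [left|right]; apply/val_inj. Qed.

Lemma sum_ord2 (V : nmodType) (f : 'I_2 -> V) : \sum_i f i = f 0 + f 1.
Proof.
rewrite !big_ord_recl big_ord0 addr0; congr (_ + f _); exact/val_inj.
Qed.

(** Locked, because unification would otherwise unfold the cross products. *)
HB.lock Definition surface_normal (R : realType) (y : 'rV[R]_2 -> 'rV[R]_3)
  (p : 'rV[R]_2) : 'rV[R]_3 := unit_normal y p.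
Arguments surface_normal {R} y p.

Section SurfaceForms.
Context {R : realType}.
Implicit Types (y : 'rV[R]_2 -> 'rV[R]_3) (p : 'rV[R]_2) (i j l : 'I_2).

Definition first_form y p i j := dotv (partial i y p) (partial j y p).

Definition second_form y p i j :=
  - dotv (partial i y p) (partial j (surface_normal y) p).

(** The covariant derivative of the second fundamental form, free of Christoffel
    symbols. *)
Definition cubic_surface y p i j l :=
  dotv (partial i (partial j y) p) (partial l (surface_normal y) p) -
  dotv (partial i (partial j (surface_normal y)) p) (partial l y p).

Definition area2 y p :=
  first_form y p 0 0 * first_form y p 1 1 - first_form y p 0 1 ^+ 2.

(** The trace of the shape operator, which is twice the usual mean curvature. *)
Definition mean2 y p := (first_form y p 1 1 * second_form y p 0 0
  - 2 * first_form y p 0 1 * second_form y p 0 1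
  + first_form y p 0 0 * second_form y p 1 1) / area2 y p.

Definition gauss y p := (second_form y p 0 0 * second_form y p 1 1
  - second_form y p 0 1 ^+ 2) / area2 y p.

(** The vector dual to the covector u for the first fundamental form is in the
    kernel of the second one; the dual is scaled by area2, to be polynomial. *)
Definition second_form_null y p (u : 'I_2 -> R) := forall k,
  second_form y p k 0 * (first_form y p 1 1 * u 0 - first_form y p 0 1 * u 1)
  + second_form y p k 1 * (first_form y p 0 0 * u 1 - first_form y p 0 1 * u 0) = 0.

Lemma first_formC y p i j : first_form y p i j = first_form y p j i.
Proof. exact: dotvC. Qed.

Lemma lagrange_identity (u v : 'rV[R]_3) : dotv (crossv u v) (crossv u v) =
  dotv u u * dotv v v - dotv u v ^+ 2.
Proof. by rewrite !dotvE3 cross0 cross1 cross2; ring. Qed.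

Lemma cross_parseval (a b u v : 'rV[R]_3) :
  (dotv a a * dotv b b - dotv a b ^+ 2) * dotv u v =
  dotv u (crossv a b) * dotv v (crossv a b) +
  dotv b b * (dotv u a * dotv v a) -
  dotv a b * (dotv u a * dotv v b + dotv u b * dotv v a) +
  dotv a a * (dotv u b * dotv v b).
Proof. by rewrite !dotvE3 cross0 cross1 cross2; ring. Qed.

End SurfaceForms.

Section Surface.
Context {R : realType}.
Variables (y : 'rV[R]_2 -> 'rV[R]_3) (U : set 'rV[R]_2).
Hypotheses (oU : open U) (sy : smooth_on U y).
Hypothesis (fy : forall p, U p -> row_free ('J y p)).
Implicit Types (p : 'rV[R]_2) (i j l : 'I_2).

Local Notation N := (surface_normal y).
Local Notation y1 i := (partial i y).
Local Notation N1 i := (partial i N).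
Local Notation y2 i j := (partial i (partial j y)).
Local Notation N2 i j := (partial i (partial j N)).
Local Notation g := (first_form y).
Local Notation h := (second_form y).
Local Notation c := (cubic_surface y).

Let cr p := crossv (y1 0 p) (y1 1 p).

Lemma surface_normalE p : U p -> N p = (enorm (cr p))^-1 *: cr p.
Proof.
by move=> Up; rewrite unlock /unit_normal !row_jacobian //; exact: smooth_diff sy Up.
Qed.

Lemma area2E p : area2 y p = dotv (cr p) (cr p).
Proof. by rewrite lagrange_identity. Qed.

Lemma area2_gt0 p : U p -> 0 < area2 y p.
Proof.
move=> Up; rewrite area2E dotv_gt0 /cr -!row_jacobian; try exact: smooth_diff sy Up.
exact/cross_neq0/fy.
Qed.

Lemma area2_neq0 p : U p -> area2 y p != 0.
Proof. by move=> Up; rewrite gt_eqF // area2_gt0. Qed.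

Lemma dotv_normal p u : U p -> dotv u (N p) = dotv u (cr p) / Num.sqrt (area2 y p).
Proof. by move=> Up; rewrite surface_normalE // dotvZr area2E mulrC. Qed.

Lemma normal_unit p : U p -> dotv (N p) (N p) = 1.
Proof.
move=> Up; have a0 := area2_gt0 Up; have s0 : 0 < Num.sqrt (area2 y p) by rewrite sqrtr_gt0.
rewrite dotv_normal // dotvC dotv_normal // -area2E -mulrA -invfM -expr2 sqr_sqrtr ?ltW //.
by rewrite divff // gt_eqF.
Qed.

Lemma normal_tangent p i : U p -> dotv (N p) (y1 i p) = 0.
Proof.
move=> Up; rewrite surface_normalE // dotvZl.
by have [->|->] := ord2P i; rewrite /cr ?dotv_crossl ?dotv_crossr mulr0.
Qed.

Lemma tangent_normal p i : U p -> dotv (y1 i p) (N p) = 0.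
Proof. by move=> Up; rewrite dotvC normal_tangent. Qed.

(** The tangent vectors y_0, y_1 and the unit normal form a basis of space;
    this is Parseval's identity in it. *)
Lemma parseval p u v : U p -> area2 y p * dotv u v =
  area2 y p * (dotv u (N p) * dotv v (N p)) +
  g p 1 1 * (dotv u (y1 0 p) * dotv v (y1 0 p)) -
  g p 0 1 * (dotv u (y1 0 p) * dotv v (y1 1 p) + dotv u (y1 1 p) * dotv v (y1 0 p)) +
  g p 0 0 * (dotv u (y1 1 p) * dotv v (y1 1 p)).
Proof.
move=> Up; rewrite [LHS]cross_parseval -/(cr p) !dotv_normal //.
have a0 := area2_gt0 Up; have s0 : Num.sqrt (area2 y p) != 0 by rewrite sqrtr_eq0 -ltNge.
congr (_ + _ - _ + _).
have : Num.sqrt (area2 y p) ^+ 2 = area2 y p by rewrite sqr_sqrtr ?ltW.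
by move: (Num.sqrt _) s0 => s s0 <-; field.
Qed.

Lemma frame_eq0 p u : U p -> dotv u (N p) = 0 -> (forall i, dotv u (y1 i p) = 0) ->
  u = 0.
Proof.
move=> Up uN uy; apply/eqP; rewrite -dotvv_eq0.
have := parseval u u Up; rewrite uN !uy !(mul0r, mulr0, addr0, subr0) => /eqP.
by rewrite mulf_eq0 (negbTE (area2_neq0 Up)).
Qed.

Lemma smooth_cross : smooth_on U cr.
Proof. by apply: smooth_crossv => //; exact: smooth_partial. Qed.

Lemma smooth_normal : smooth_on U N.
Proof.
apply: (@smooth_eq _ _ _ _ (fun p => (Num.sqrt (area2 y p))^-1 *: cr p)) => // [p Up|].
  by rewrite surface_normalE // area2E.
apply: smooth_scalev => //; last exact: smooth_cross.
apply: smoothV => // [p Up|]; first by rewrite sqrtr_eq0 -ltNge area2_gt0.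
apply: smooth_sqrt => // [p|]; first exact: area2_gt0.
apply: (@smooth_eq _ _ _ _ (fun p => dotv (cr p) (cr p))) => // [p Up|].
  by rewrite area2E.
by apply: smooth_dotv => //; exact: smooth_cross.
Qed.

Lemma smooth_y1 i : smooth_on U (y1 i). Proof. exact: smooth_partial. Qed.
Lemma smooth_N1 i : smooth_on U (N1 i).
Proof. exact/smooth_partial/smooth_normal. Qed.

Let dy1 p i : U p -> differentiable (y1 i) p.
Proof. exact/smooth_diff/smooth_y1. Qed.
Let dN p : U p -> differentiable N p. Proof. exact/smooth_diff/smooth_normal. Qed.
Let dN1 p i : U p -> differentiable (N1 i) p.
Proof. exact/smooth_diff/smooth_N1. Qed.

Lemma y2C p i j : U p -> y2 i j p = y2 j i p.
Proof. by move=> Up; exact: partialC oU Up sy. Qed.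

Lemma N2C p i j : U p -> N2 i j p = N2 j i p.
Proof. by move=> Up; exact: partialC oU Up smooth_normal. Qed.

Lemma partial_normal p i : U p -> dotv (N1 i p) (N p) = 0.
Proof.
move=> Up; have : partial i (fun q => dotv (N q) (N q)) p = 0.
  by apply: (partial_cst_on (c := 1 : R) _ oU Up) => q; exact: normal_unit.
rewrite partial_dotv; [|exact: dN..].
by rewrite [dotv (N p) _]dotvC; lra.
Qed.

Lemma second_formE p i j : U p -> h p i j = dotv (y2 i j p) (N p).
Proof.
move=> Up; have : partial i (fun q => dotv (y1 j q) (N q)) p = 0.
  by apply: (partial_cst_on (c := 0 : R) _ oU Up) => q; exact: tangent_normal.
rewrite partial_dotv; [|exact: dy1|exact: dN].
move=> E; have E2 : partial j (fun q => dotv (y1 i q) (N q)) p = 0.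
  by apply: (partial_cst_on (c := 0 : R) _ oU Up) => q; exact: tangent_normal.
move: E2; rewrite partial_dotv; [|exact: dy1|exact: dN].
by rewrite (y2C i j Up) /second_form; lra.
Qed.

Lemma second_formC p i j : U p -> h p i j = h p j i.
Proof. by move=> Up; rewrite !second_formE // y2C. Qed.

Lemma dotv_N1 p i j : U p -> dotv (N1 i p) (y1 j p) = - h p i j.
Proof. by move=> Up; rewrite second_formC // /second_form opprK dotvC. Qed.

Lemma cubic_C12 p i j l : U p -> c p i j l = c p j i l.
Proof. by move=> Up; rewrite /cubic_surface y2C // N2C. Qed.

(** Differentiating the symmetry of h.  Together with cubic_C12 this is the
    Codazzi equation: the cubic form is totally symmetric. *)
Lemma cubic_C23 p i j l : U p -> c p i j l = c p i l j.
Proof.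
move=> Up.
have : partial i (fun q => dotv (y1 j q) (N1 l q) - dotv (y1 l q) (N1 j q)) p = 0.
  apply: (partial_cst_on (c := 0 : R) _ oU Up) => q Uq.
  by rewrite dotvC dotv_N1 // [dotv (y1 l q) _]dotvC dotv_N1 // second_formC // subrr.
rewrite partial_sub; first last.
- by apply: differentiable_dotv; [exact: dy1|exact: dN1].
- by apply: differentiable_dotv; [exact: dy1|exact: dN1].
rewrite !partial_dotv; [|exact: dy1|exact: dN1|exact: dy1|exact: dN1].
rewrite [dotv (y1 j p) _]dotvC [dotv (y1 l p) _]dotvC /cubic_surface; lra.
Qed.

(** The form <N_i, N_j> is that of the square of the shape operator, to which
    Cayley-Hamilton applies. *)
Lemma third_form p i j : U p ->
  dotv (N1 i p) (N1 j p) = mean2 y p * h p i j - gauss y p * g p i j.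
Proof.
move=> Up; apply: (mulfI (area2_neq0 Up)); rewrite parseval // !partial_normal //.
rewrite !dotv_N1 // /mean2 /gauss.
have h10 := second_formC 1 0 Up; have g10 := first_formC y p 1 0.
have := area2_neq0 Up; rewrite /area2 => a0.
by have [->|->] := ord2P i; have [->|->] := ord2P j; rewrite ?h10 ?g10; field.
Qed.

Lemma partial_first_form p l i j : U p -> partial l (fun q => g q i j) p =
  dotv (y2 l i p) (y1 j p) + dotv (y2 l j p) (y1 i p).
Proof.
move=> Up; rewrite /first_form partial_dotv; [|exact: dy1|exact: dy1].
by rewrite [dotv (y1 i p) _]dotvC.
Qed.

Lemma partial_second_form p l i j : U p -> partial l (fun q => h q i j) p =
  c p l i j - dotv (y2 l i p) (N1 j p) - dotv (y2 l j p) (N1 i p).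
Proof.
move=> Up; have -> : partial l (fun q => h q i j) p =
    - partial l (fun q => dotv (y1 i q) (N1 j q)) p.
  rewrite /second_form.
  have -> : (fun q => - dotv (y1 i q) (N1 j q)) =
      (fun q => (cst 0 q) - dotv (y1 i q) (N1 j q)) by apply/funext => q; rewrite sub0r.
  by rewrite partial_sub ?partial_cst ?sub0r //; apply: differentiable_dotv;
    [exact: dy1|exact: dN1].
rewrite partial_dotv; [|exact: dy1|exact: dN1].
have := cubic_C23 l i j Up; rewrite /cubic_surface [dotv (y1 i p) _]dotvC; lra.
Qed.

Lemma dotv_y2_N1 p l i j : U p -> area2 y p * dotv (y2 l i p) (N1 j p) =
  - (g p 1 1 * (dotv (y2 l i p) (y1 0 p) * h p j 0) -
  g p 0 1 * (dotv (y2 l i p) (y1 0 p) * h p j 1 + dotv (y2 l i p) (y1 1 p) * h p j 0) +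
  g p 0 0 * (dotv (y2 l i p) (y1 1 p) * h p j 1)).
Proof.
by move=> Up; rewrite parseval // partial_normal // !dotv_N1 //; ring.
Qed.

Lemma smooth_first_form i j : smooth_on U (fun q => g q i j).
Proof. by apply: smooth_dotv => //; exact: smooth_y1. Qed.

Lemma smooth_second_form i j : smooth_on U (fun q => h q i j).
Proof.
by apply: smoothN => //; apply: smooth_dotv => //; [exact: smooth_y1|exact: smooth_N1].
Qed.

Lemma smooth_area2 : smooth_on U (area2 y).
Proof.
apply: smoothB => //; last by apply: smoothX => //; exact: smooth_first_form.
by apply: smoothM => //; exact: smooth_first_form.
Qed.

Lemma smooth_mean2 : smooth_on U (mean2 y).
Proof.
have sg := smooth_first_form; have sh := smooth_second_form.
apply: smoothM => //; last by apply: smoothV => //; [exact: area2_neq0|exact: smooth_area2].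
apply: smoothD => //; last by apply: smoothM => //.
apply: smoothB => //; first by apply: smoothM => //.
apply: smoothM => //; apply: smoothM => //; exact: smooth_cst.
Qed.

Lemma smooth_gauss : smooth_on U (gauss y).
Proof.
have sh := smooth_second_form.
apply: smoothM => //; last by apply: smoothV => //; [exact: area2_neq0|exact: smooth_area2].
by apply: smoothB => //; [apply: smoothM|apply: smoothX].
Qed.

(** The adjugate matrix of h maps the vanishing vector of second_form_null to
    the multiple det h of the dual of u. *)
Lemma gauss_null p (u : 'I_2 -> R) : U p -> second_form_null y p u ->
  forall l, gauss y p * u l = 0.
Proof.
move=> Up H; have a0 := area2_neq0 Up; move: (H 0) (H 1); rewrite (second_formC 1 0 Up).
set w0 := _ - _; set w1 := _ - _ => H0 H1 l.
have K0 : gauss y p * area2 y p * w0 = 0.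
  transitivity (h p 1 1 * (h p 0 0 * w0 + h p 0 1 * w1)
    - h p 0 1 * (h p 0 1 * w0 + h p 1 1 * w1)); first by rewrite /gauss mulfVK //; ring.
  by rewrite H0 H1; ring.
have K1 : gauss y p * area2 y p * w1 = 0.
  transitivity (h p 0 0 * (h p 0 1 * w0 + h p 1 1 * w1)
    - h p 0 1 * (h p 0 0 * w0 + h p 0 1 * w1)); first by rewrite /gauss mulfVK //; ring.
  by rewrite H0 H1; ring.
apply: (mulfI a0); apply: (mulfI a0); rewrite !mulr0.
transitivity (gauss y p * area2 y p * (area2 y p * u l)); first by ring.
have [->|->] := ord2P l.
  transitivity (g p 0 0 * (gauss y p * area2 y p * w0) + g p 0 1 * (gauss y p * area2 y p * w1)).
    by rewrite /w0 /w1 /area2; ring.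
  by rewrite K0 K1; ring.
transitivity (g p 0 1 * (gauss y p * area2 y p * w0) + g p 1 1 * (gauss y p * area2 y p * w1)).
  by rewrite /w0 /w1 /area2; ring.
by rewrite K0 K1; ring.
Qed.

End Surface.

(** * Derivatives of the mean and Gauss curvatures *)

Section CurvatureDerivatives.
Context {R : realType}.
Variables (y : 'rV[R]_2 -> 'rV[R]_3) (U : set 'rV[R]_2).
Hypotheses (oU : open U) (sy : smooth_on U y).
Hypothesis (fy : forall p, U p -> row_free ('J y p)).
Implicit Types (p : 'rV[R]_2) (i j l : 'I_2).

Local Notation g := (first_form y).
Local Notation h := (second_form y).
Local Notation c := (cubic_surface y).

Let dg p i j : U p -> differentiable (fun q => g q i j) p.
Proof. exact/smooth_diff/(smooth_first_form oU sy). Qed.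
Let dh p i j : U p -> differentiable (fun q => h q i j) p.
Proof. exact/smooth_diff/(smooth_second_form oU sy fy). Qed.
Let dA p : U p -> differentiable (area2 y) p.
Proof. exact/smooth_diff/(smooth_area2 oU sy). Qed.
Let dm p : U p -> differentiable (mean2 y) p.
Proof. exact/smooth_diff/(smooth_mean2 oU sy fy). Qed.
Let dK p : U p -> differentiable (gauss y) p.
Proof. exact/smooth_diff/(smooth_gauss oU sy fy). Qed.

Let partial_area2 p l : U p -> partial l (area2 y) p =
  partial l (fun q => g q 0 0) p * g p 1 1 + g p 0 0 * partial l (fun q => g q 1 1) p
  - 2 * g p 0 1 * partial l (fun q => g q 0 1) p.
Proof.
move=> Up; rewrite /area2 partial_sub.
- by rewrite partial_mul ?partial_sqr //; exact: dg.
- by apply: differentiableM; exact: dg.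
- by apply: differentiable_sqr; exact: dg.
Qed.

Let weingarten p l i j : U p ->
  dotv (partial l (partial i y) p) (partial j (surface_normal y) p) =
  - (g p 1 1 * (dotv (partial l (partial i y) p) (partial 0 y p) * h p j 0) -
  g p 0 1 * (dotv (partial l (partial i y) p) (partial 0 y p) * h p j 1
    + dotv (partial l (partial i y) p) (partial 1 y p) * h p j 0) +
  g p 0 0 * (dotv (partial l (partial i y) p) (partial 1 y p) * h p j 1)) / area2 y p.
Proof.
move=> Up; rewrite -(dotv_y2_N1 oU sy fy) // mulrAC mulfV ?mul1r //.
exact: (area2_neq0 sy fy Up).
Qed.

(** The trace of h with respect to g has the trace of the covariant derivative c
    as its derivative. *)
Lemma partial_mean2 p l : U p -> area2 y p * partial l (mean2 y) p =
  g p 1 1 * c p l 0 0 - 2 * g p 0 1 * c p l 0 1 + g p 0 0 * c p l 1 1.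
Proof.
move=> Up; have a0 := area2_neq0 sy fy Up.
have : partial l (fun q => area2 y q * mean2 y q) p =
    partial l (fun q => g q 1 1 * h q 0 0 - 2 * g q 0 1 * h q 0 1 + g q 0 0 * h q 1 1) p.
  apply: (partial_eq_on _ oU Up) => q Uq.
  by rewrite /mean2 mulrC divfK //; exact: (area2_neq0 sy fy Uq).
rewrite (@partial_mul _ _ (area2 y) (mean2 y)); [|exact: dA|exact: dm].
(* The derivatives of area2 and of mean2 are generalized, since the product
   rule would otherwise apply inside them. *)
move: (partial l (area2 y) p) (partial_area2 l Up) (partial l (mean2 y) p) => da EA ml.
have d2 : differentiable (fun q => 2 * g q 0 1) p by apply: differentiableZ; exact: dg.
have d3 : differentiable (fun q => g q 1 1 * h q 0 0) p.
  by apply: differentiableM; [exact: dg|exact: dh].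
have d4 : differentiable (fun q => 2 * g q 0 1 * h q 0 1) p.
  by apply: differentiableM; [exact: d2|exact: dh].
rewrite partial_add; [|by apply: differentiableB
  |by apply: differentiableM; [exact: dg|exact: dh]].
rewrite partial_sub // !partial_mul; do ?[exact: dg|exact: dh|exact: d2|exact: differentiable_cst].
rewrite partial_cst !(partial_first_form sy) // !(partial_second_form oU sy fy) //.
move=> H; apply: (addrI (da * mean2 y p)); rewrite H EA.
rewrite !(partial_first_form sy) // !weingarten // /mean2 (second_formC oU sy fy 1 0 Up).
by move: a0; rewrite /area2 => a0; field.
Qed.

(** Jacobi's formula for the determinant of h with respect to g. *)
Lemma partial_gauss p l : U p -> area2 y p * partial l (gauss y) p =
  h p 1 1 * c p l 0 0 - 2 * h p 0 1 * c p l 0 1 + h p 0 0 * c p l 1 1.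
Proof.
move=> Up; have a0 := area2_neq0 sy fy Up.
have : partial l (fun q => area2 y q * gauss y q) p =
    partial l (fun q => h q 0 0 * h q 1 1 - h q 0 1 ^+ 2) p.
  apply: (partial_eq_on _ oU Up) => q Uq.
  by rewrite /gauss mulrC divfK //; exact: (area2_neq0 sy fy Uq).
rewrite (@partial_mul _ _ (area2 y) (gauss y)); [|exact: dA|exact: dK].
move: (partial l (area2 y) p) (partial_area2 l Up) (partial l (gauss y) p) => da EA kl.
rewrite partial_sub; [|by apply: differentiableM; exact: dh|by apply: differentiable_sqr; exact: dh].
rewrite partial_sqr; last exact: dh.
rewrite partial_mul; [|exact: dh..].
rewrite !(partial_second_form oU sy fy) //.
move=> H; apply: (addrI (da * gauss y p)); rewrite H EA.
rewrite !(partial_first_form sy) // !weingarten // /gauss (second_formC oU sy fy 1 0 Up).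
by move: a0; rewrite /area2 => a0; field.
Qed.

End CurvatureDerivatives.

(** * The Maslovian equations of a normal bundle *)

Section BlockInverse.
Context {R : realType}.

Lemma sum_fibre (V : nmodType) (f : 'I_(2 + 1) -> V) :
  \sum_a f a = f (base_index 0) + f (base_index 1) + f fibre_index.
Proof. by rewrite big_split_ord /= sum_ord2 big_ord1. Qed.

Lemma fibreP (a : 'I_(2 + 1)) :
  [\/ a = base_index 0, a = base_index 1 | a = fibre_index].
Proof.
case: (splitP a) => j aj.
  have -> : a = base_index j by exact/val_inj.
  by have [->|->] := ord2P j; [constructor 1|constructor 2].
by constructor 3; apply/val_inj; rewrite /= aj (ord1 j).
Qed.

Lemma invmx_fibre (M : 'M[R]_(2 + 1)) (b : 'I_2 -> 'I_(2 + 1) := base_index)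
    (o := fibre_index) (d := M (b 0) (b 0) * M (b 1) (b 1) - M (b 0) (b 1) ^+ 2) :
  d != 0 -> M (b 1) (b 0) = M (b 0) (b 1) ->
  (forall i, M (b i) o = 0) -> (forall i, M o (b i) = 0) -> M o o = 1 ->
  [/\ invmx M (b 0) (b 0) = M (b 1) (b 1) / d,
      invmx M (b 0) (b 1) = - M (b 0) (b 1) / d,
      invmx M (b 1) (b 0) = - M (b 0) (b 1) / d,
      invmx M (b 1) (b 1) = M (b 0) (b 0) / d &
      [/\ forall i, invmx M (b i) o = 0, forall i, invmx M o (b i) = 0 &
          invmx M o o = 1]].
Proof.
move=> d0 M10 Mbo Mob Moo.
pose B2 : 'M[R]_2 := \matrix_(i, j) (if i == 0 then if j == 0 then M (b 1) (b 1) / d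
   else - M (b 0) (b 1) / d else if j == 0 then - M (b 0) (b 1) / d else M (b 0) (b 0) / d).
pose B : 'M[R]_(2 + 1) := block_mx B2 0 0 1.
have Bbb i j : B (b i) (b j) = B2 i j by rewrite block_mxEul.
have Bbo i : B (b i) o = 0 by rewrite block_mxEur mxE.
have Bob i : B o (b i) = 0 by rewrite block_mxEdl mxE.
have Boo : B o o = 1 by rewrite block_mxEdr mxE.
have MB : M *m B = 1%:M.
  apply/matrixP => a a'; rewrite mxE sum_fibre.
  have [->|->|->] := fibreP a; have [->|->|->] := fibreP a';
  rewrite -/b -/o ?Bbb ?Bbo ?Bob ?Boo ?Mbo ?Mob ?Moo ?M10 ?mxE /= ?mulr0 ?mul0r ?mulr1 ?addr0 ?add0r //;
  by move: d0; rewrite /d => d0; field.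
have uM : M \in unitmx by case/mulmx1_unit: MB.
have -> : invmx M = B by rewrite -[LHS]mulmx1 -MB mulKmx.
by split; [rewrite Bbb mxE..|split].
Qed.

End BlockInverse.

Section NormalBundleEquations.
Context {R : realType}.
Variables (y : 'rV[R]_2 -> 'rV[R]_3) (U : set 'rV[R]_2).
Hypotheses (oU : open U) (sy : smooth_on U y).
Hypothesis (fy : forall p, U p -> row_free ('J y p)).
Implicit Types (p : 'rV[R]_2) (i j l : 'I_2).

Local Notation N := (surface_normal y).
Local Notation g := (first_form y).
Local Notation h := (second_form y).
Local Notation c := (cubic_surface y).
Local Notation m := (mean2 y).
Local Notation K := (gauss y).
Let W : set 'rV[R]_(2 + 1) := [set w | U (lsubmx w)].
Let oW : open W. Proof. exact: open_lsubmx. Qed.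
Let sN : smooth_on U N. Proof. exact: smooth_normal oU sy fy. Qed.
Let s0 : smooth_on U (fun=> 0 : 'rV[R]_3). Proof. exact: smooth_cst. Qed.

Definition normal_map (w : 'rV[R]_(2 + 1)) : 'rV[R]_(3 + 3) :=
  row_mx (y (lsubmx w)) (rsubmx w 0 0 *: N (lsubmx w)).

Lemma normal_mapE : normal_map = affine_fibre y (fun=> 0) N.
Proof. by apply/funext => w; rewrite /affine_fibre add0r. Qed.

Lemma smooth_normal_map : smooth_on W normal_map.
Proof. by rewrite normal_mapE; exact: smooth_affine_fibre. Qed.

Let partial0 i : partial i (fun=> 0 : 'rV[R]_3) = (fun=> 0).
Proof. by apply/funext => p; rewrite partial_cst. Qed.

Let F_base i w : W w -> partial (base_index i) normal_map w =
  affine_fibre (partial i y) (fun=> 0) (partial i N) w.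
Proof. by move=> Ww; rewrite normal_mapE (partial_affine_base oU) // partial0. Qed.

Let F_fibre w : W w -> partial fibre_index normal_map w =
  affine_fibre (fun=> 0) N (fun=> 0) w.
Proof. by move=> Ww; rewrite normal_mapE (partial_affine_fibre oU). Qed.

Let F_base2 i j w : W w ->
  partial (base_index i) (partial (base_index j) normal_map) w =
  affine_fibre (partial i (partial j y)) (fun=> 0) (partial i (partial j N)) w.
Proof.
move=> Ww; rewrite (partial_eq_on _ oW Ww (F_base j)).
by rewrite (partial_affine_base oU) ?partial0 //; exact: smooth_partial.
Qed.

Let F_base_fibre i w : W w ->
  partial (base_index i) (partial fibre_index normal_map) w =
  affine_fibre (fun=> 0) (partial i N) (fun=> 0) w.
Proof.
move=> Ww; rewrite (partial_eq_on _ oW Ww F_fibre).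
by rewrite (partial_affine_base oU) ?partial0.
Qed.

Let F_fibre_base i w : W w ->
  partial fibre_index (partial (base_index i) normal_map) w =
  affine_fibre (fun=> 0) (partial i N) (fun=> 0) w.
Proof.
move=> Ww; rewrite (partial_eq_on _ oW Ww (F_base i)).
by rewrite (partial_affine_fibre oU) //; exact: smooth_partial.
Qed.

Let F_fibre2 w : W w -> partial fibre_index (partial fibre_index normal_map) w = 0.
Proof.
move=> Ww; rewrite (partial_eq_on _ oW Ww F_fibre) (partial_affine_fibre oU) //.
by rewrite /affine_fibre scaler0 addr0 row_mx0.
Qed.

Lemma free_normal_map w : W w -> row_free ('J normal_map w).
Proof.
move=> Ww; apply: inj_row_free => v; rewrite (mulmx_jacobian smooth_normal_map) //.
rewrite sum_fibre !F_base // F_fibre // /affine_fibre !scale_row_mx !add_row_mx.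
rewrite -[0 in RHS]row_mx0 => /eq_row_mx [vy vN].
have {vy}vb : lsubmx v = 0 :> 'rV[R]_2.
  apply: (row_free_inj (fy Ww)); rewrite mul0mx (mulmx_jacobian sy) // sum_ord2 !mxE.
  by rewrite -[RHS]vy scaler0 addr0.
have v0 i : v 0 (base_index i) = 0.
  by have := congr1 (fun u : 'rV_2 => u 0 i) vb; rewrite !mxE.
move: vN; rewrite !v0 !scale0r !add0r scaler0 addr0 => vN.
have vo : v 0 fibre_index = 0.
  have := congr1 (dotv (N (lsubmx w))) vN.
  by rewrite dotvZr (normal_unit sy fy) // mulr1 dotv0r.
by apply/rowP => a; rewrite mxE; have [->|->|->] := fibreP a.
Qed.

Let dotNy p i : U p -> dotv (N p) (partial i y p) = 0.
Proof. exact: normal_tangent. Qed.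

Let dotyN p i : U p -> dotv (partial i y p) (N p) = 0.
Proof. exact: tangent_normal. Qed.

Let dotN1N p i : U p -> dotv (partial i N p) (N p) = 0.
Proof. exact: partial_normal. Qed.

Let dotyN1 p i j : U p -> dotv (partial i y p) (partial j N p) = - h p i j.
Proof. by rewrite /second_form opprK. Qed.

Let dotN1y p i j : U p -> dotv (partial i N p) (partial j y p) = - h p i j.
Proof. exact: dotv_N1. Qed.

Lemma lagrangian_normal_map w : W w -> lagrangian_at normal_map w.
Proof.
move=> Ww; have dF := smooth_diff smooth_normal_map Ww.
apply: lagrangian_criterion; first exact: free_normal_map.
have sym i j : second_form y (lsubmx w) i j = second_form y (lsubmx w) j i.
  exact: (second_formC oU sy fy i j Ww).
move=> a b; rewrite !row_jacobian //.
have [->|->|->] := fibreP a; have [->|->|->] := fibreP b;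
  rewrite ?F_base // ?F_fibre // /affine_fibre complexJ_row_mx dotv_row_mx;
  by rewrite !dotvL ?(dotyN1 _ _ Ww) ?(dotN1y _ _ Ww) ?(dotyN _ Ww) ?(dotNy _ Ww) ?(sym 1 0); ring.
Qed.

(** The metric g + t^2 <N_i, N_j> of the normal bundle along the surface, and the
    ratio of its determinant to area2. *)
Definition fibre_form t p i j :=
  (1 - t ^+ 2 * K p) * g p i j + t ^+ 2 * m p * h p i j.

Definition fibre_disc t p := (1 - t ^+ 2 * K p) ^+ 2 + t ^+ 2 * m p ^+ 2.

Let gF w : W w ->
  [/\ forall i j, metric normal_map w (base_index i) (base_index j) =
        fibre_form (rsubmx w 0 0) (lsubmx w) i j,
      forall i, metric normal_map w (base_index i) fibre_index = 0,
      forall i, metric normal_map w fibre_index (base_index i) = 0 &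
      metric normal_map w fibre_index fibre_index = 1].
Proof.
move=> Ww; split => [i j|i|i|]; rewrite (metricE smooth_normal_map) //
  ?F_base // ?F_fibre // /affine_fibre dotv_row_mx !dotvL.
- rewrite (third_form oU sy fy) // /fibre_form /first_form; ring.
- by rewrite (dotN1N _ Ww); ring.
- by rewrite [dotv (N _) _]dotvC (dotN1N _ Ww); ring.
- by rewrite (normal_unit sy fy Ww) //; ring.
Qed.

Let cF w : W w ->
  [/\ forall i j l, cubic_form normal_map w (base_index i) (base_index j) (base_index l)
        = - rsubmx w 0 0 * c (lsubmx w) i j l,
      forall i j, [/\ cubic_form normal_map w (base_index i) (base_index j) fibre_index
        = - h (lsubmx w) i j,
       cubic_form normal_map w (base_index i) fibre_index (base_index j)
        = - h (lsubmx w) i j &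
       cubic_form normal_map w fibre_index (base_index i) (base_index j)
        = - h (lsubmx w) i j],
      forall i, [/\ cubic_form normal_map w (base_index i) fibre_index fibre_index = 0,
       cubic_form normal_map w fibre_index (base_index i) fibre_index = 0 &
       cubic_form normal_map w fibre_index fibre_index (base_index i) = 0] &
       cubic_form normal_map w fibre_index fibre_index fibre_index = 0].
Proof.
move=> Ww; split => [i j l|i j|i|]; first 1 last.
- split; rewrite /cubic_form ?F_base2 // ?F_base_fibre // ?F_fibre_base // ?F_base // ?F_fibre //
    /affine_fibre complexJ_row_mx dotv_row_mx !dotvL ?(dotN1y _ _ Ww) //; try ring.
  by rewrite (second_formE oU sy fy) //; ring.
- split; rewrite /cubic_form ?F_fibre2 // ?F_base_fibre // ?F_fibre_base // ?dotv0l //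
    F_fibre // /affine_fibre complexJ_row_mx dotv_row_mx !dotvL; ring.
- by rewrite /cubic_form F_fibre2 // dotv0l.
- rewrite /cubic_form F_base2 // F_base // /affine_fibre complexJ_row_mx dotv_row_mx !dotvL.
  by rewrite /cubic_surface; ring.
Qed.

Let row_fibre (x0 x1 tau : R) : 'rV[R]_(2 + 1) :=
  row_mx (\row_j (if j == 0 then x0 else x1)) (tau%:M).

Let row_fibreE x0 x1 tau : [/\ row_fibre x0 x1 tau 0 (base_index 0) = x0,
  row_fibre x0 x1 tau 0 (base_index 1) = x1 & row_fibre x0 x1 tau 0 fibre_index = tau].
Proof.
by rewrite /row_fibre !row_mxEl row_mxEr !mxE /= mulr1n.
Qed.

Let det_fibre t p : U p ->
  fibre_form t p 0 0 * fibre_form t p 1 1 - fibre_form t p 0 1 ^+ 2 =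
  fibre_disc t p * area2 y p.
Proof.
move=> Up; have a0 := area2_neq0 sy fy Up; move: a0.
by rewrite /fibre_form /fibre_disc /mean2 /gauss /area2 => a0; field.
Qed.

(** The equations of the Maslovian condition at the point t N(p) of the normal
    bundle.  The coordinates of JH are (x0, x1) along the surface and tau along
    the fibre. *)
Lemma maslovian_normal_map w (p := lsubmx w) (t := rsubmx w 0 0)
    (s := fun l => (1 - t ^+ 2 * K p) * partial l m p
                   + t ^+ 2 * m p * partial l K p) :
  W w -> fibre_disc t p != 0 -> maslovian_at normal_map w <->
  exists x0 x1 tau, [/\ ~ [/\ x0 = 0, x1 = 0 & tau = 0],
    forall l, fibre_disc t p * (fibre_form t p l 0 * x0 + fibre_form t p l 1 * x1) = t * s l,
    fibre_disc t p * tau = m p * (1 + t ^+ 2 * K p) &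
    exists lambda,
     h p 0 0 * x0 ^+ 2 + 2 * h p 0 1 * x0 * x1 + h p 1 1 * x1 ^+ 2 = lambda * tau /\
     forall k, t * (c p k 0 0 * x0 ^+ 2 + 2 * c p k 0 1 * x0 * x1 + c p k 1 1 * x1 ^+ 2)
       + 2 * tau * (h p k 0 * x0 + h p k 1 * x1)
       = lambda * (fibre_form t p k 0 * x0 + fibre_form t p k 1 * x1)].
Proof.
move=> Ww D0; have Up : U p := Ww.
rewrite (maslovian_cubic oW smooth_normal_map free_normal_map) //; last exact: lagrangian_normal_map.
have [gbb gbo gob goo] := gF Ww; have [c3 c2 c1 c0] := cF Ww.
rewrite -/p -/t in gbb gbo gob goo c3 c2 c1 c0.
have a0 := area2_neq0 sy fy Up.
have G10 : fibre_form t p 1 0 = fibre_form t p 0 1.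
  by rewrite /fibre_form (first_formC y p 1 0) (second_formC oU sy fy 1 0 Up).
have dG := det_fibre t Up.
have d0 : fibre_disc t p * area2 y p != 0 by rewrite mulf_neq0.
have := @invmx_fibre R (metric normal_map w); cbv zeta; rewrite !gbb dG.
move=> /(_ d0 G10 gbo gob goo)[i00 i01 i10 i11 [ibo iob ioo]].
have c10 k : c p 1 0 k = c p 0 1 k by rewrite (cubic_C12 oU sy fy).
have ccyc i j k : c p i j k = c p k i j.
  by rewrite (cubic_C23 oU sy fy) // (cubic_C12 oU sy fy).
have pm l := partial_mean2 oU sy fy l Up; have pK l := partial_gauss oU sy fy l Up.
have tr_c l : \sum_a \sum_b invmx (metric normal_map w) a b *
    cubic_form normal_map w a b (base_index l) = - (t * s l) / fibre_disc t p.
  rewrite !sum_fibre i00 i01 i10 i11 !ibo !iob ioo !c3 !mul0r.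
  have [_ _ ->] := c1 l; rewrite c10.
  have sE : s l * area2 y p = fibre_form t p 1 1 * c p l 0 0
      - 2 * fibre_form t p 0 1 * c p l 0 1 + fibre_form t p 0 0 * c p l 1 1.
    transitivity ((1 - t ^+ 2 * K p) * (area2 y p * partial l m p)
        + t ^+ 2 * m p * (area2 y p * partial l K p)); first by rewrite /s; ring.
    by rewrite pm pK /fibre_form; ring.
  rewrite (ccyc 0 0 l) (ccyc 0 1 l) (ccyc 1 1 l).
  apply: (mulfI a0); apply: (mulfI D0).
  transitivity (- t * (s l * area2 y p)).
    by rewrite sE; field; rewrite D0 a0.
  by field.
have tr_o : \sum_a \sum_b invmx (metric normal_map w) a b *
    cubic_form normal_map w a b fibre_index = - (m p * (1 + t ^+ 2 * K p)) / fibre_disc t p.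
  rewrite !sum_fibre i00 i01 i10 i11 !ibo !iob ioo !mul0r c0.
  have [-> _ _] := c2 0 0; have [-> _ _] := c2 0 1; have [-> _ _] := c2 1 0; have [-> _ _] := c2 1 1.
  have GE : fibre_form t p 1 1 * h p 0 0 - 2 * fibre_form t p 0 1 * h p 0 1
      + fibre_form t p 0 0 * h p 1 1 = area2 y p * (m p * (1 + t ^+ 2 * K p)).
    rewrite /fibre_form /mean2 /gauss; move: a0; rewrite /area2 => a0; field.
    exact: a0.
  rewrite (second_formC oU sy fy 1 0 Up); apply: (mulfI a0); apply: (mulfI D0).
  transitivity (- (area2 y p * (m p * (1 + t ^+ 2 * K p)))); last by field.
  by rewrite -GE; field; rewrite D0 a0.
have hC := second_formC oU sy fy 1 0 Up.
have quad (X : 'rV[R]_(2 + 1)) k : \sum_a \sum_b X 0 a * X 0 b * cubic_form normal_map w a (base_index k) b =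
   - (t * (c p k 0 0 * X 0 (base_index 0) ^+ 2
     + 2 * c p k 0 1 * X 0 (base_index 0) * X 0 (base_index 1)
     + c p k 1 1 * X 0 (base_index 1) ^+ 2)
   + 2 * X 0 fibre_index * (h p k 0 * X 0 (base_index 0) + h p k 1 * X 0 (base_index 1))).
  rewrite !sum_fibre !c3; have [_ -> _] := c1 k.
  have [_ _ ->] := c2 k 0; have [_ _ ->] := c2 k 1.
  have [-> _ _] := c2 0 k; have [-> _ _] := c2 1 k.
  rewrite (cubic_C12 oU sy fy 0 k 0 Up) (cubic_C12 oU sy fy 0 k 1 Up).
  rewrite (cubic_C12 oU sy fy 1 k 0 Up) (cubic_C12 oU sy fy 1 k 1 Up).
  rewrite (cubic_C23 oU sy fy k 1 0 Up).
  rewrite (second_formC oU sy fy 0 k) // (second_formC oU sy fy 1 k) //; ring.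
have quado (X : 'rV[R]_(2 + 1)) : \sum_a \sum_b X 0 a * X 0 b * cubic_form normal_map w a fibre_index b =
   - (h p 0 0 * X 0 (base_index 0) ^+ 2
     + 2 * h p 0 1 * X 0 (base_index 0) * X 0 (base_index 1)
     + h p 1 1 * X 0 (base_index 1) ^+ 2).
  rewrite !sum_fibre c0.
  have [_ -> _] := c2 0 0; have [_ -> _] := c2 0 1; have [_ -> _] := c2 1 0; have [_ -> _] := c2 1 1.
  have [-> _ ->] := c1 0; have [-> _ ->] := c1 1; rewrite hC; ring.
have gX (X : 'rV[R]_(2 + 1)) k : (X *m metric normal_map w) 0 (base_index k) =
    fibre_form t p k 0 * X 0 (base_index 0) + fibre_form t p k 1 * X 0 (base_index 1).
  rewrite mxE sum_fibre !gbb gob mulr0 addr0.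
  have -> : fibre_form t p 0 k = fibre_form t p k 0.
    by rewrite /fibre_form (first_formC y p 0 k) (second_formC oU sy fy 0 k Up).
  have -> : fibre_form t p 1 k = fibre_form t p k 1.
    by rewrite /fibre_form (first_formC y p 1 k) (second_formC oU sy fy 1 k Up).
  by ring.
have gXo (X : 'rV[R]_(2 + 1)) : (X *m metric normal_map w) 0 fibre_index = X 0 fibre_index.
  by rewrite mxE sum_fibre !gbo goo !mulr0 !add0r mulr1.
split.
- move=> [X [X0 XC [lam XL]]].
  exists (X 0 (base_index 0)), (X 0 (base_index 1)), (X 0 fibre_index); split.
  + move=> [e0 e1 et]; move/eqP: X0; apply; apply/rowP => a; rewrite mxE.
    by have [->|->|->] := fibreP a.
  + by move=> l; rewrite -gX XC tr_c; field.
  + by rewrite -gXo XC tr_o; field.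
  + exists lam; split; first by have := XL fibre_index; rewrite quado gXo opprK.
    by move=> k; have := XL (base_index k); rewrite quad gX opprK.
- move=> [x0 [x1 [tau [X0 XC Xt [lam [L1 L2]]]]]].
  have [e0 e1 et] := row_fibreE x0 x1 tau.
  exists (row_fibre x0 x1 tau); split.
  + apply/eqP => X00; apply: X0; rewrite X00 in e0 e1 et.
    by rewrite -e0 -e1 -et !mxE.
  + move=> a; have base k : (row_fibre x0 x1 tau *m metric normal_map w) 0 (base_index k) =
      - \sum_a \sum_b invmx (metric normal_map w) a b *
        cubic_form normal_map w a b (base_index k).
      by rewrite gX tr_c e0 e1; apply: (mulfI D0); rewrite XC; field.
    have [->|->|->] := fibreP a; [exact: base|exact: base|].
    by rewrite gXo tr_o et; apply: (mulfI D0); rewrite Xt; field.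
  + exists lam => a; have base k : - \sum_a \sum_b row_fibre x0 x1 tau 0 a *
      row_fibre x0 x1 tau 0 b * cubic_form normal_map w a (base_index k) b =
      lam * (row_fibre x0 x1 tau *m metric normal_map w) 0 (base_index k).
      by rewrite quad gX opprK e0 e1 et.
    have [->|->|->] := fibreP a; [exact: base|exact: base|].
    by rewrite quado gXo opprK e0 e1 et.
Qed.

End NormalBundleEquations.

(** * Pointwise consequences of the Maslovian equations *)

Section Pointwise.
Context {R : realType}.

(** This replaces the passage to the limit t = 0. *)
Lemma horner0_of_punctured (q : {poly R}) :
  (forall t, t != 0 -> q.[t] = 0) -> q.[0] = 0.
Proof.
move=> q0; have [->|qn0] := eqVneq q 0; first by rewrite horner0.
pose r := [seq i.+1%:R : R | i <- iota 0 (size q)].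
have rr : all (root q) r.
  by apply/allP => _ /mapP[i _ ->]; rewrite rootE q0 // pnatr_eq0.
have ur : uniq r.
  by rewrite map_inj_uniq ?iota_uniq // => i j /eqP; rewrite eqr_nat => /eqP [].
by have := max_poly_roots qn0 rr ur; rewrite size_map size_iota ltnn.
Qed.

Variables (y : 'rV[R]_2 -> 'rV[R]_3) (U : set 'rV[R]_2).
Hypotheses (oU : open U) (sy : smooth_on U y).
Hypothesis (fy : forall p, U p -> row_free ('J y p)).
Variable p : 'rV[R]_2.
Hypothesis (Up : U p).

Local Notation g i j := (first_form y p i j).
Local Notation h i j := (second_form y p i j).
Local Notation c i j k := (cubic_surface y p i j k).
Local Notation m := (mean2 y p).
Local Notation K := (gauss y p).
Local Notation m1 l := (partial l (mean2 y) p).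
Local Notation K1 l := (partial l (gauss y) p).
Local Notation delta := (area2 y p).

Let point (t : R) : 'rV[R]_(2 + 1) := row_mx p t%:M.
Let point_base t : lsubmx (point t) = p. Proof. exact: row_mxKl. Qed.
Let point_fibre t : rsubmx (point t) 0 0 = t.
Proof. by rewrite row_mxKr mxE mulr1n. Qed.

Lemma fibre_disc_neq0 t : m != 0 -> fibre_disc y t p != 0.
Proof.
move=> m0; have m2 : 0 < m ^+ 2 by rewrite exprn_even_gt0.
rewrite /fibre_disc; have [->|t0] := eqVneq t 0.
  by rewrite expr0n /= !mul0r subr0 expr1n addr0 oner_neq0.
have t2 : 0 < t ^+ 2 by rewrite exprn_even_gt0.
by rewrite gt_eqF // ltr_wpDl ?sqr_ge0 // mulr_gt0.
Qed.

(* The rules of hornerE without associativity, which would match inside the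
   curvatures. *)
Let hE := (@hornerD R, @hornerN R, @hornerM R, @horner_exp R, @hornerC R, @hornerX R).

Section Necessary.
Hypothesis maslov : forall w, lsubmx w = p -> maslovian_at (normal_map y) w.

(** On the zero section the equations say that JH has no component along the
    surface and the component m along the fibre; so m = 0 would make H vanish. *)
Lemma maslovian_mean2 : m != 0.
Proof.
have D0 : fibre_disc y 0 p = 1 by rewrite /fibre_disc expr0n /= !mul0r subr0 expr1n addr0.
have M := @maslovian_normal_map _ _ _ oU sy fy (point 0).
rewrite /= point_base point_fibre in M.
have D00 : fibre_disc y 0 p != 0 by rewrite D0 oner_neq0.
have [x0 [x1 [tau [X0 XC Xt _]]]] := (M Up D00).1 (maslov (point_base 0)); apply/eqP => m0; apply: X0.
have := XC 0; have := XC 1; move: Xt; rewrite D0 /fibre_form expr0n /=.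
rewrite m0 !mul0r !mul1r !subr0 !addr0 !mul1r => tau0.
rewrite (first_formC y p 1 0) => e1 e2.
have a0 := area2_neq0 sy fy Up.
split=> //; apply: (mulfI a0); rewrite mulr0.
  transitivity (g 1 1 * (g 0 0 * x0 + g 0 1 * x1) - g 0 1 * (g 0 1 * x0 + g 1 1 * x1)).
    by rewrite /area2; ring.
  by rewrite e1 e2; ring.
transitivity (g 0 0 * (g 0 1 * x0 + g 1 1 * x1) - g 0 1 * (g 0 0 * x0 + g 0 1 * x1)).
  by rewrite /area2; ring.
by rewrite e1 e2; ring.
Qed.

(* The coordinates of JH along the surface and the factor lambda are eliminated
   from the Maslovian equations at the point t N(p). *)
Let eliminated t k (G := fibre_form y t p) (D := fibre_disc y t p)
    (T := m * (1 + t ^+ 2 * K))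
    (s := fun l => (1 - t ^+ 2 * K) * m1 l + t ^+ 2 * m * K1 l)
    (X0 := G 1 1 * s 0 - G 0 1 * s 1) (X1 := G 0 0 * s 1 - G 0 1 * s 0) : t != 0 ->
  2 * T ^+ 2 * D * delta * (h k 0 * X0 + h k 1 * X1) + t ^+ 2 *
  (T * (c k 0 0 * X0 ^+ 2 + 2 * c k 0 1 * X0 * X1 + c k 1 1 * X1 ^+ 2)
   - (h 0 0 * X0 ^+ 2 + 2 * h 0 1 * X0 * X1 + h 1 1 * X1 ^+ 2) * s k) = 0.
Proof.
move=> t0; have D0 : D != 0 by exact/fibre_disc_neq0/maslovian_mean2.
have M := @maslovian_normal_map _ _ _ oU sy fy (point t).
rewrite /= point_base point_fibre in M.
have [x0 [x1 [tau [_ XC Xt [lam [L1 L2]]]]]] := (M Up D0).1 (maslov (point_base t)).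
have {}L2 := L2 k; have := XC 0; have := XC 1; have Xk := XC k.
have -> : fibre_form y t p 1 0 = fibre_form y t p 0 1.
  by rewrite /fibre_form (first_formC y p 1 0) (second_formC oU sy fy 1 0 Up).
rewrite -/G -/D -/(s 0) -/(s 1) -/(s k) in Xt Xk L2 * => E1 E0.
have dG : G 0 0 * G 1 1 - G 0 1 ^+ 2 = D * delta.
  move: (area2_neq0 sy fy Up).
  by rewrite /G /D /fibre_form /fibre_disc /mean2 /gauss /area2 => a0; field.
have X0E : D ^+ 2 * delta * x0 = t * X0.
  transitivity (D * (D * delta) * x0); first by ring.
  rewrite -dG; transitivity (G 1 1 * (D * (G 0 0 * x0 + G 0 1 * x1))
    - G 0 1 * (D * (G 0 1 * x0 + G 1 1 * x1))); first by ring.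
  by rewrite E0 E1 /X0; ring.
have X1E : D ^+ 2 * delta * x1 = t * X1.
  transitivity (D * (D * delta) * x1); first by ring.
  rewrite -dG; transitivity (G 0 0 * (D * (G 0 1 * x0 + G 1 1 * x1))
    - G 0 1 * (D * (G 0 0 * x0 + G 0 1 * x1))); first by ring.
  by rewrite E0 E1 /X1; ring.
apply: (mulfI t0); rewrite mulr0.
transitivity (2 * (D * tau) ^+ 2 * D * delta * (h k 0 * (t * X0) + h k 1 * (t * X1))
  + (D * tau * t) * (c k 0 0 * (t * X0) ^+ 2 + 2 * c k 0 1 * (t * X0) * (t * X1)
      + c k 1 1 * (t * X1) ^+ 2)
  - (h 0 0 * (t * X0) ^+ 2 + 2 * h 0 1 * (t * X0) * (t * X1) + h 1 1 * (t * X1) ^+ 2)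
    * (t * s k)); first by rewrite Xt /T; ring.
rewrite -Xk -X0E -X1E.
transitivity (D ^+ 5 * delta ^+ 2 * (tau * (t * (c k 0 0 * x0 ^+ 2 + 2 * c k 0 1 * x0 * x1
    + c k 1 1 * x1 ^+ 2) + 2 * tau * (h k 0 * x0 + h k 1 * x1))
  - (h 0 0 * x0 ^+ 2 + 2 * h 0 1 * x0 * x1 + h 1 1 * x1 ^+ 2)
    * (G k 0 * x0 + G k 1 * x1))); first by ring.
by rewrite L1 L2; ring.
Qed.

(* The polynomials in t occurring in the eliminated equation. *)
Let horner_pieces : exists (T D : {poly R}) (G : 'I_2 -> 'I_2 -> {poly R}) (s : 'I_2 -> {poly R}),
  [/\ forall t, T.[t] = m * (1 + t ^+ 2 * K), forall t, D.[t] = fibre_disc y t p,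
      forall i j t, (G i j).[t] = fibre_form y t p i j &
      forall l t, (s l).[t] = (1 - t ^+ 2 * K) * m1 l + t ^+ 2 * m * K1 l].
Proof.
exists (m%:P * (1 + 'X ^+ 2 * K%:P)).
exists ((1 - 'X ^+ 2 * K%:P) ^+ 2 + 'X ^+ 2 * (m ^+ 2)%:P).
exists (fun i j => (1 - 'X ^+ 2 * K%:P) * (g i j)%:P + 'X ^+ 2 * m%:P * (h i j)%:P).
exists (fun l => (1 - 'X ^+ 2 * K%:P) * (m1 l)%:P + 'X ^+ 2 * m%:P * (K1 l)%:P).
by split=> *; rewrite !hE.
Qed.

(** At t = 0 only the first term of the eliminated equation survives. *)
Lemma second_form_grad_mean2 : second_form_null y p (fun l => m1 l).
Proof.
move=> k; cbv beta; have [T [D [G [s [TE DE GE sE]]]]] := horner_pieces.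
pose X0 := G 1 1 * s 0 - G 0 1 * s 1; pose X1 := G 0 0 * s 1 - G 0 1 * s 0.
have X0E t : X0.[t] = fibre_form y t p 1 1 * (s 0).[t] - fibre_form y t p 0 1 * (s 1).[t].
  by rewrite !hE !GE.
have X1E t : X1.[t] = fibre_form y t p 0 0 * (s 1).[t] - fibre_form y t p 0 1 * (s 0).[t].
  by rewrite !hE !GE.
move: X0 X1 X0E X1E => X0 X1 X0E X1E.
pose q := 2%:P * T ^+ 2 * D * delta%:P * ((h k 0)%:P * X0 + (h k 1)%:P * X1) + 'X ^+ 2 *
  (T * ((c k 0 0)%:P * X0 ^+ 2 + (2 * c k 0 1)%:P * X0 * X1 + (c k 1 1)%:P * X1 ^+ 2)
   - ((h 0 0)%:P * X0 ^+ 2 + (2 * h 0 1)%:P * X0 * X1 + (h 1 1)%:P * X1 ^+ 2) * s k).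
have : q.[0] = 0.
  apply: horner0_of_punctured => t t0; have := eliminated k t0.
  by cbv zeta; rewrite -!sE -X0E -X1E -TE -DE /q !hE.
rewrite /q !hE X0E X1E !sE TE DE /fibre_form /fibre_disc.
rewrite expr0n /= !mul0r !addr0 !subr0 !mul1r expr1n !mulr1.
have a0 := area2_neq0 sy fy Up; have m0 := maslovian_mean2.
have e0 : 2 * m ^+ 2 * delta != 0 by rewrite mulf_neq0 // mulf_neq0 ?expf_neq0 // pnatr_eq0.
by move/eqP; rewrite mulf_eq0 (negbTE e0) => /eqP.
Qed.

(** For a critical point of m the eliminated equation is divisible by t^2 m, and
    the quotient has the same shape, with the gradient of K instead of that of
    m. *)
Lemma second_form_grad_gauss : m1 0 = 0 -> m1 1 = 0 ->
  second_form_null y p (fun l => K1 l).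
Proof.
move=> m10 m11 k; cbv beta; have m1k : m1 k = 0 by have [->|->] := ord2P k.
have a0 := area2_neq0 sy fy Up; have m0 := maslovian_mean2.
have [T [D [G [s [TE DE GE _]]]]] := horner_pieces.
pose X0 := G 1 1 * (K1 0)%:P - G 0 1 * (K1 1)%:P.
pose X1 := G 0 0 * (K1 1)%:P - G 0 1 * (K1 0)%:P.
have X0E t : X0.[t] = fibre_form y t p 1 1 * K1 0 - fibre_form y t p 0 1 * K1 1.
  by rewrite !hE !GE.
have X1E t : X1.[t] = fibre_form y t p 0 0 * K1 1 - fibre_form y t p 0 1 * K1 0.
  by rewrite !hE !GE.
move: X0 X1 X0E X1E => X0 X1 X0E X1E.
pose q := 2%:P * T ^+ 2 * D * delta%:P * ((h k 0)%:P * X0 + (h k 1)%:P * X1)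
  + 'X ^+ 4 * (T * m%:P *
   ((c k 0 0)%:P * X0 ^+ 2 + (2 * c k 0 1)%:P * X0 * X1 + (c k 1 1)%:P * X1 ^+ 2)
   - 'X ^+ 2 * (m ^+ 2)%:P * ((h 0 0)%:P * X0 ^+ 2 + (2 * h 0 1)%:P * X0 * X1
     + (h 1 1)%:P * X1 ^+ 2) * (K1 k)%:P).
have : q.[0] = 0.
  apply: horner0_of_punctured => t t0.
  have tm : t ^+ 2 * m != 0 by rewrite mulf_neq0 ?expf_neq0.
  apply: (mulfI tm); rewrite mulr0 -[RHS](eliminated k t0) m10 m11 m1k.
  rewrite !mulr0 !add0r /q !hE X0E X1E TE DE.
  move: (fibre_form y t p) (fibre_disc y t p) (m * (1 + _)) => F e S.
  have -> : F 1 1 * (t ^+ 2 * m * K1 0) - F 0 1 * (t ^+ 2 * m * K1 1)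
    = t ^+ 2 * m * (F 1 1 * K1 0 - F 0 1 * K1 1) by ring.
  have -> : F 0 0 * (t ^+ 2 * m * K1 1) - F 0 1 * (t ^+ 2 * m * K1 0)
    = t ^+ 2 * m * (F 0 0 * K1 1 - F 0 1 * K1 0) by ring.
  by move: (_ * K1 0 - _) (_ * K1 1 - _) => Y0 Y1; ring.
rewrite /q !hE X0E X1E TE DE /fibre_form /fibre_disc.
rewrite !expr0n /= !mul0r !addr0 !subr0 !mul1r expr1n !mulr1.
have e0 : 2 * m ^+ 2 * delta != 0 by rewrite mulf_neq0 // mulf_neq0 ?expf_neq0 // pnatr_eq0.
by move/eqP; rewrite mulf_eq0 (negbTE e0) => /eqP.
Qed.

End Necessary.

(** Here dm = - m xi, dK = 0 and K xi = 0.  So JH is, up to its fibre component,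
    a multiple of the dual (w0, w1) of xi, which h annihilates, and both sides
    of the Maslovian equations vanish with lambda = 0. *)
Lemma maslovian_sufficient (xi : 'I_2 -> R) : m != 0 -> 0 <= K ->
  (forall i j k, c i j k = - (h i j * xi k + h j k * xi i + h i k * xi j)) ->
  second_form_null y p xi -> forall w, lsubmx w = p -> maslovian_at (normal_map y) w.
Proof.
move=> m0 K0 cE hxi w wp; set t := rsubmx w 0 0.
have a0 := area2_neq0 sy fy Up; have D0 := fibre_disc_neq0 t m0.
have hC := second_formC oU sy fy 1 0 Up.
set w0 := g 1 1 * xi 0 - g 0 1 * xi 1; set w1 := g 0 0 * xi 1 - g 0 1 * xi 0.
have hw k : h k 0 * w0 + h k 1 * w1 = 0 by exact: hxi.
have hw0 := hw 0; have hw1 := hw 1; rewrite hC in hw1.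
have Kxi := gauss_null oU sy fy Up hxi.
have mE l : m1 l = - m * xi l.
  apply: (mulfI a0); rewrite (partial_mean2 oU sy fy) // !cE.
  have hl := hw l.
  transitivity (- (m * delta) * xi l - 2 * (h l 0 * w0 + h l 1 * w1)).
    by rewrite /mean2 mulfVK // /w0 /w1; ring.
  by rewrite hl; ring.
have KE l : K1 l = 0.
  apply: (mulfI a0); rewrite (partial_gauss oU sy fy) // !cE mulr0.
  transitivity (- (4 * delta * (K * xi l))); last by rewrite Kxi; ring.
  have -> : 4 * delta * (K * xi l) = 4 * (h 0 0 * h 1 1 - h 0 1 ^+ 2) * xi l.
    by rewrite /gauss; field.
  by have [->|->] := ord2P l; rewrite ?hC; ring.
have M := @maslovian_normal_map _ _ _ oU sy fy w; rewrite /= wp -/t in M.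
apply/M => //.
(* the factor of w0 and w1 dictated by the equation for H *)
pose a := - (t * m) / (fibre_disc y t p * delta).
exists (a * w0), (a * w1), (m * (1 + t ^+ 2 * K) / fibre_disc y t p); split.
- move=> [_ _ tau0].
  have T0 : 1 + t ^+ 2 * K != 0 by rewrite gt_eqF // ltr_pwDl // mulr_ge0 ?sqr_ge0.
  have : m * (1 + t ^+ 2 * K) / fibre_disc y t p != 0.
    by rewrite mulf_neq0 ?invr_neq0 // mulf_neq0.
  by rewrite tau0 eqxx.
- move=> l; rewrite mE KE.
  have Gw : fibre_form y t p l 0 * w0 + fibre_form y t p l 1 * w1 = delta * xi l.
    transitivity ((1 - t ^+ 2 * K) * (g l 0 * w0 + g l 1 * w1)
      + t ^+ 2 * m * (h l 0 * w0 + h l 1 * w1)); first by rewrite /fibre_form; ring.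
    rewrite hw; have -> : g l 0 * w0 + g l 1 * w1 = delta * xi l.
      rewrite /w0 /w1 /area2.
      by have [->|->] := ord2P l; rewrite ?(first_formC y p 1 0); ring.
    transitivity (delta * (xi l - t ^+ 2 * (K * xi l))); first by ring.
    by rewrite Kxi; ring.
  transitivity (- (t * m) / delta * (fibre_form y t p l 0 * w0 + fibre_form y t p l 1 * w1)).
    by rewrite /a; field; rewrite a0 D0.
  rewrite Gw; transitivity (- (t * (m * xi l))); first by field.
  transitivity (- (t * m * (xi l - t ^+ 2 * (K * xi l)))); last by ring.
  by rewrite Kxi; ring.
- by rewrite mulrC mulfVK.
- exists 0; rewrite mul0r; split=> [|k].
    transitivity (a ^+ 2 * (w0 * (h 0 0 * w0 + h 0 1 * w1) + w1 * (h 0 1 * w0 + h 1 1 * w1))).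
      by ring.
    by rewrite hw0 hw1; ring.
  rewrite mul0r !cE.
  have hk : h k 0 * (a * w0) + h k 1 * (a * w1) = 0.
    by transitivity (a * (h k 0 * w0 + h k 1 * w1)); [ring|rewrite hw mulr0].
  rewrite hk.
  transitivity (- (t * a ^+ 2) * (2 * (h k 0 * w0 + h k 1 * w1) * (xi 0 * w0 + xi 1 * w1)
    + xi k * (w0 * (h 0 0 * w0 + h 0 1 * w1) + w1 * (h 0 1 * w0 + h 1 1 * w1)))); first by ring.
  by rewrite hw hw0 hw1; ring.
Qed.

End Pointwise.

(** * Surfaces in quadrics of revolution *)

(** The model surfaces are open parts of quadrics <B(z - a), z - a> = const
    with B = id - beta w w^T. *)
Section Quadric.
Context {R : realType}.
Variables (y : 'rV[R]_2 -> 'rV[R]_3) (U : set 'rV[R]_2).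
Hypotheses (oU : open U) (sy : smooth_on U y).
Hypothesis (fy : forall p, U p -> row_free ('J y p)).
Variables (a w : 'rV[R]_3) (beta kappa : R).

Local Notation N := (surface_normal y).
Local Notation g := (first_form y).
Local Notation h := (second_form y).

Definition quadric_op (v : 'rV[R]_3) : 'rV[R]_3 := v - (beta * dotv v w) *: w.
Definition quadric_normal q : R := dotv (quadric_op (y q - a)) (N q).
Local Notation B := quadric_op.
Local Notation nu := quadric_normal.

Hypothesis w1 : dotv w w = 1.
Hypothesis By_cst : forall q, U q -> dotv (B (y q - a)) (y q - a) = kappa.
Hypothesis By_neq0 : forall q, U q -> B (y q - a) != 0.

Lemma quadric_op_sym u v : dotv (B u) v = dotv u (B v).
Proof. by rewrite /quadric_op !dotvL [dotv w v]dotvC; ring. Qed.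

Let sY : smooth_on U (fun q => y q - a).
Proof. by apply: smoothB => //; exact: smooth_cst. Qed.

Let dY q : U q -> differentiable (fun q => y q - a) q.
Proof. exact/smooth_diff/sY. Qed.

Let partialY q i : U q -> partial i (fun q => y q - a) q = partial i y q.
Proof.
move=> Uq; rewrite partial_sub ?partial_cst ?subr0 //.
exact: (smooth_diff sy Uq).
Qed.

Let sB : smooth_on U (fun q => B (y q - a)).
Proof.
have scst (v : 'rV[R]_3) : smooth_on U (fun=> v) by exact: smooth_cst.
apply: smoothB => //; apply: smooth_scalev => //.
by apply: smoothM => //; [exact: smooth_cst|exact: smooth_dotv].
Qed.

Let dB q : U q -> differentiable (fun q => B (y q - a)) q.
Proof. exact/smooth_diff/sB. Qed.

Let sN : smooth_on U N. Proof. exact: smooth_normal oU sy fy. Qed.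
Let dN q : U q -> differentiable N q. Proof. exact/smooth_diff/sN. Qed.

Let partialB q i : U q -> partial i (fun q => B (y q - a)) q = B (partial i y q).
Proof.
move=> Uq; have dw : differentiable (fun=> w : 'rV[R]_3) q by exact: differentiable_cst.
have dYq := dY Uq; have dyw := differentiable_dotv dYq dw.
have d1 : differentiable (fun q => beta * dotv (y q - a) w) q.
  exact: differentiableZ.
have d2 : differentiable (fun q => (beta * dotv (y q - a) w) *: w) q.
  apply/differentiable_row => k; under eq_fun do rewrite mxE.
  by apply: differentiableM.
rewrite /quadric_op (partial_sub i dYq d2).
rewrite partialY // (partial_scalev i d1 dw) partial_cst scaler0 addr0.
rewrite (@partial_mul _ _ (fun=> beta) _ q i (differentiable_cst _ _) dyw).
by rewrite partial_cst mul0r add0r (partial_dotv i dYq dw) partial_cst dotv0r addr0 partialY.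
Qed.

Lemma quadric_op_tangent q i : U q -> dotv (B (y q - a)) (partial i y q) = 0.
Proof.
move=> Uq; have := partial_cst_on i oU Uq By_cst.
rewrite partial_dotv; [|exact: dB|exact: dY].
rewrite partialB // partialY // quadric_op_sym dotvC; lra.
Qed.

Lemma quadric_op_normal q : U q -> B (y q - a) = nu q *: N q.
Proof.
move=> Uq; apply/eqP; rewrite -subr_eq0; apply/eqP.
apply: (frame_eq0 sy fy Uq) => [|i]; rewrite dotvBl dotvZl.
  by rewrite (normal_unit sy fy Uq) mulr1 subrr.
by rewrite quadric_op_tangent // (normal_tangent sy i Uq) mulr0 subrr.
Qed.

Lemma quadric_normal_sqr q : U q -> nu q ^+ 2 = dotv (B (y q - a)) (B (y q - a)).
Proof.
move=> Uq; rewrite {1 2}quadric_op_normal // dotvZl dotvZr.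
by rewrite (normal_unit sy fy Uq); ring.
Qed.

Lemma quadric_normal_neq0 q : U q -> nu q != 0.
Proof. by move=> Uq; rewrite -sqrf_eq0 quadric_normal_sqr // dotvv_eq0 By_neq0. Qed.

Lemma smooth_quadric_normal : smooth_on U nu.
Proof. exact: smooth_dotv. Qed.

Let dnu q : U q -> differentiable nu q.
Proof. exact/smooth_diff/smooth_quadric_normal. Qed.

Let By1 q i : U q -> B (partial i y q) = partial i nu q *: N q + nu q *: partial i N q.
Proof.
move=> Uq; rewrite -partialB // (partial_eq_on i oU Uq quadric_op_normal).
by rewrite partial_scalev //; [exact: dnu|exact: dN].
Qed.

Lemma quadric_second_form q i j : U q ->
  nu q * h q i j = - dotv (B (partial i y q)) (partial j y q).
Proof.
move=> Uq; rewrite By1 // dotvDl !dotvZl (normal_tangent sy j Uq).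
by rewrite (dotv_N1 oU sy fy i j Uq); ring.
Qed.

(** The covariant derivative of nu h = - <B y_i, y_j>: as B is constant, only the
    normal parts of the second derivatives of y contribute. *)
Lemma quadric_cubic q i j l : U q -> cubic_surface y q j i l =
  - (h q j i * (partial l nu q / nu q) + h q i l * (partial j nu q / nu q)
     + h q j l * (partial i nu q / nu q)).
Proof.
move=> Uq; have n0 := quadric_normal_neq0 Uq.
have dh : differentiable (fun q => h q i l) q.
  exact: (smooth_diff (smooth_second_form oU sy fy i l) Uq).
have E : partial j (fun q => nu q * h q i l) q =
    partial j (fun q => (fun=> 0 : R) q - dotv (B (partial i y q)) (partial l y q)) q.
  by apply: (partial_eq_on j oU Uq) => r Ur; rewrite quadric_second_form // sub0r.
have sBi : smooth_on U (fun r => B (partial i y r)).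
  apply: (smooth_eq oU _ (smooth_partial i sB)) => r Ur; exact: partialB.
have Bij : partial j (fun r => B (partial i y r)) q = B (partial j (partial i y) q).
  have sc (v : 'rV[R]_3) : differentiable (fun=> v) q by exact: differentiable_cst.
  have dyi : differentiable (partial i y) q by exact: (smooth_diff (smooth_partial i sy) Uq).
  have dyw : differentiable (fun q => dotv (partial i y q) w) q by apply: differentiable_dotv.
  have d1 : differentiable (fun q => beta * dotv (partial i y q) w) q by apply: differentiableZ.
  rewrite /quadric_op partial_sub //; last first.
    apply/differentiable_row => k; under eq_fun do rewrite mxE.
    by apply: differentiableM.
  rewrite partial_scalev // partial_cst scaler0 addr0.
  rewrite (@partial_mul _ _ (fun=> beta)) // partial_cst mul0r add0r.
  by rewrite partial_dotv // partial_cst dotv0r addr0.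
move: E; rewrite partial_sub ?partial_cst; first last.
- apply: differentiable_dotv; first exact: (smooth_diff sBi Uq).
  exact: (smooth_diff (smooth_partial l sy) Uq).
- exact: differentiable_cst.
rewrite partial_mul //; last exact: dnu.
rewrite partial_dotv; [|exact: (smooth_diff sBi Uq)|exact: (smooth_diff (smooth_partial l sy) Uq)].
rewrite Bij quadric_op_sym (By1 l Uq) (By1 i Uq) (partial_second_form oU sy fy j i l Uq).
rewrite !dotvL -(second_formE oU sy fy j i Uq).
rewrite [dotv (N q) _]dotvC -(second_formE oU sy fy j l Uq) [dotv (partial i N q) _]dotvC.
move=> E; apply: (mulfI n0).
transitivity (- (h q j i * partial l nu q + h q i l * partial j nu q + h q j l * partial i nu q)).
  by lra.
by field.
Qed.

(** The principal curvatures are - 1 / nu and - (1 - k) / nu: the sphere has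
    k = 0, the cylinder and the cone have k = 1. *)
Lemma quadric_maslovian (k : R) p : U p -> 0 <= k <= 1 ->
  beta * (1 - dotv w (N p) ^+ 2) = k ->
  second_form_null y p (fun i => partial i nu p) -> forall z, lsubmx z = p -> maslovian_at (normal_map y) z.
Proof.
move=> Up /andP[k0 k1] bk hnu; have n0 := quadric_normal_neq0 Up.
have a0 := area2_neq0 sy fy Up.
have hE i j : nu p * h p i j = - (g p i j - beta * dotv w (partial i y p) * dotv w (partial j y p)).
  rewrite quadric_second_form // /quadric_op dotvBl dotvZl [dotv (partial i y p) w]dotvC.
  by rewrite /first_form.
have pw := parseval sy fy w w Up; rewrite w1 mulr1 in pw.
have nm : nu p * mean2 y p = - (2 - k).
  apply: (mulfI a0); rewrite -bk.
  transitivity (g p 1 1 * (nu p * h p 0 0) - 2 * g p 0 1 * (nu p * h p 0 1)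
    + g p 0 0 * (nu p * h p 1 1)).
    by rewrite /mean2; field.
  rewrite !hE.
  transitivity (- 2 * (g p 0 0 * g p 1 1 - g p 0 1 ^+ 2) + beta * (area2 y p -
     area2 y p * (dotv w (N p) * dotv w (N p)))).
    by rewrite {1}pw; ring.
  by rewrite -/(area2 y p); ring.
have nK : nu p ^+ 2 * gauss y p = 1 - k.
  apply: (mulfI a0); rewrite -bk.
  transitivity ((nu p * h p 0 0) * (nu p * h p 1 1) - (nu p * h p 0 1) ^+ 2).
    by rewrite /gauss; field.
  rewrite !hE.
  transitivity ((g p 0 0 * g p 1 1 - g p 0 1 ^+ 2) - beta * (area2 y p -
     area2 y p * (dotv w (N p) * dotv w (N p)))).
    by rewrite {1}pw; ring.
  by rewrite -/(area2 y p); ring.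
apply: (maslovian_sufficient oU sy fy Up (xi := fun i => partial i nu p / nu p)).
- by apply/eqP => m0; move: nm; rewrite m0 mulr0; lra.
- by rewrite -(@pmulr_rge0 _ (nu p ^+ 2)) ?nK ?subr_ge0 // exprn_even_gt0.
- by move=> i j l; rewrite quadric_cubic.
- move=> i; have := hnu i; cbv beta; move=> E.
  by apply: (mulfI n0); rewrite mulr0 -E; field; exact: n0.
Qed.

End Quadric.

(** * Spheres, cylinders and cones up to congruence *)

Section Models.
Context {R : realType}.
Implicit Types (w a b z : 'rV[R]_3) (r rho : R).

Definition cylinder_about w b rho : set 'rV[R]_3 :=
  [set z | dotv (z - b) (z - b) - dotv (z - b) w ^+ 2 = rho ^+ 2].

(** The half-angle at the apex a has tangent r. *)
Definition cone_about w a r : set 'rV[R]_3 :=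
  [set z | z != a /\ (1 + r ^+ 2) * dotv (z - a) w ^+ 2 = dotv (z - a) (z - a)].

Lemma round_sphereE (c : 'rV[R]_3) rho z : 0 < rho ->
  round_sphere c rho z <-> dotv (z - c) (z - c) = rho ^+ 2.
Proof.
move=> rho0; rewrite /round_sphere /enorm /=; split=> [<-|->].
  by rewrite sqr_sqrtr // dotv_ge0.
by rewrite sqrtr_sqr gtr0_norm.
Qed.

Lemma angle_exists (s t : R) : s ^+ 2 + t ^+ 2 = 1 -> exists v, cos v = s /\ sin v = t.
Proof.
move=> st; have s1 : -1 <= s <= 1.
  by rewrite -ler_norml -(@ler_pXn2r _ 2) ?nnegrE // real_normK ?num_real // expr1n -st lerDl sqr_ge0.
have sa : sin (acos s) = `|t| by rewrite sin_acos // -st addrC addKr sqrtr_sqr.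
have ca : cos (acos s) = s by rewrite acosK // in_itv.
have [t0|t0] := leP 0 t.
  by exists (acos s); rewrite sa ger0_norm.
by exists (- acos s); rewrite cosN sinN sa ltr0_norm ?opprK.
Qed.

Lemma model_coneE r z : r != 0 -> model_cone r z <->
  z 0 2 != 0 /\ z 0 0 ^+ 2 + z 0 1 ^+ 2 = r ^+ 2 * z 0 2 ^+ 2.
Proof.
move=> r0; have q0 : 0 < r ^+ 2 + 1 by rewrite ltr_pwDr ?sqr_ge0.
set s := Num.sqrt (r ^+ 2 + 1); have s0 : s != 0 by rewrite sqrtr_eq0 -ltNge.
split=> [[u [v [u0 ->]]]|[z0 zE]].
  rewrite /cone_param -/s !mxE /=; set th := s / r * v.
  have ct := cos2Dsin2 th; split; first by rewrite mulr1 mulf_neq0 ?invr_neq0.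
  transitivity ((u / s) ^+ 2 * r ^+ 2 * (cos th ^+ 2 + sin th ^+ 2)); first by ring.
  by rewrite ct; ring.
have [v [cv sv]] : exists v, cos v = z 0 0 / (r * z 0 2) /\ sin v = z 0 1 / (r * z 0 2).
  apply: angle_exists; transitivity ((z 0 0 ^+ 2 + z 0 1 ^+ 2) / (r ^+ 2 * z 0 2 ^+ 2)).
    by field; rewrite r0 z0.
  by rewrite zE divff // mulf_neq0 ?expf_neq0.
exists (z 0 2 * s), (v * r / s); split; first by rewrite mulf_neq0.
rewrite /cone_param -/s (_ : s / r * (v * r / s) = v); last by field; rewrite r0 s0.
by apply: row3P; rewrite !mxE /= ?cv ?sv; field; rewrite ?r0 ?s0 ?z0.
Qed.

Lemma orthogonal_dotv (Q : 'M[R]_3) (u v : 'rV[R]_3) : Q *m Q^T = 1%:M ->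
  dotv (u *m Q) (v *m Q) = dotv u v.
Proof. by move=> QQ; rewrite /dotv trmx_mul mulmxA -[u *m Q *m _]mulmxA QQ mulmx1. Qed.

Lemma orthogonal_axis (Q : 'M[R]_3) (u : 'rV[R]_3) : Q *m Q^T = 1%:M ->
  dotv (u *m Q) (row 2 Q) = u 0 2.
Proof.
move=> QQ; rewrite rowE orthogonal_dotv // /dotv trmx_delta -colE.
by rewrite !mxE.
Qed.

Lemma dotv3E (u : 'rV[R]_3) : dotv u u = u 0 0 ^+ 2 + u 0 1 ^+ 2 + u 0 2 ^+ 2.
Proof. by rewrite dotvE3. Qed.

(** The Householder reflection that exchanges w and the third coordinate axis. *)
Lemma orthogonal_with_axis w : dotv w w = 1 ->
  exists Q : 'M[R]_3, Q *m Q^T = 1%:M /\ row 2 Q = w.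
Proof.
move=> w1; pose e : 'rV[R]_3 := delta_mx 0 2; pose v := w - e.
have ee : dotv e e = 1 by rewrite dotvE3 /e !mxE /=; ring.
have [v0|v0] := eqVneq v 0.
  exists 1%:M; split; first by rewrite trmx1 mulmx1.
  by rewrite rowE mulmx1; move/eqP: v0; rewrite subr_eq0 => /eqP ->.
have n0 : dotv v v != 0 by rewrite dotvv_eq0.
have vv : dotv v v = - (2 * dotv e v) by rewrite /v !dotvL w1 ee [dotv w e]dotvC; ring.
have ev : e + v = w by rewrite /v addrC subrK.
clearbody v; pose Q : 'M[R]_3 := 1%:M - (2 / dotv v v) *: (v^T *m v).
have QT : Q^T = Q by rewrite /Q linearB /= linearZ /= trmx_mul trmxK trmx1.
have vQ u : u *m Q = u - (2 * dotv u v / dotv v v) *: v.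
  rewrite /Q mulmxBr mulmx1 -scalemxAr mulmxA; congr (_ - _).
  rewrite [u *m v^T]mx11_scalar mul_scalar_mx scalerA; congr (_ *: _).
  by rewrite -/(dotv u v); ring.
exists Q; split; last first.
  rewrite rowE vQ -/e.
  have -> : 2 * dotv e v / dotv v v = - 1.
    by rewrite -[2 * _]opprK -vv mulNr divff.
  by rewrite scaleN1r opprK.
rewrite QT; apply/row_matrixP => i; rewrite rowE [RHS]rowE mulmxA mulmx1.
move: (delta_mx 0 i) => u; rewrite !vQ dotvBl dotvZl divfK //.
have -> : 2 * (dotv u v - 2 * dotv u v) / dotv v v = - (2 * dotv u v / dotv v v) by ring.
by rewrite scaleNr opprK subrK.
Qed.

Lemma congruent_cylinder rho S : 0 < rho -> congruent (model_cylinder rho) S <->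
  exists w b, dotv w w = 1 /\ S = cylinder_about w b rho.
Proof.
move=> rho0.
have key (Q : 'M[R]_3) b : Q *m Q^T = 1%:M ->
    [set u *m Q + b | u in model_cylinder rho] = cylinder_about (row 2 Q) b rho.
  move=> QQ; have mE u : cylinder_about (row 2 Q) b rho (u *m Q + b) <-> model_cylinder rho u.
    rewrite /cylinder_about /model_cylinder /= addrK orthogonal_dotv // orthogonal_axis //.
    by rewrite dotv3E addrK.
  apply/seteqP; split=> [_ [u Su <-]|z]; first exact/mE.
  have -> : z = ((z - b) *m Q^T) *m Q + b by rewrite -mulmxA (mulmx1C QQ) mulmx1 subrK.
  by move=> /mE Su; exists ((z - b) *m Q^T).
split=> [[Q [b [QQ ->]]]|[w [b [w1 ->]]]].
  exists (row 2 Q), b; split; last exact: key.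
  by rewrite rowE orthogonal_dotv // dotvE3 !mxE /=; ring.
have [Q [QQ <-]] := orthogonal_with_axis w1.
by exists Q, b; split=> //; rewrite key.
Qed.

Lemma congruent_cone r S : r != 0 -> congruent (model_cone r) S <->
  exists w a, dotv w w = 1 /\ S = cone_about w a r.
Proof.
move=> r0.
have key (Q : 'M[R]_3) b : Q *m Q^T = 1%:M ->
    [set u *m Q + b | u in model_cone r] = cone_about (row 2 Q) b r.
  move=> QQ; have mE u : cone_about (row 2 Q) b r (u *m Q + b) <-> model_cone r u.
    rewrite model_coneE // /cone_about /= addrK orthogonal_dotv // orthogonal_axis //.
    rewrite dotv3E -subr_eq0 addrK; split=> [[uQ E]|[u2 E]].
      have uE : u 0 0 ^+ 2 + u 0 1 ^+ 2 = r ^+ 2 * u 0 2 ^+ 2 by move: E; lra.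
      split=> //; apply/eqP => u2; move/eqP: uQ; apply.
      have : dotv u u = 0 by rewrite dotv3E -E u2; ring.
      by move/eqP; rewrite dotvv_eq0 => /eqP ->; rewrite mul0mx.
    split; last by rewrite E; ring.
    apply/eqP => uQ; move/eqP: u2; apply.
    by rewrite -(orthogonal_axis _ QQ) uQ dotv0l.
  apply/seteqP; split=> [_ [u Su <-]|z]; first exact/mE.
  have -> : z = ((z - b) *m Q^T) *m Q + b by rewrite -mulmxA (mulmx1C QQ) mulmx1 subrK.
  by move=> /mE Su; exists ((z - b) *m Q^T).
split=> [[Q [b [QQ ->]]]|[w [b [w1 ->]]]].
  exists (row 2 Q), b; split; last exact: key.
  by rewrite rowE orthogonal_dotv // dotvE3 !mxE /=; ring.
have [Q [QQ <-]] := orthogonal_with_axis w1.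
by exists Q, b; split=> //; rewrite key.
Qed.

End Models.

(** * Principal frames *)

Lemma open_neq0 (R : realType) (V : normedModType R) (U : set V) (f : V -> R) :
  open U -> smooth_on U f -> open (U `&` [set q | f q != 0]).
Proof.
move=> oU sf; rewrite openE => q [Uq fq]; apply: filterI.
  exact: open_nbhs_nbhs.
have cf : {for q, continuous f} by exact/differentiable_continuous/(smooth_diff sf Uq).
have n0 : nbhs (f q) [set x : R | x != 0].
  apply: open_nbhs_nbhs; split=> //; exact: open_neq.
exact: cf _ n0.
Qed.

(** Orthonormal moving frames (e, f, N) diagonalizing the shape operator. *)
Section PrincipalFrame.
Context {R : realType}.
Variables (y : 'rV[R]_2 -> 'rV[R]_3) (U : set 'rV[R]_2).
Hypotheses (oU : open U) (sy : smooth_on U y).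
Hypothesis (fy : forall p, U p -> row_free ('J y p)).
Variables (k1 k2 : 'rV[R]_2 -> R).

Local Notation N := (surface_normal y).
Local Notation g := (first_form y).
Local Notation h := (second_form y).

Hypotheses (sk1 : smooth_on U k1) (sk2 : smooth_on U k2).
Hypothesis k12 : forall q, U q -> k1 q != k2 q.
Hypothesis k12m : forall q, U q -> k1 q + k2 q = mean2 y q.
Hypothesis k12K : forall q, U q -> k1 q * k2 q = gauss y q.

Definition adapted_frame (e f : 'rV[R]_2 -> 'rV[R]_3) q :=
  [/\ [/\ dotv (e q) (e q) = 1, dotv (f q) (f q) = 1 & dotv (e q) (f q) = 0],
      [/\ dotv (e q) (N q) = 0 & dotv (f q) (N q) = 0],
      (forall u v, dotv u v = dotv u (e q) * dotv v (e q)
        + dotv u (f q) * dotv v (f q) + dotv u (N q) * dotv v (N q)),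
      (forall l, dotv (partial l N q) (e q) = - k1 q * dotv (partial l y q) (e q)) &
      (forall l, dotv (partial l N q) (f q) = - k2 q * dotv (partial l y q) (f q))].

Let not_umbilic q (k : R) : U q -> k = k1 q \/ k = k2 q ->
  exists i, partial i N q + k *: partial i y q != 0.
Proof.
move=> Uq kk; apply: contrapT => /forallNP P0.
have hk i j : h q i j = k * g q i j.
  have /negP/negPn/eqP E := P0 i.
  have := congr1 (fun u => dotv u (partial j y q)) E.
  by rewrite dotvDl dotvZl dotv0l (dotv_N1 oU sy fy) // -/(first_form y q i j); lra.
have mk : mean2 y q = 2 * k.
  have := area2_neq0 sy fy Uq; rewrite /mean2 !hk /area2 => a0; field; exact: a0.
have := k12m Uq; rewrite mk => E; have /eqP := k12 Uq; apply.
by case: kk E => ->; lra.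
Qed.

Let orthogonal_rows q i l : U q ->
  dotv (partial l N q + k1 q *: partial l y q) (partial i N q + k2 q *: partial i y q) = 0.
Proof.
move=> Uq; rewrite !dotvL (third_form oU sy fy) // -k12m // -k12K //.
rewrite (dotv_N1 oU sy fy) // [dotv (partial l y q) _]dotvC (dotv_N1 oU sy fy) //.
rewrite (second_formC oU sy fy i l) // /first_form; ring.
Qed.

(** By Cayley-Hamilton, N_i + k2 y_i is in the principal direction of k1 for each
    i, and for some i it does not vanish near p. *)
Lemma principal_frame p : U p -> exists U' (e f : 'rV[R]_2 -> 'rV[R]_3),
  [/\ open U', U' p, U' `<=` U, smooth_on U' e /\ smooth_on U' f &
      forall q, U' q -> adapted_frame e f q].
Proof.
move=> Up; have [i Pi] := not_umbilic Up (or_intror erefl).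
pose P l q := partial l N q + k2 q *: partial l y q.
have sN := smooth_normal oU sy fy.
have sP l : smooth_on U (P l).
  apply: smoothD => //; first exact: smooth_partial.
  by apply: smooth_scalev => //; exact: smooth_partial.
pose n2 q := dotv (P i q) (P i q).
have sn : smooth_on U n2 by exact: smooth_dotv.
pose U' := U `&` [set q | n2 q != 0].
have oU' : open U' by exact: open_neq0.
have U'U : U' `<=` U by move=> q [].
pose e q := (Num.sqrt (n2 q))^-1 *: P i q.
have n2_gt0 q : U' q -> 0 < n2 q by move=> [_ n0]; rewrite lt_neqAle eq_sym n0 dotv_ge0.
have se : smooth_on U' e.
  apply: smooth_scalev => //; last exact: smoothS (sP i).
  apply: smoothV => // [q U'q|]; first by rewrite sqrtr_eq0 -ltNge n2_gt0.
  by apply: smooth_sqrt => //; exact: smoothS sn.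
pose f q := crossv (N q) (e q).
exists U', e, f; split=> //.
- by split=> //; rewrite /= /n2 dotvv_eq0.
- by split=> //; apply: smooth_crossv => //; exact: smoothS sN.
move=> q U'q; have Uq := U'U q U'q; have n20 := n2_gt0 q U'q.
have s0 : Num.sqrt (n2 q) != 0 by rewrite sqrtr_eq0 -ltNge.
have NN := normal_unit sy fy Uq.
have PN l : dotv (P l q) (N q) = 0.
  by rewrite dotvDl dotvZl (partial_normal oU sy fy) // (tangent_normal sy) //; ring.
have ee : dotv (e q) (e q) = 1.
  rewrite dotvZl dotvZr -/(n2 q) mulrA -invfM -expr2 sqr_sqrtr ?ltW // mulVf //.
  by rewrite gt_eqF.
have eN : dotv (e q) (N q) = 0 by rewrite dotvZl PN mulr0.
have Ne : dotv (N q) (e q) = 0 by rewrite dotvC.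
have ff : dotv (f q) (f q) = 1 by rewrite lagrange_identity NN ee Ne; ring.
have fN : dotv (f q) (N q) = 0 by exact: dotv_crossl.
have ef : dotv (e q) (f q) = 0 by rewrite dotvC; exact: dotv_crossr.
have pars u v : dotv u v = dotv u (e q) * dotv v (e q)
        + dotv u (f q) * dotv v (f q) + dotv u (N q) * dotv v (N q).
  have := cross_parseval (N q) (e q) u v; rewrite NN ee Ne -/(f q) => E.
  by transitivity ((1 * 1 - 0 ^+ 2) * dotv u v); [ring|rewrite E; ring].
have Qe l : dotv (partial l N q + k1 q *: partial l y q) (e q) = 0.
  by rewrite dotvZr orthogonal_rows // mulr0.
split=> // l.
  by have := Qe l; rewrite dotvDl dotvZl; lra.
have [j Qj] := not_umbilic Uq (or_introl erefl).
have QN : dotv (partial j N q + k1 q *: partial j y q) (N q) = 0.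
  by rewrite dotvDl dotvZl (partial_normal oU sy fy) // (tangent_normal sy) //; ring.
have Qf : dotv (partial j N q + k1 q *: partial j y q) (f q) != 0.
  apply: contra_neq Qj => Qf0; apply/eqP; rewrite -dotvv_eq0.
  by rewrite pars Qf0 Qe QN; apply/eqP; ring.
have /eqP : dotv (partial j N q + k1 q *: partial j y q) (f q) * dotv (P l q) (f q) = 0.
  by have := orthogonal_rows l j Uq; rewrite pars Qe QN => <-; ring.
rewrite mulf_eq0 (negbTE Qf) /= dotvDl dotvZl => /eqP; lra.
Qed.

End PrincipalFrame.

(** Cartan's structure equations of a principal frame. *)
Section StructureEquations.
Context {R : realType}.
Variables (y : 'rV[R]_2 -> 'rV[R]_3) (U : set 'rV[R]_2).
Hypotheses (oU : open U) (sy : smooth_on U y).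
Hypothesis (fy : forall p, U p -> row_free ('J y p)).
Variables (k1 k2 : 'rV[R]_2 -> R) (e f : 'rV[R]_2 -> 'rV[R]_3).
Hypotheses (sk1 : smooth_on U k1) (sk2 : smooth_on U k2).
Hypotheses (se : smooth_on U e) (sf : smooth_on U f).
Hypothesis ef_adapted : forall q, U q -> adapted_frame y k1 k2 e f q.

Local Notation N := (surface_normal y).
Definition coframe1 q i := dotv (partial i y q) (e q).
Definition coframe2 q i := dotv (partial i y q) (f q).
Definition connection q i := dotv (partial i e q) (f q).
Local Notation eta := coframe1.
Local Notation phi := coframe2.
Local Notation theta := connection.

Let sN : smooth_on U N. Proof. exact: smooth_normal oU sy fy. Qed.
Let de q : U q -> differentiable e q. Proof. exact: smooth_diff. Qed.
Let df q : U q -> differentiable f q. Proof. exact: smooth_diff. Qed.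
Let dN q : U q -> differentiable N q. Proof. exact/smooth_diff/sN. Qed.
Let dy1 i q : U q -> differentiable (partial i y) q.
Proof. exact/smooth_diff/smooth_partial. Qed.
Let dN1 i q : U q -> differentiable (partial i N) q.
Proof. exact/smooth_diff/smooth_partial/sN. Qed.
Let de1 i q : U q -> differentiable (partial i e) q.
Proof. exact/smooth_diff/smooth_partial. Qed.

Let partial_dotv_cst (u v : 'rV[R]_2 -> 'rV[R]_3) (a : R) i q : U q ->
  differentiable u q -> differentiable v q -> (forall r, U r -> dotv (u r) (v r) = a) ->
  dotv (partial i u q) (v q) = - dotv (u q) (partial i v q).
Proof.
move=> Uq du dv uv; have := partial_cst_on i oU Uq uv.
by rewrite partial_dotv //; lra.
Qed.

Let frame_expand q u : U q ->
  u = dotv u (e q) *: e q + dotv u (f q) *: f q + dotv u (N q) *: N q.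
Proof.
move=> Uq; have [[ee ff ef] [eN fN] pars _ _] := ef_adapted Uq.
apply/eqP; rewrite -subr_eq0 -dotvv_eq0; apply/eqP.
have NN := normal_unit sy fy Uq.
rewrite [LHS]pars !dotvL ee ff NN [dotv (f q) (e q)]dotvC [dotv (N q) (e q)]dotvC.
by rewrite [dotv (N q) (f q)]dotvC ef eN fN; ring.
Qed.

Lemma partial_e q i : U q -> partial i e q = theta q i *: f q + (k1 q * eta q i) *: N q.
Proof.
move=> Uq; have [[ee ff ef] [eN fN] pars Ne _] := ef_adapted Uq.
rewrite {1}(frame_expand (partial i e q) Uq).
have -> : dotv (partial i e q) (e q) = 0.
  have h : forall r, U r -> dotv (e r) (e r) = 1 by move=> r /ef_adapted [[]].
  have := partial_dotv_cst i Uq (de Uq) (de Uq) h; rewrite [dotv (e q) _]dotvC; lra.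
have -> : dotv (partial i e q) (N q) = k1 q * eta q i.
  have h : forall r, U r -> dotv (e r) (N r) = 0 by move=> r /ef_adapted [_ []].
  have := partial_dotv_cst i Uq (de Uq) (dN Uq) h; rewrite [dotv (e q) _]dotvC Ne => ->.
  by rewrite /coframe1; ring.
by rewrite scale0r add0r.
Qed.

Lemma partial_f q i : U q -> partial i f q = - theta q i *: e q + (k2 q * phi q i) *: N q.
Proof.
move=> Uq; have [[ee ff ef] [eN fN] pars _ Nf] := ef_adapted Uq.
rewrite {1}(frame_expand (partial i f q) Uq).
have -> : dotv (partial i f q) (f q) = 0.
  have h : forall r, U r -> dotv (f r) (f r) = 1 by move=> r /ef_adapted [[]].
  have := partial_dotv_cst i Uq (df Uq) (df Uq) h; rewrite [dotv (f q) _]dotvC; lra.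
have -> : dotv (partial i f q) (e q) = - theta q i.
  have h : forall r, U r -> dotv (f r) (e r) = 0.
    by move=> r /ef_adapted [[_ _ +] _ _ _ _]; rewrite dotvC.
  have := partial_dotv_cst i Uq (df Uq) (de Uq) h.
  by rewrite [dotv (f q) _]dotvC => ->.
have -> : dotv (partial i f q) (N q) = k2 q * phi q i.
  have h : forall r, U r -> dotv (f r) (N r) = 0 by move=> r /ef_adapted [_ []].
  have := partial_dotv_cst i Uq (df Uq) (dN Uq) h; rewrite [dotv (f q) _]dotvC Nf => ->.
  by rewrite /coframe2; ring.
by rewrite scale0r addr0.
Qed.

Lemma partial_y q i : U q -> partial i y q = eta q i *: e q + phi q i *: f q.
Proof.
move=> Uq; rewrite {1}(frame_expand (partial i y q) Uq).
by rewrite (tangent_normal sy) // scale0r addr0.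
Qed.

Lemma partial_N q i : U q -> partial i N q = - (k1 q * eta q i) *: e q + - (k2 q * phi q i) *: f q.
Proof.
move=> Uq; have [_ _ _ Ne Nf] := ef_adapted Uq.
rewrite {1}(frame_expand (partial i N q) Uq).
by rewrite (partial_normal oU sy fy) // scale0r addr0 Ne Nf !mulNr.
Qed.

Lemma first_form_coframe q i j : U q ->
  first_form y q i j = eta q i * eta q j + phi q i * phi q j.
Proof.
move=> Uq; have [_ _ pars _ _] := ef_adapted Uq.
by rewrite /first_form pars !(tangent_normal sy) // mulr0 addr0.
Qed.

Lemma second_form_coframe q i j : U q ->
  second_form y q i j = k1 q * eta q i * eta q j + k2 q * phi q i * phi q j.
Proof.
move=> Uq; have [_ _ pars Ne Nf] := ef_adapted Uq.
by rewrite /second_form pars !(tangent_normal sy) // Ne Nf /coframe1 /coframe2; ring.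
Qed.

Definition coarea q := eta q 0 * phi q 1 - eta q 1 * phi q 0.

Lemma coarea_neq0 q : U q -> coarea q != 0.
Proof.
move=> Uq; have := area2_neq0 sy fy Uq; rewrite /area2 !first_form_coframe // => a0.
rewrite -sqrf_eq0; apply: contra_neq a0 => w0; rewrite -[RHS]w0 /coarea; ring.
Qed.

(** The members of the coframe are independent, so that a covector which is
    proportional to both must be zero. *)
Lemma coframe_eq0 q (z : 'I_2 -> R) : U q -> eta q 1 * z 0 = eta q 0 * z 1 ->
  phi q 1 * z 0 = phi q 0 * z 1 -> forall i, z i = 0.
Proof.
move=> Uq ez pz i; apply: (mulfI (coarea_neq0 Uq)); rewrite mulr0 /coarea.
have [->|->] := ord2P i.
  transitivity (eta q 0 * (phi q 1 * z 0) - phi q 0 * (eta q 1 * z 0)); first by ring.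
  by rewrite ez pz; ring.
transitivity (phi q 1 * (eta q 0 * z 1) - eta q 1 * (phi q 0 * z 1)); first by ring.
by rewrite -ez -pz; ring.
Qed.

Let partial_eta q k l : U q -> partial k (fun r => eta r l) q =
  dotv (partial k (partial l y) q) (e q) + phi q l * theta q k.
Proof.
move=> Uq; have [[ee ff ef] [eN fN] _ _ _] := ef_adapted Uq.
rewrite /coframe1 partial_dotv; [|exact: dy1|exact: de].
congr (_ + _); rewrite partial_e // dotvDr !dotvZr (tangent_normal sy) //.
by rewrite /coframe2; ring.
Qed.

Let partial_phi q k l : U q -> partial k (fun r => phi r l) q =
  dotv (partial k (partial l y) q) (f q) - eta q l * theta q k.
Proof.
move=> Uq; have [[ee ff ef] [eN fN] _ _ _] := ef_adapted Uq.
rewrite /coframe2 partial_dotv; [|exact: dy1|exact: df].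
rewrite partial_f // dotvDr !dotvZr (tangent_normal sy) //.
by rewrite /coframe1; ring.
Qed.

Let s_eta l : smooth_on U (fun r => eta r l).
Proof. by apply: smooth_dotv => //; exact: smooth_partial. Qed.
Let s_phi l : smooth_on U (fun r => phi r l).
Proof. by apply: smooth_dotv => //; exact: smooth_partial. Qed.

Let smooth_partial_diff (F : 'rV[R]_2 -> R) q : U q -> smooth_on U F -> differentiable F q.
Proof. by move=> Uq sF; exact: (smooth_diff sF Uq). Qed.

(** This equation and the next one are the two projections of the symmetry of the
    second derivatives of N. *)
Lemma codazzi1 q : U q -> (k1 q - k2 q) * (phi q 1 * theta q 0 - phi q 0 * theta q 1) =
  - (partial 0 k1 q * eta q 1 - partial 1 k1 q * eta q 0).
Proof.
move=> Uq; have [[ee ff ef] [eN fN] _ Ne Nf] := ef_adapted Uq.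
have E k l : dotv (partial k (partial l N) q) (e q) - k2 q * phi q l * theta q k =
    - (partial k k1 q * eta q l + k1 q * (dotv (partial k (partial l y) q) (e q)
       + phi q l * theta q k)).
  have : partial k (fun r => dotv (partial l N r) (e r)) q =
      partial k (fun r => (fun=> 0) r - k1 r * eta r l) q.
    apply: (partial_eq_on k oU Uq) => r Ur; have [_ _ _ -> _] := ef_adapted Ur.
    by rewrite sub0r mulNr.
  rewrite partial_dotv; [|exact: dN1|exact: de].
  rewrite partial_sub; [|exact: differentiable_cst
    |by apply: differentiableM; exact: smooth_partial_diff].
  rewrite partial_cst partial_mul; [|exact: smooth_partial_diff..].
  rewrite partial_eta // partial_e // dotvDr !dotvZr (partial_normal oU sy fy) // Nf.
  rewrite /coframe2; lra.
have := E 0 1; have := E 1 0.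
rewrite (partialC 0 1 oU Uq sN) (partialC 0 1 oU Uq sy); lra.
Qed.

Lemma codazzi2 q : U q -> (k1 q - k2 q) * (eta q 1 * theta q 0 - eta q 0 * theta q 1) =
  - (partial 0 k2 q * phi q 1 - partial 1 k2 q * phi q 0).
Proof.
move=> Uq; have [[ee ff ef] [eN fN] _ Ne Nf] := ef_adapted Uq.
have E k l : dotv (partial k (partial l N) q) (f q) + k1 q * eta q l * theta q k =
    - (partial k k2 q * phi q l + k2 q * (dotv (partial k (partial l y) q) (f q)
       - eta q l * theta q k)).
  have : partial k (fun r => dotv (partial l N r) (f r)) q =
      partial k (fun r => (fun=> 0) r - k2 r * phi r l) q.
    apply: (partial_eq_on k oU Uq) => r Ur; have [_ _ _ _ ->] := ef_adapted Ur.
    by rewrite sub0r mulNr.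
  rewrite partial_dotv; [|exact: dN1|exact: df].
  rewrite partial_sub; [|exact: differentiable_cst
    |by apply: differentiableM; exact: smooth_partial_diff].
  rewrite partial_cst partial_mul; [|exact: smooth_partial_diff..].
  rewrite partial_phi // partial_f // dotvDr !dotvZr (partial_normal oU sy fy) // Ne.
  rewrite /coframe1; lra.
have := E 0 1; have := E 1 0.
rewrite (partialC 0 1 oU Uq sN) (partialC 0 1 oU Uq sy); lra.
Qed.

(** A surface with distinct constant principal curvatures is flat: the frame is
    parallel, and the second derivatives of e commute. *)
Lemma constant_curvatures_flat q : U q ->
  (forall r i, U r -> partial i k1 r = 0 /\ partial i k2 r = 0) ->
  (forall r, U r -> k1 r != k2 r) -> k1 q * k2 q = 0.
Proof.
move=> Uq dk k12; have theta0 r i : U r -> theta r i = 0.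
  move=> Ur; have k0 : k1 r - k2 r != 0 by rewrite subr_eq0 k12.
  move: i; apply: (coframe_eq0 Ur).
    apply: (mulfI k0); apply/eqP; rewrite -subr_eq0 -mulrBr codazzi2 //.
    by rewrite (dk r 0 Ur).2 (dk r 1 Ur).2; apply/eqP; ring.
  apply: (mulfI k0); apply/eqP; rewrite -subr_eq0 -mulrBr codazzi1 //.
  by rewrite (dk r 0 Ur).1 (dk r 1 Ur).1; apply/eqP; ring.
have [[ee ff ef] [eN fN] _ Ne Nf] := ef_adapted Uq.
have E k l : dotv (partial k (partial l e) q) (f q) = - (k1 q * eta q l * (k2 q * phi q k)).
  have h : forall r, U r -> dotv (partial l e r) (f r) = 0 by move=> r; exact: theta0.
  rewrite (partial_dotv_cst k Uq (de1 l Uq) (df Uq) h) partial_e // partial_f //.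
  rewrite !theta0 // oppr0 !scale0r !add0r dotvZl dotvZr (normal_unit sy fy Uq); ring.
have := E 0 1; rewrite (partialC 0 1 oU Uq se) E => E01.
apply: (mulIf (coarea_neq0 Uq)); rewrite mul0r /coarea; move: E01; lra.
Qed.

End StructureEquations.

(** * Flat surfaces and their rulings *)

(** The data of a cone or a cylinder at a point: the unit direction e of the
    ruling, and the slope s with which - 1 / m grows along it. *)
Definition ruling (R : realType) (y : 'rV[R]_2 -> 'rV[R]_3) q (e : 'rV[R]_3) (s : R) :=
  [/\ dotv e e = 1, dotv e (surface_normal y q) = 0,
      (forall l, dotv e (partial l (surface_normal y) q) = 0) &
      (forall l, partial l (mean2 y) q = s * mean2 y q ^+ 2 * dotv (partial l y q) e)].

Section Developable.
Context {R : realType}.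
Variables (y : 'rV[R]_2 -> 'rV[R]_3) (U : set 'rV[R]_2).
Hypotheses (oU : open U) (sy : smooth_on U y).
Hypothesis (fy : forall p, U p -> row_free ('J y p)).

Local Notation N := (surface_normal y).
Local Notation m := (mean2 y).

Hypothesis m0 : forall q, U q -> m q != 0.
Hypothesis K0 : forall q, U q -> gauss y q = 0.
Hypothesis grad_m : forall q, U q -> second_form_null y q (fun l => partial l m q).

Section Frame.
Variables (V : set 'rV[R]_2) (e f : 'rV[R]_2 -> 'rV[R]_3).
Hypotheses (oV : open V) (VU : V `<=` U).
Hypotheses (se : smooth_on V e) (sf : smooth_on V f).
Hypothesis ef_adapted : forall q, V q -> adapted_frame y (fun=> 0) m e f q.

Local Notation eta := (coframe1 y e).
Local Notation phi := (coframe2 y f).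
Local Notation theta := (connection e f).

Let syV : smooth_on V y. Proof. exact: smoothS sy. Qed.
Let fyV q : V q -> row_free ('J y q). Proof. by move=> /VU; exact: fy. Qed.
Let sk1 : smooth_on V (fun=> 0 : R). Proof. exact: smooth_cst. Qed.
Let sm : smooth_on V m. Proof. exact: smooth_mean2 oV syV fyV. Qed.
Let area0 q (Vq : V q) := coarea_neq0 syV fyV ef_adapted Vq.

Let grad_m_ruling q : V q -> eta q 1 * partial 0 m q = eta q 0 * partial 1 m q.
Proof.
move=> Vq; have w0 := area0 Vq; have mq := m0 (VU Vq).
have E k : m q * phi q k * coarea y e f q *
    (eta q 1 * partial 0 m q - eta q 0 * partial 1 m q) = 0.
  have := grad_m (VU Vq) k; cbv beta; move=> Z; rewrite -[RHS]oppr0 -Z.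
  rewrite !(first_form_coframe syV ef_adapted _ _ Vq).
  by rewrite !(second_form_coframe syV ef_adapted _ _ Vq) /coarea; ring.
apply/eqP; rewrite -subr_eq0; apply/eqP.
apply: (mulfI mq); apply: (mulfI w0); apply: (mulfI w0); rewrite !mulr0.
have E0 := E 0; have E1 := E 1.
transitivity (eta q 0 * (m q * phi q 1 * coarea y e f q *
    (eta q 1 * partial 0 m q - eta q 0 * partial 1 m q)) -
  eta q 1 * (m q * phi q 0 * coarea y e f q *
    (eta q 1 * partial 0 m q - eta q 0 * partial 1 m q))).
  by rewrite {2}/coarea; ring.
by rewrite E0 E1; ring.
Qed.

Definition ruling_rate q := (partial 0 m q * eta q 0 + partial 1 m q * eta q 1) /
  (m q ^+ 2 * (eta q 0 ^+ 2 + eta q 1 ^+ 2)).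
Local Notation s := ruling_rate.

Let eta_neq0 q : V q -> eta q 0 ^+ 2 + eta q 1 ^+ 2 != 0.
Proof.
move=> Vq; have := area0 Vq; rewrite /coarea => w0.
apply: contra_neq w0 => n0; have e0 : eta q 0 = 0 by nra.
by have e1 : eta q 1 = 0 by [nra|]; rewrite e0 e1; ring.
Qed.

Lemma partial_mean2_ruling q l : V q -> partial l m q = s q * m q ^+ 2 * eta q l.
Proof.
move=> Vq; have n0 := eta_neq0 Vq; have mq := m0 (VU Vq); have E := grad_m_ruling Vq.
have m2 : m q ^+ 2 * (eta q 0 ^+ 2 + eta q 1 ^+ 2) != 0 by rewrite mulf_neq0 ?expf_neq0.
apply: (mulIf n0).
transitivity ((partial 0 m q * eta q 0 + partial 1 m q * eta q 1) * eta q l); last first.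
  by rewrite /s; field; rewrite n0 mq.
have [->|->] := ord2P l.
  transitivity (partial 0 m q * eta q 0 * eta q 0 + (eta q 1 * partial 0 m q) * eta q 1).
    by ring.
  by rewrite E; ring.
transitivity (partial 1 m q * eta q 1 * eta q 1 + (eta q 0 * partial 1 m q) * eta q 0).
  by ring.
by rewrite -E; ring.
Qed.

Let s_eta l : smooth_on V (fun r => eta r l).
Proof. by apply: smooth_dotv => //; exact: smooth_partial. Qed.

Lemma smooth_ruling_rate : smooth_on V s.
Proof.
have sm1 l : smooth_on V (partial l m) by exact: smooth_partial.
apply: smoothM => //; first by apply: smoothD => //; apply: smoothM.
apply: smoothV => // [q Vq|].
  by rewrite mulf_neq0 ?expf_neq0 ?(m0 (VU Vq)) ?eta_neq0.
apply: smoothM => //; first exact: smoothX.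
by apply: smoothD => //; exact: smoothX.
Qed.

Let connectionE q i : V q -> theta q i = - (s q * m q) * phi q i.
Proof.
move=> Vq; have mq := m0 (VU Vq); apply/eqP; rewrite -subr_eq0; apply/eqP.
have c1 := codazzi1 oV syV fyV sk1 se ef_adapted Vq.
have c2 := codazzi2 oV syV fyV sm se sf ef_adapted Vq.
rewrite !partial_cst in c1; rewrite !partial_mean2_ruling // in c2.
move: i; apply: (coframe_eq0 syV fyV ef_adapted Vq (z := fun i => theta q i - - (s q * m q) * phi q i)).
  by apply: (mulfI mq); move: c2; lra.
by apply: (mulfI mq); move: c1; lra.
Qed.

Let partial_eE q i : V q -> partial i e q = s q *: partial i N q.
Proof.
move=> Vq; rewrite (partial_e oV syV fyV se ef_adapted) // (partial_N oV syV fyV ef_adapted) //.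
rewrite connectionE // !mul0r oppr0 !scale0r addr0 add0r scalerA; congr (_ *: _); ring.
Qed.

(** The map e / m has derivative - s dy.  The symmetry of its second derivatives
    reads s_0 y_1 = s_1 y_0, where y_0 and y_1 are independent. *)
Lemma partial_ruling_rate q i : V q -> partial i s q = 0.
Proof.
move=> Vq; pose Z r := (m r)^-1 *: e r.
have sV : smooth_on V (fun r => (m r)^-1).
  by apply: smoothV => // r Vr; exact/m0/VU.
have sZ : smooth_on V Z by exact: smooth_scalev.
have dm r : V r -> differentiable m r by exact/smooth_diff/sm.
have ZE j r : V r -> partial j Z r = - s r *: partial j y r.
  move=> Vr; have mr := m0 (VU Vr); rewrite partial_scalev; first last.
  - exact: (smooth_diff se Vr).
  - exact: (smooth_diff sV Vr).
  rewrite partial_inv //; last exact: dm.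
  rewrite (partial_e oV syV fyV se ef_adapted) // partial_mean2_ruling //.
  rewrite (partial_y syV fyV ef_adapted) // connectionE // mul0r scale0r addr0.
  rewrite scalerDr !scalerA; congr (_ *: _ + _ *: _); field; exact: mr.
have E k l : partial k (partial l Z) q =
    - partial k s q *: partial l y q - s q *: partial k (partial l y) q.
  rewrite (partial_eq_on k oV Vq (ZE l)).
  rewrite partial_scalev; first last.
  - exact: (smooth_diff (smooth_partial l syV) Vq).
  - by apply: differentiableN; exact: (smooth_diff smooth_ruling_rate Vq).
  have -> : partial k (fun r => - s r) q = - partial k s q.
    have -> : (fun r => - s r) = (fun r => (fun=> 0) r - s r) by apply/funext => r; rewrite sub0r.
    by rewrite partial_sub ?partial_cst ?sub0r //; exact: (smooth_diff smooth_ruling_rate Vq).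
  by rewrite [X in _ + X]scaleNr.
have E01 : partial 0 s q *: partial 1 y q = partial 1 s q *: partial 0 y q.
  have := E 0 1; rewrite (partialC 0 1 oV Vq sZ) E (partialC 0 1 oV Vq syV) !scaleNr.
  by move/addIr/oppr_inj.
move: i; apply: (coframe_eq0 syV fyV ef_adapted Vq (z := fun i => partial i s q)).
  have := congr1 (fun u => dotv u (e q)) E01.
  by rewrite !dotvZl /coframe1 [_ * partial 0 s q]mulrC [_ * partial 1 s q]mulrC.
have := congr1 (fun u => dotv u (f q)) E01.
by rewrite !dotvZl /coframe2 [_ * partial 0 s q]mulrC [_ * partial 1 s q]mulrC.
Qed.

Lemma frame_ruling q : V q -> [/\ ruling y q (e q) (s q),
  forall i, partial i s q = 0, forall i, partial i e q = s q *: partial i N q &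
  forall i, partial i N q = - m q *: (partial i y q - dotv (partial i y q) (e q) *: e q)].
Proof.
move=> Vq; have [[ee _ _] [eN _] _ Ne _] := ef_adapted Vq.
split.
- split=> // l; last exact: partial_mean2_ruling.
  by rewrite dotvC Ne; ring.
- by move=> i; exact: partial_ruling_rate.
- by move=> i; exact: partial_eE.
move=> i; rewrite (partial_y syV fyV ef_adapted) // (partial_N oV syV fyV ef_adapted) //.
rewrite dotvDl !dotvZl ee dotvC; have [[_ _ ->] _ _ _ _] := ef_adapted Vq.
rewrite mulr1 mulr0 addr0 [X in X - _]addrC addrK scalerA.
by rewrite mul0r oppr0 scale0r add0r mulNr.
Qed.

End Frame.

(** These equations characterize pieces of cylinders (s = 0) and of circular
    cones with s as the tangent of the half-angle. *)
Lemma developable_ruling p : U p -> exists V (e : 'rV[R]_2 -> 'rV[R]_3) (s : 'rV[R]_2 -> R),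
  [/\ open V, V p, V `<=` U, smooth_on V e /\ smooth_on V s &
   forall q, V q -> [/\ ruling y q (e q) (s q),
    forall i, partial i s q = 0, forall i, partial i e q = s q *: partial i N q &
    forall i, partial i N q = - m q *: (partial i y q - dotv (partial i y q) (e q) *: e q)]].
Proof.
move=> Up; have sm := smooth_mean2 oU sy fy.
have k12 q : U q -> 0 != m q by move=> Uq; rewrite eq_sym m0.
have [V [e [f [oV Vp VU [se sf] ad]]]] :=
  @principal_frame R y U oU sy fy (fun=> 0) m sm
   k12 (fun q _ => add0r _)
   (fun q Uq => etrans (mul0r _) (esym (K0 Uq))) p Up.
exists V, e, (ruling_rate e); split=> //.
  split=> //; exact: (smooth_ruling_rate oV VU se ad).
by move=> q Vq; exact: (frame_ruling oV VU se sf ad Vq).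
Qed.

End Developable.

(** * Osculating models *)

Section Rulings.
Context {R : realType}.
Variables (y : 'rV[R]_2 -> 'rV[R]_3) (U : set 'rV[R]_2).
Hypotheses (oU : open U) (sy : smooth_on U y).
Hypothesis (fy : forall p, U p -> row_free ('J y p)).

Local Notation N := (surface_normal y).
Local Notation g := (first_form y).
Local Notation m := (mean2 y).

(** The quotient |grad m|^2 / m^4, which does not depend on the chart and is
    s^2 on a surface with a ruling (e, s); at other points it makes sense
    without one. *)
Definition gradnorm q := (g q 1 1 * partial 0 m q ^+ 2
  - 2 * g q 0 1 * partial 0 m q * partial 1 m q + g q 0 0 * partial 1 m q ^+ 2)
  / (area2 y q * m q ^+ 4).

Lemma ruling_gradnorm q e s : U q -> m q != 0 -> ruling y q e s -> gradnorm q = s ^+ 2.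
Proof.
move=> Uq mq [ee eN _ ml]; have a0 := area2_neq0 sy fy Uq.
have := parseval sy fy e e Uq; rewrite ee eN !mulr0 mulr1 add0r => E.
rewrite /gradnorm !ml [dotv (partial 0 y q) e]dotvC [dotv (partial 1 y q) e]dotvC.
transitivity (s ^+ 2 * m q ^+ 4 * area2 y q / (area2 y q * m q ^+ 4)).
  by rewrite [X in _ = _ * X / _]E; congr (_ / _); ring.
by field; rewrite a0 mq.
Qed.

(** As m <> 0, some derivative N_l is not zero, and e is orthogonal to the
    independent vectors N and N_l. *)
Lemma ruling_unique q e s e' s' : U q -> m q != 0 -> ruling y q e s -> ruling y q e' s' ->
  (e' = e /\ s' = s) \/ (e' = - e /\ s' = - s).
Proof.
move=> Uq mq [ee eN eN1 em] [ee' eN' eN1' em'].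
have NN := normal_unit sy fy Uq.
have [l n0] : exists l, dotv (partial l N q) (partial l N q) != 0.
  apply: contrapT => /forallNP n0.
  have N0 l : partial l N q = 0.
    by apply/eqP; rewrite -dotvv_eq0; apply/negPn/negP; exact: n0.
  by move/eqP: mq; apply; rewrite /mean2 /second_form !N0 !dotv0r; ring.
have dNN : dotv (N q) (partial l N q) = 0 by rewrite dotvC (partial_normal oU sy fy).
pose c := crossv (N q) (partial l N q).
have cp u v : dotv u (N q) = 0 -> dotv u (partial l N q) = 0 ->
    dotv (partial l N q) (partial l N q) * dotv u v = dotv u c * dotv v c.
  move=> uN ul; have := cross_parseval (N q) (partial l N q) u v.
  rewrite NN dNN uN ul => E; rewrite -[LHS]mul1r -[RHS]addr0; move: E; rewrite -/c; lra.
have c1 := cp e e eN (eN1 l); have c2 := cp e' e' eN' (eN1' l); have c3 := cp e e' eN (eN1 l).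
rewrite ee mulr1 in c1; rewrite ee' mulr1 in c2.
have : dotv e e' ^+ 2 = 1.
  apply: (mulfI n0); apply: (mulfI n0); rewrite mulr1.
  transitivity ((dotv (partial l N q) (partial l N q) * dotv e e') ^+ 2); first by ring.
  by rewrite c3 {1}c1 c2; ring.
have sE t : e' = t *: e -> t ^+ 2 = 1 -> s' = t * s.
  move=> et t2; apply: contrapT => st.
  have : e = 0.
    apply: (frame_eq0 sy fy Uq eN) => k.
    have := em' k; rewrite (em k) et dotvZr dotvC => E; apply/eqP/negPn/negP => ek0.
    apply: st; apply: (mulIf (expf_neq0 2 mq)); apply: (mulIf ek0).
    transitivity (t * (s' * m q ^+ 2 * (t * dotv e (partial k y q)))); last by rewrite -E; ring.
    by transitivity (s' * m q ^+ 2 * t ^+ 2 * dotv e (partial k y q)); [rewrite t2; ring|ring].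
  by move=> e0; move: ee; rewrite e0 dotv0l => /eqP; rewrite eq_sym oner_eq0.
move/eqP; rewrite sqrf_eq1 => /orP[]/eqP ee2; [left|right].
  have e'e : e' = e.
    by apply/eqP; rewrite -subr_eq0 -dotvv_eq0 !dotvL ee ee' [dotv e' e]dotvC ee2; apply/eqP; ring.
  by split=> //; rewrite -[s]mul1r; apply: sE; rewrite ?scale1r // expr1n.
have e'e : e' = - e.
  by apply/eqP; rewrite -subr_eq0 -dotvv_eq0 !dotvL ee ee' [dotv e' e]dotvC ee2; apply/eqP; ring.
by split=> //; rewrite -mulN1r; apply: sE; rewrite ?scaleN1r // sqrrN expr1n.
Qed.

(** The models with the curvature, the normal and the ruling of the surface at q.
    The cylinder has its axis through the centre of curvature; the cone has its
    apex where 1 / m, being linear along the ruling, vanishes. *)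
Definition osculating_sphere q : set 'rV[R]_3 :=
  round_sphere (y q + (2 / m q) *: N q) (2 / `|m q|).

Definition cylinder_of q e := cylinder_about e (y q + (m q)^-1 *: N q) (m q)^-1.

Definition cone_of q e s :=
  cone_about ((Num.sqrt (1 + s ^+ 2))^-1 *: (e - s *: N q)) (y q + (m q * s)^-1 *: e) s.

Definition osculating_cylinder q S := exists e s, ruling y q e s /\ S = cylinder_of q e.

Definition osculating_cone q S := exists e s, ruling y q e s /\ S = cone_of q e s.

Lemma cylinder_aboutN (w b : 'rV[R]_3) rho : cylinder_about (- w) b rho = cylinder_about w b rho.
Proof.
by apply/seteqP; split=> z; rewrite /cylinder_about /= dotvNr sqrrN.
Qed.

Lemma cone_aboutN (w b : 'rV[R]_3) r : cone_about (- w) b (- r) = cone_about w b r.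
Proof.
by apply/seteqP; split=> z; rewrite /cone_about /= dotvNr !sqrrN.
Qed.

Lemma osculating_cylinder_unique q S S' : U q -> m q != 0 ->
  osculating_cylinder q S -> osculating_cylinder q S' -> S = S'.
Proof.
move=> Uq mq [e [s [r ->]]] [e' [s' [r' ->]]].
have [[-> _]|[-> _]] // := ruling_unique Uq mq r r'.
by rewrite /cylinder_of cylinder_aboutN.
Qed.

Lemma osculating_cone_unique q S S' : U q -> m q != 0 ->
  osculating_cone q S -> osculating_cone q S' -> S = S'.
Proof.
move=> Uq mq [e [s [r ->]]] [e' [s' [r' ->]]].
have [[-> ->]|[-> ->]] // := ruling_unique Uq mq r r'.
rewrite /cone_of sqrrN; set k := (Num.sqrt _)^-1.
have -> : k *: (- e - - s *: N q) = - (k *: (e - s *: N q)).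
  by rewrite scaleNr opprK -scalerN opprB addrC.
have -> : (m q * - s)^-1 *: - e = (m q * s)^-1 *: e.
  by rewrite mulrN invrN scaleNr scalerN opprK.
by rewrite cone_aboutN.
Qed.

Lemma mem_osculating_sphere q : U q -> osculating_sphere q (y q).
Proof.
move=> Uq; rewrite /osculating_sphere /round_sphere /enorm /= opprD addrA subrr add0r.
rewrite (_ : dotv _ _ = (2 / m q) ^+ 2); last first.
  by rewrite !dotvL (normal_unit sy fy Uq); ring.
by rewrite sqrtr_sqr normrM normfV ger0_norm.
Qed.

Lemma mem_osculating_cylinder q S : U q -> osculating_cylinder q S -> S (y q).
Proof.
move=> Uq [e [s [[_ eN _ _] ->]]]; rewrite /cylinder_of /cylinder_about /=.
rewrite opprD addrA subrr add0r !dotvL (normal_unit sy fy Uq) [dotv (N q) e]dotvC eN.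
by ring.
Qed.

Lemma mem_osculating_cone q S : U q -> m q != 0 -> gradnorm q != 0 ->
  osculating_cone q S -> S (y q).
Proof.
move=> Uq mq g0 [e [s [r ->]]]; have [ee eN _ _] := r.
have s0 : s != 0 by move: g0; rewrite (ruling_gradnorm Uq mq r) sqrf_eq0.
have ms : m q * s != 0 by rewrite mulf_neq0.
rewrite /cone_of /cone_about /=; split.
  rewrite -subr_eq0 opprD addrA subrr add0r oppr_eq0 scaler_eq0 invr_eq0 (negbTE ms) /=.
  by apply/eqP => e0; move: ee; rewrite e0 dotv0l => /eqP; rewrite eq_sym oner_eq0.
have q0 : 0 < 1 + s ^+ 2 by rewrite ltr_pwDl ?sqr_ge0.
have : Num.sqrt (1 + s ^+ 2) ^+ 2 = 1 + s ^+ 2 by rewrite sqr_sqrtr // ltW.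
have k0 : Num.sqrt (1 + s ^+ 2) != 0 by rewrite sqrtr_eq0 -ltNge.
move: (Num.sqrt _) k0 => k k0 kE.
rewrite opprD addrA subrr add0r !dotvL ee eN -kE; field.
by move: ms; rewrite mulf_eq0 negb_or => /andP[-> ->]; rewrite k0.
Qed.

Lemma osculating_cylinder_model q S : m q != 0 -> osculating_cylinder q S ->
  is_circular_cylinder S.
Proof.
move=> mq [e [s [[ee _ _ _] ->]]]; exists `|(m q)^-1|.
have r0 : 0 < `|(m q)^-1| by rewrite normr_gt0 invr_eq0.
split=> //; apply/congruent_cylinder => //; exists e, (y q + (m q)^-1 *: N q); split=> //.
by apply/seteqP; split=> z; rewrite /cylinder_of /cylinder_about /= real_normK ?num_real.
Qed.

Lemma osculating_cone_model q S : U q -> m q != 0 -> gradnorm q != 0 ->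
  osculating_cone q S -> is_circular_cone S.
Proof.
move=> Uq mq g0 [e [s [r ->]]]; have [ee eN _ _] := r.
have s0 : s != 0 by move: g0; rewrite (ruling_gradnorm Uq mq r) sqrf_eq0.
exists s; split=> //; apply/congruent_cone => //.
exists ((Num.sqrt (1 + s ^+ 2))^-1 *: (e - s *: N q)), (y q + (m q * s)^-1 *: e); split=> //.
have q0 : 0 < 1 + s ^+ 2 by rewrite ltr_pwDl ?sqr_ge0.
transitivity ((Num.sqrt (1 + s ^+ 2))^-1 ^+ 2 * (1 + s ^+ 2)).
  rewrite !dotvL ee (normal_unit sy fy Uq) [dotv (N q) e]dotvC eN; ring.
by rewrite exprVn sqr_sqrtr ?ltW // mulVf // gt_eqF.
Qed.

Lemma osculating_sphere_model q : m q != 0 -> is_round_sphere (osculating_sphere q).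
Proof.
move=> mq; exists (y q + (2 / m q) *: N q), (2 / `|m q|).
by rewrite divr_gt0 // normr_gt0.
Qed.

End Rulings.

(** * Local rigidity *)

Section LocalRigidity.
Context {R : realType}.
Variables (y : 'rV[R]_2 -> 'rV[R]_3) (U : set 'rV[R]_2).
Hypotheses (oU : open U) (sy : smooth_on U y).
Hypothesis (fy : forall p, U p -> row_free ('J y p)).

Local Notation N := (surface_normal y).
Local Notation g := (first_form y).
Local Notation h := (second_form y).
Local Notation m := (mean2 y).
Local Notation K := (gauss y).

Hypothesis m0 : forall q, U q -> m q != 0.

Let sm : smooth_on U m. Proof. exact: smooth_mean2 oU sy fy. Qed.
Let sK : smooth_on U K. Proof. exact: smooth_gauss oU sy fy. Qed.
Let sN : smooth_on U N. Proof. exact: smooth_normal oU sy fy. Qed.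
Let sA : smooth_on U (area2 y). Proof. exact: smooth_area2 oU sy. Qed.
Let sg i j : smooth_on U (fun q => g q i j). Proof. exact: smooth_first_form oU sy i j. Qed.
Let sm1 l : smooth_on U (partial l m). Proof. exact: smooth_partial. Qed.

Let diffU (F : 'rV[R]_2 -> R) q : smooth_on U F -> U q -> differentiable F q.
Proof. exact: smooth_diff. Qed.

Lemma gradnorm_eq0 q : U q -> gradnorm y q = 0 -> forall l, partial l m q = 0.
Proof.
move=> Uq; have a0 := area2_gt0 sy fy Uq; have mq := m0 Uq.
rewrite /gradnorm => /eqP; rewrite mulf_eq0 invr_eq0 mulf_eq0 expf_eq0 (negbTE mq) /=.
rewrite (gt_eqF a0) !orbF => /eqP E.
have g00 : 0 <= g q 0 0 by exact: dotv_ge0.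
have E' : (g q 0 0 * partial 1 m q - g q 0 1 * partial 0 m q) ^+ 2
    + area2 y q * partial 0 m q ^+ 2 = 0.
  by rewrite -[RHS](mulr0 (g q 0 0)) -E /area2; ring.
have d0 : partial 0 m q = 0.
  apply/eqP; rewrite -sqrf_eq0; apply/eqP; apply: (mulfI (lt0r_neq0 a0)); rewrite mulr0.
  have s1 := sqr_ge0 (g q 0 0 * partial 1 m q - g q 0 1 * partial 0 m q).
  have s2 : 0 <= area2 y q * partial 0 m q ^+ 2 by rewrite mulr_ge0 ?sqr_ge0 // ltW.
  by lra.
have g0 : g q 0 0 != 0.
  apply/eqP => g0; move: a0.
  by rewrite /area2 g0 mul0r sub0r oppr_gt0 ltNge sqr_ge0.
move: E'; rewrite d0 expr0n /= !mulr0 subr0 addr0 => /eqP.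
rewrite sqrf_eq0 mulf_eq0 (negbTE g0) /= => /eqP d1 l.
by have [->|->] := ord2P l.
Qed.

Section Gradient.
Hypothesis grad_m : forall q, U q -> second_form_null y q (fun l => partial l m q).

(** At its zeros gradnorm has zero derivative as a quadratic form in the gradient
    of m; elsewhere K = 0 nearby, and gradnorm is the square of the constant
    slope of the rulings. *)
Lemma partial_gradnorm q i : U q -> partial i (gradnorm y) q = 0.
Proof.
move=> Uq; pose n2 r := partial 0 m r ^+ 2 + partial 1 m r ^+ 2.
have [n0|n0] := eqVneq (n2 q) 0.
  have d0 : partial 0 m q = 0 by move: n0; rewrite /n2; nra.
  have d1 : partial 1 m q = 0 by move: n0; rewrite /n2 d0; nra.
  pose D r := (area2 y r * m r ^+ 4)^-1.
  have sD : smooth_on U D.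
    apply: smoothV => // [r Ur|]; last by apply: smoothM => //; exact: smoothX.
    by rewrite mulf_neq0 ?expf_neq0 ?m0 ?(area2_neq0 sy fy Ur).
  pose P r := (g r 1 1 * partial 0 m r - g r 0 1 * partial 1 m r) * D r.
  pose Q r := (g r 0 0 * partial 1 m r - g r 0 1 * partial 0 m r) * D r.
  have sP : smooth_on U P.
    by apply: smoothM => //; apply: smoothB => //; apply: smoothM.
  have sQ : smooth_on U Q.
    by apply: smoothM => //; apply: smoothB => //; apply: smoothM.
  have P0 : P q = 0 by rewrite /P d0 d1; ring.
  have Q0 : Q q = 0 by rewrite /Q d0 d1; ring.
  have -> : gradnorm y = (fun r => partial 0 m r * P r + partial 1 m r * Q r).
    by apply/funext => r; rewrite /gradnorm /P /Q /D; ring.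
  clearbody P Q; rewrite partial_add; first last.
  - by apply: differentiableM; exact: diffU.
  - by apply: differentiableM; exact: diffU.
  rewrite (partial_mul i (diffU (sm1 0) Uq) (diffU sP Uq)).
  rewrite (partial_mul i (diffU (sm1 1) Uq) (diffU sQ Uq)).
  by rewrite P0 Q0 d0 d1 !mulr0 !mul0r !addr0.
pose U1 := U `&` [set r | n2 r != 0].
have oU1 : open U1.
  by apply: open_neq0 => //; apply: smoothD => //; exact: smoothX.
have U1U : U1 `<=` U by move=> r [].
have K0 r : U1 r -> K r = 0.
  move=> [Ur nr]; apply/eqP/negPn/negP => Kr.
  have Z := gauss_null oU sy fy Ur (grad_m Ur).
  have dz l : partial l m r = 0.
    by have /eqP := Z l; rewrite mulf_eq0 (negbTE Kr) => /eqP.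
  by move/eqP: nr; apply; rewrite /n2 !dz; ring.
have U1q : U1 q by split.
have [V [e [s [oV Vq VU [se ss] ES]]]] := developable_ruling oU1 (smoothS U1U sy)
  (fun r H => fy (U1U r H)) (fun r H => m0 (U1U r H)) K0 (fun r H => grad_m (U1U r H)) U1q.
have E r : V r -> gradnorm y r = s r ^+ 2.
  move=> Vr; have Ur := U1U r (VU r Vr); have [rul _ _ _] := ES r Vr.
  exact: (ruling_gradnorm sy fy Ur (m0 Ur) rul).
rewrite (partial_eq_on i oV Vq E) partial_sqr; last exact: (smooth_diff ss Vq).
by have [_ -> _ _] := ES q Vq; rewrite mulr0.
Qed.

Lemma smooth_gradnorm : smooth_on U (gradnorm y).
Proof.
apply: smoothM => //; last first.
  apply: smoothV => // [r Ur|]; last by apply: smoothM => //; exact: smoothX.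
  by rewrite mulf_neq0 ?expf_neq0 ?m0 ?(area2_neq0 sy fy Ur).
apply: smoothD => //; last by apply: smoothM => //; exact: smoothX.
apply: smoothB => //; first by apply: smoothM => //; exact: smoothX.
by apply: smoothM => //; apply: smoothM => //; apply: smoothM => //; exact: smooth_cst.
Qed.

Lemma gradnorm_near p : U p -> \forall q \near p, gradnorm y q = gradnorm y p.
Proof.
move=> Up; apply: (constant_near_real oU Up smooth_gradnorm) => q j.
exact: partial_gradnorm.
Qed.

Section Flat.
Hypothesis K0 : forall q, U q -> K q = 0.

Lemma osculating_cylinder_exists p : U p -> exists S, osculating_cylinder y p S.
Proof.
move=> Up; have [V [e [s [_ Vp _ _ ES]]]] := developable_ruling oU sy fy m0 K0 grad_m Up.
by have [rul _ _ _] := ES p Vp; exists (cylinder_of y p (e p)), (e p), (s p).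
Qed.

Lemma osculating_cone_exists p : U p -> exists S, osculating_cone y p S.
Proof.
move=> Up; have [V [e [s [_ Vp _ _ ES]]]] := developable_ruling oU sy fy m0 K0 grad_m Up.
by have [rul _ _ _] := ES p Vp; exists (cone_of y p (e p) (s p)), (e p), (s p).
Qed.

Lemma cylinder_aboutE (w b : 'rV[R]_3) rho z : dotv w w = 1 -> cylinder_about w b rho z <->
  dotv (z - dotv z w *: w - (b - dotv b w *: w))
   (z - dotv z w *: w - (b - dotv b w *: w)) = rho ^+ 2.
Proof.
move=> ww; rewrite /cylinder_about /= !dotvL ww [dotv w z]dotvC [dotv w b]dotvC [dotv b z]dotvC.
by split=> <-; ring.
Qed.

(** Here s = 0, and both the direction e and the foot c of the perpendicular from
    the origin to the axis have zero derivative. *)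
Lemma osculating_cylinder_near p S : U p -> (forall q, U q -> gradnorm y q = 0) ->
  osculating_cylinder y p S -> \forall q \near p, osculating_cylinder y q S.
Proof.
move=> Up g0 pS; have [V [e [s [oV Vp VU [se ss] ES]]]] := developable_ruling oU sy fy m0 K0 grad_m Up.
have s0 q : V q -> s q = 0.
  move=> Vq; have Uq := VU q Vq; have [rul _ _ _] := ES q Vq.
  by apply/eqP; rewrite -sqrf_eq0 -(ruling_gradnorm sy fy Uq (m0 Uq) rul) g0.
have me q i : V q -> partial i m q = 0 by move=> Vq; apply: gradnorm_eq0; [exact: VU|exact/g0/VU].
have ee0 q i : V q -> partial i e q = 0.
  by move=> Vq; have [_ _ -> _] := ES q Vq; rewrite s0 // scale0r.
have smV := smoothS VU sm; have sNV := smoothS VU sN; have syV := smoothS VU sy.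
pose b q := y q + (m q)^-1 *: N q.
have smV' : smooth_on V (fun q => (m q)^-1) by apply: smoothV => // r Vr; exact/m0/VU.
have sb : smooth_on V b by apply: smoothD => //; apply: smooth_scalev.
have bE q i : V q -> partial i b q = dotv (partial i y q) (e q) *: e q.
  move=> Vq; have Uq := VU q Vq; rewrite (partial_offset i Vq syV smV' sNV).
  rewrite partial_inv; [|exact: m0|exact: (smooth_diff sm Uq)].
  rewrite me // mulr0 scale0r add0r; have [_ _ _ ->] := ES q Vq.
  by rewrite scalerA mulrN mulVf ?m0 // scaleN1r opprB addrC subrK.
pose c q := b q - dotv (b q) (e q) *: e q.
have sbe : smooth_on V (fun q => dotv (b q) (e q)) by exact: smooth_dotv.
have sc : smooth_on V c by apply: smoothB => //; exact: smooth_scalev.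
have c0 q i : V q -> partial i c q = 0.
  move=> Vq; have [[ee _ _ _] _ _ _] := ES q Vq.
  rewrite partial_sub; first last.
  - by apply: (smooth_diff _ Vq); exact: smooth_scalev.
  - exact: (smooth_diff sb Vq).
  rewrite partial_scalev; first last.
  - exact: (smooth_diff se Vq).
  - exact: (smooth_diff sbe Vq).
  rewrite partial_dotv; first last.
  - exact: (smooth_diff se Vq).
  - exact: (smooth_diff sb Vq).
  by rewrite bE // ee0 // dotv0r scaler0 !addr0 dotvZl ee mulr1 subrr.
have nc := constant_near oV Vp sc (fun q j H => c0 q j H).
have ne := constant_near oV Vp se (fun q j H => ee0 q j H).
have nm := constant_near_real oV Vp smV (fun q j H => me q j H).
have nV : \forall q \near p, V q by exact: open_nbhs_nbhs.
near=> q; have Vq : V q by near: q.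
have [rul _ _ _] := ES q Vq; have [rulp _ _ _] := ES p Vp; exists (e q), (s q); split=> //.
have <- : cylinder_of y p (e p) = S.
  apply: (osculating_cylinder_unique oU sy fy Up (m0 Up)) pS.
  by exists (e p), (s p).
have cE : c q = c p by near: q.
have eE : e q = e p by near: q.
have mE : m q = m p by near: q.
have [[ep _ _ _] _ _ _] := ES p Vp.
apply/seteqP; split=> z; rewrite /cylinder_of -/(b p) -/(b q) eE mE.
  move=> /cylinder_aboutE h1; apply/cylinder_aboutE => //.
  by rewrite -eE -/(c q) cE /c eE; exact: h1.
move=> /cylinder_aboutE h1; apply/cylinder_aboutE => //.
by rewrite -/(c p) -cE /c eE; exact: h1.
Unshelve. all: by end_near. Qed.

(** The vector e - s N and the apex have zero derivative, since de = s dN and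
    d(1 / m) = - s <dy, e>. *)
Lemma osculating_cone_near p S : U p -> (forall q, U q -> gradnorm y q != 0) ->
  osculating_cone y p S -> \forall q \near p, osculating_cone y q S.
Proof.
move=> Up g0 pS; have [V [e [s [oV Vp VU [se ss] ES]]]] := developable_ruling oU sy fy m0 K0 grad_m Up.
have s0 q : V q -> s q != 0.
  move=> Vq; have Uq := VU q Vq; have [rul _ _ _] := ES q Vq.
  by rewrite -sqrf_eq0 -(ruling_gradnorm sy fy Uq (m0 Uq) rul) g0.
have smV := smoothS VU sm; have sNV := smoothS VU sN; have syV := smoothS VU sy.
have dm q : V q -> differentiable m q by move=> /VU; exact: smooth_diff sm.
pose w q := e q - s q *: N q.
have ssN : smooth_on V (fun q => s q *: N q) by exact: smooth_scalev.
have sw : smooth_on V w by exact: smoothB.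
have s10 q i : V q -> partial i s q = 0 by move=> Vq; have [_ -> _ _] := ES q Vq.
have w0 q i : V q -> partial i w q = 0.
  move=> Vq; rewrite partial_sub; first last.
  - exact: (smooth_diff ssN Vq).
  - exact: (smooth_diff se Vq).
  rewrite partial_scalev; first last.
  - exact: (smooth_diff sNV Vq).
  - exact: (smooth_diff ss Vq).
  by rewrite s10 // scale0r add0r; have [_ _ -> _] := ES q Vq; rewrite subrr.
have ms0 q : V q -> m q * s q != 0 by move=> Vq; rewrite mulf_neq0 ?s0 // m0 //; exact: VU.
have sms : smooth_on V (fun q => m q * s q) by exact: smoothM.
have simv : smooth_on V (fun q => (m q * s q)^-1) by exact: smoothV.
pose a q := y q + (m q * s q)^-1 *: e q.
have sce : smooth_on V (fun q => (m q * s q)^-1 *: e q) by exact: smooth_scalev.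
have sa : smooth_on V a by exact: smoothD.
have a0 q i : V q -> partial i a q = 0.
  move=> Vq; have Uq := VU q Vq; have [[_ _ _ me] _ eE NE] := ES q Vq.
  rewrite (partial_offset i Vq syV simv se).
  rewrite partial_inv; [|exact: ms0|exact: (smooth_diff sms Vq)].
  rewrite partial_mul; [|exact: dm|exact: (smooth_diff ss Vq)].
  rewrite s10 // mulr0 addr0 me eE NE scalerA.
  have mq := m0 Uq; have sq := s0 q Vq.
  set t := dotv _ _; have -> : - (m q * s q)^-1 ^+ 2 * (s q * m q ^+ 2 * t * s q) = - t.
    by field; rewrite mq sq.
  rewrite scalerA (_ : _ * _ * - m q = -1) ?scaleN1r; last by field; rewrite mq sq.
  by rewrite opprB scaleNr addKr subrr.
have na := constant_near oV Vp sa (fun q j H => a0 q j H).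
have nw := constant_near oV Vp sw (fun q j H => w0 q j H).
have ns := constant_near_real oV Vp ss (fun q j H => s10 q j H).
have nV : \forall q \near p, V q by exact: open_nbhs_nbhs.
near=> q; have Vq : V q by near: q.
have [rul _ _ _] := ES q Vq; have [rulp _ _ _] := ES p Vp; exists (e q), (s q); split=> //.
have <- : cone_of y p (e p) (s p) = S.
  apply: (osculating_cone_unique oU sy fy Up (m0 Up)) pS.
  by exists (e p), (s p).
have aE : a q = a p by near: q.
have wE : w q = w p by near: q.
have sE : s q = s p by near: q.
by rewrite /cone_of -/(a p) -/(a q) -/(w p) -/(w q) aE wE sE.
Unshelve. all: by end_near. Qed.

End Flat.

End Gradient.

Section ConstantMean.
Hypothesis m1 : forall q i, U q -> partial i m q = 0.

(* The two principal curvatures are real: the discriminant is computed in the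
   orthogonal basis (d_0, g_00 d_1 - g_01 d_0). *)
Let gauss_le_mean2 q : U q -> 0 <= m q ^+ 2 - 4 * K q.
Proof.
move=> Uq; have a0 := area2_gt0 sy fy Uq.
have g0 : 0 < g q 0 0.
  rewrite lt_neqAle dotv_ge0 andbT eq_sym; apply/eqP => g0; move: a0.
  by rewrite /area2 g0 mul0r sub0r oppr_gt0 ltNge sqr_ge0.
pose u := g q 0 0 * h q 0 1 - g q 0 1 * h q 0 0.
pose v := g q 0 0 ^+ 2 * h q 1 1 - 2 * g q 0 0 * g q 0 1 * h q 0 1 + g q 0 1 ^+ 2 * h q 0 0.
have -> : m q ^+ 2 - 4 * K q = ((area2 y q * h q 0 0 - v) / (g q 0 0 * area2 y q)) ^+ 2
    + 4 * u ^+ 2 / (g q 0 0 ^+ 2 * area2 y q).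
  have := lt0r_neq0 a0; have := lt0r_neq0 g0.
  rewrite /mean2 /gauss /area2 /u /v => g0' a0'; field; by rewrite g0' a0'.
rewrite addr_ge0 ?sqr_ge0 // divr_ge0 //; first by rewrite mulr_ge0 ?sqr_ge0 ?ler0n.
by rewrite mulr_ge0 ?sqr_ge0 // ltW.
Qed.

(** Otherwise the two principal curvatures are distinct constants near p, and
    constant_curvatures_flat gives K = 0. *)
Lemma umbilic_of_constant p : (forall q i, U q -> partial i K q = 0) -> U p ->
  K p != 0 -> m p ^+ 2 = 4 * K p.
Proof.
move=> K1 Up Kp; apply/eqP; rewrite -subr_eq0; apply/negPn/negP => D0.
have Dpos : 0 < m p ^+ 2 - 4 * K p by rewrite lt_neqAle eq_sym D0 gauss_le_mean2.
have [r r0 rr] : exists2 r : R, 0 < r & r ^+ 2 = m p ^+ 2 - 4 * K p.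
  by exists (Num.sqrt (m p ^+ 2 - 4 * K p)); rewrite ?sqrtr_gt0 // sqr_sqrtr // ltW.
have nm := constant_near_real oU Up sm (fun q j H => m1 j H).
have nK := constant_near_real oU Up sK (fun q j H => K1 q j H).
have nU : nbhs p U by exact: open_nbhs_nbhs.
have nV : nbhs p [set q | [/\ U q, m q = m p & K q = K p]].
  by apply: filterS3 nm nK nU => q.
pose V := interior [set q | [/\ U q, m q = m p & K q = K p]].
have oV : open V by exact: open_interior.
have VE q : V q -> [/\ U q, m q = m p & K q = K p] by move=> /interior_subset.
have VU : V `<=` U by move=> q /VE[].
have Vp : V p by exact: nV.
have k12 q : V q -> (m p - r) / 2 != (m p + r) / 2.
  by move=> _; apply/eqP => E; move: r0; lra.
have k12m q : V q -> (m p - r) / 2 + (m p + r) / 2 = m q.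
  by move=> /VE[_ -> _]; field.
have k12K q : V q -> (m p - r) / 2 * ((m p + r) / 2) = K q.
  move=> /VE[_ _ ->]; transitivity ((m p ^+ 2 - r ^+ 2) / 4); first by field.
  by rewrite rr; field.
have syV := smoothS VU sy; have fyV q (H : V q) := fy (VU q H).
have sc (z : R) : smooth_on V (fun=> z) by exact: smooth_cst.
have [V' [e [f [oV' V'p V'V [se sf] ad]]]] :=
  @principal_frame R y V oV syV fyV (fun=> (m p - r) / 2) (fun=> (m p + r) / 2)
    (sc _) k12 k12m k12K p Vp.
have := constant_curvatures_flat oV' (smoothS V'V syV) (fun q H => fyV q (V'V q H))
  (smoothS V'V (sc _)) (smoothS V'V (sc _)) se sf ad V'p.
rewrite (k12K p Vp) => H; move/eqP: Kp; apply; apply: H => q.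
  by move=> i _; rewrite !partial_cst.
by move=> /V'V; exact: k12.
Qed.

(** The third fundamental form shows that dN = - (m / 2) dy at umbilics, so that
    the centre y + (2 / m) N has zero derivative. *)
Lemma osculating_sphere_near p : U p -> (forall q, U q -> m q ^+ 2 = 4 * K q) ->
  \forall q \near p, osculating_sphere y q = osculating_sphere y p.
Proof.
move=> Up mK; pose Z q := y q + (2 / m q) *: N q.
have s2m : smooth_on U (fun q => 2 / m q).
  by apply: smoothM => //; [exact: smooth_cst|exact: smoothV].
have sZ : smooth_on U Z by apply: smoothD => //; exact: smooth_scalev.
have N1 q i : U q -> partial i N q = - (m q / 2) *: partial i y q.
  move=> Uq; apply/eqP; rewrite -subr_eq0 -dotvv_eq0 scaleNr opprK !dotvL.
  rewrite (third_form oU sy fy) // (dotv_N1 oU sy fy) // dotvC (dotv_N1 oU sy fy) //.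
  rewrite -/(first_form y q i i); apply/eqP; have := mK q Uq.
  move=> E; transitivity ((m q ^+ 2 - 4 * K q) / 4 * g q i i); last by rewrite E subrr mul0r mul0r.
  by field.
have Z0 q i : U q -> partial i Z q = 0.
  move=> Uq; rewrite (partial_offset i Uq sy s2m sN).
  have -> : partial i (fun q => 2 / m q) q = 0.
    rewrite (@partial_mul _ _ (fun=> 2)); first last.
    + by apply: (smooth_diff _ Uq); exact: smoothV.
    + exact: differentiable_cst.
    rewrite partial_cst partial_inv; [|exact: m0|exact: (smooth_diff sm Uq)].
    by rewrite m1 // !mulr0 mul0r addr0.
  rewrite scale0r add0r N1 // scalerA (_ : _ * _ = -1) ?scaleN1r ?subrr //.
  by field; exact: m0.
have nZ := constant_near oU Up sZ (fun q j H => Z0 q j H).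
have nm := constant_near_real oU Up sm (fun q j H => m1 j H).
apply: filterS2 nZ nm => q ZE mE.
by rewrite /osculating_sphere -/(Z q) ZE mE.
Qed.

End ConstantMean.

End LocalRigidity.

(** * Changes of charts and gluing *)

Section Gluing.
Context {R : realType} {M : topologicalType} {n : nat}.
Variable A : set (@local_param R n M).
Hypothesis atlasA : smooth_atlas A.
Implicit Types (phi psi : @local_param R n M).

Lemma lp_coordK phi p : A phi -> lp_dom phi p -> lp_coord phi (phi p) = p.
Proof.
move=> Aphi domp; rewrite /lp_coord pinvKV ?inE //.
exact: (atlas_inj atlasA Aphi).
Qed.

Lemma lp_mapK phi a : lp_image phi a -> phi (lp_coord phi a) = a.
Proof. by move=> ia; rewrite /lp_coord pinvK // inE. Qed.

Lemma lp_coord_dom phi a : A phi -> lp_image phi a -> lp_dom phi (lp_coord phi a).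
Proof. by move=> Aphi [p domp <-]; rewrite lp_coordK. Qed.

Lemma continuous_lp_coord phi a : A phi -> lp_image phi a ->
  {for a, continuous (lp_coord phi)}.
Proof.
move=> Aphi ia; have := atlas_coord_continuous atlasA Aphi.
rewrite continuous_open_subspace; last exact: (atlas_open_image atlasA Aphi).
by apply; rewrite inE.
Qed.

Lemma continuous_lp_map phi p : A phi -> lp_dom phi p -> {for p, continuous phi}.
Proof.
move=> Aphi domp; have := atlas_continuous atlasA Aphi.
rewrite continuous_open_subspace; last exact: (atlas_open_dom atlasA Aphi).
by apply; rewrite inE.
Qed.

(** The set where the quantity takes a given value is open; so is its complement,
    the union of the sets where it takes other values.  Stated for a functional
    relation P, as the quantity may be given by an existence statement. *)
Lemma chart_glue (T : Type) (P : @local_param R n M -> 'rV[R]_n -> T -> Prop) :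
  connected [set: M] ->
  (forall phi p, A phi -> lp_dom phi p -> exists v, P phi p v) ->
  (forall phi psi p p' v v', A phi -> A psi -> lp_dom phi p -> lp_dom psi p' ->
    phi p = psi p' -> P phi p v -> P psi p' v' -> v = v') ->
  (forall phi p v, A phi -> lp_dom phi p -> P phi p v -> \forall q \near p, P phi q v) ->
  forall phi psi p p' v v', A phi -> A psi -> lp_dom phi p -> lp_dom psi p' ->
    P phi p v -> P psi p' v' -> v = v'.
Proof.
move=> connM Pex Puniq Ploc phi psi p p' v v' Aphi Apsi domp domp' Pv Pv'.
pose E u := [set a : M | exists phi p, [/\ A phi, lp_dom phi p, phi p = a & P phi p u]].
have oE u : open (E u).
  rewrite openE => a [f [q [Af dq fqa Pu]]].
  have ia : lp_image f a by exists q.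
  have nd : nbhs q (lp_dom f) by apply: open_nbhs_nbhs; split=> //; exact: (atlas_open_dom atlasA Af).
  have nP := filterI nd (Ploc _ _ _ Af dq Pu).
  have cf := continuous_lp_coord Af ia.
  have na : nbhs a (lp_image f).
    by apply: open_nbhs_nbhs; split=> //; exact: (atlas_open_image atlasA Af).
  have nc : nbhs a (lp_coord f @^-1` (lp_dom f `&` [set q | P f q u])).
    by apply: cf; rewrite -fqa lp_coordK //; exact: nP.
  apply: filterS (filterI na nc) => b [ib [db Pb]].
  by exists f, (lp_coord f b); split=> //; exact: lp_mapK.
have cE u : closed (E u).
  rewrite -openC (_ : ~` E u = \bigcup_(u' in [set u' | u' <> u]) E u').
    by apply: bigcup_open => u' _; exact: oE.
  apply/seteqP; split=> [a nE|a [u' u'u [f [q [Af dq fqa Pu']]]] [f' [q' [Af' dq' fqa' Pu]]]].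
    have : (\bigcup_(f in A) lp_image f) a by rewrite (atlas_cover atlasA).
    move=> [f Af [q dq fqa]]; have [u' Pu'] := Pex f q Af dq.
    exists u'; last by exists f, q.
    by move=> u'u; apply: nE; exists f, q; rewrite -u'u.
  by apply: u'u; apply: (Puniq f f' q q') => //; rewrite fqa.
have EvT : E v = [set: M].
  apply: connM.
  - by exists (phi p), phi, p.
  - by exists (E v); [exact: oE|rewrite setTI].
  - by exists (E v); [exact: cE|rewrite setTI].
have : E v (psi p') by rewrite EvT.
move=> [f [q [Af dq fq Pq]]].
exact: (Puniq f psi q p').
Qed.

End Gluing.

(** Two charts around a point see the same geometry, up to the sign eps of the
    unit normal and the Jacobian matrix t of the change of coordinates. *)
Section ChartChange.
Context {R : realType} {M : topologicalType}.
Variables (A : set (@local_param R 2 M)) (x : M -> 'rV[R]_3).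
Hypotheses (atlasA : smooth_atlas A) (immx : immersion A x).

Definition same_jet (y z : 'rV[R]_2 -> 'rV[R]_3) p p' (eps : R) (t : 'I_2 -> 'I_2 -> R) :=
  [/\ eps ^+ 2 = 1,
      y p = z p' /\ surface_normal y p = eps *: surface_normal z p',
      forall i, partial i y p = t i 0 *: partial 0 z p' + t i 1 *: partial 1 z p',
      forall i, partial i (surface_normal y) p =
        eps *: (t i 0 *: partial 0 (surface_normal z) p' + t i 1 *: partial 1 (surface_normal z) p') &
      [/\ mean2 y p = eps * mean2 z p', gauss y p = gauss z p',
        area2 y p = (t 0 0 * t 1 1 - t 0 1 * t 1 0) ^+ 2 * area2 z p' &
       forall i, partial i (mean2 y) p =
        eps * (t i 0 * partial 0 (mean2 z) p' + t i 1 * partial 1 (mean2 z) p')]].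

Lemma crossv_comb (a b c d : R) (u v : 'rV[R]_3) :
  crossv (a *: u + b *: v) (c *: u + d *: v) = (a * d - b * c) *: crossv u v.
Proof.
apply: row3P; rewrite ![(_ *: _ : 'rV_3) _ _]mxE ?cross0 ?cross1 ?cross2;
  rewrite ![(_ + _ : 'rV_3) _ _]mxE ![(_ *: _ : 'rV_3) _ _]mxE; ring.
Qed.

Section Pullback.
Variables (y z : 'rV[R]_2 -> 'rV[R]_3) (tau : 'rV[R]_2 -> 'rV[R]_2) (D U : set 'rV[R]_2).
Hypotheses (oD : open D) (oU : open U).
Hypotheses (stau : smooth_on D tau) (sy : smooth_on D y) (sz : smooth_on U z).
Hypotheses (fy : forall q, D q -> row_free ('J y q)) (fz : forall q, U q -> row_free ('J z q)).
Hypothesis tauU : forall q, D q -> U (tau q).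
Hypothesis yz : forall q, D q -> y q = z (tau q).

Let t q i j := (partial i tau q) 0 j.
Let det q := t q 0 0 * t q 1 1 - t q 0 1 * t q 1 0.

Let dtau q : D q -> differentiable tau q. Proof. exact: smooth_diff. Qed.

Let pull (W : normedModType R) (F : 'rV[R]_2 -> W) (G : 'rV[R]_2 -> W) V q i : open V -> V q -> V `<=` D ->
  smooth_on U G -> (forall r, V r -> F r = G (tau r)) ->
  partial i F q = t q i 0 *: partial 0 G (tau q) + t q i 1 *: partial 1 G (tau q).
Proof.
move=> oV Vq VD sG FG; have Dq := VD q Vq.
rewrite (partial_eq_on i oV Vq FG).
apply: etrans (partial_chain i (dtau Dq) (smooth_diff sG (tauU Dq))) _.
by rewrite sum_ord2.
Qed.

Let y_pull q i : D q ->
  partial i y q = t q i 0 *: partial 0 z (tau q) + t q i 1 *: partial 1 z (tau q).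
Proof. by move=> Dq; exact: (pull i oD Dq (fun _ H => H) sz yz). Qed.

Let cross_pull q : D q -> crossv (partial 0 y q) (partial 1 y q) =
  det q *: crossv (partial 0 z (tau q)) (partial 1 z (tau q)).
Proof. by move=> Dq; rewrite !y_pull // crossv_comb. Qed.

Let area2_pull q : D q -> area2 y q = det q ^+ 2 * area2 z (tau q).
Proof. by move=> Dq; rewrite !area2E cross_pull // !dotvL; ring. Qed.

Let det_neq0 q : D q -> det q != 0.
Proof.
move=> Dq; have := area2_neq0 sy fy Dq; rewrite area2_pull // => a0.
by apply: contra_neq a0 => ->; ring.
Qed.

Let normal_pull q : D q ->
  surface_normal y q = Num.sg (det q) *: surface_normal z (tau q).
Proof.
move=> Dq; have d0 := det_neq0 Dq.
rewrite (surface_normalE sy Dq) (surface_normalE sz (tauU Dq)).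
rewrite cross_pull // /enorm !scalerA.
rewrite (_ : dotv _ _ = det q ^+ 2 * dotv (crossv (partial 0 z (tau q)) (partial 1 z (tau q)))
   (crossv (partial 0 z (tau q)) (partial 1 z (tau q)))); last by rewrite !dotvL; ring.
rewrite sqrtrM ?sqr_ge0 // sqrtr_sqr invfM mulrAC; congr (_ * _ *: _).
by apply: (mulfI (_ : `|det q| != 0)); rewrite ?normr_eq0 // mulrA divff ?normr_eq0 // mul1r mulrC -numEsg.
Qed.

Let smooth_t i j : smooth_on D (fun q => t q i j).
Proof. by move: j; apply/(smooth_row _ oD); exact: smooth_partial. Qed.

Lemma pullback_jet p : D p -> exists eps t0, same_jet y z p (tau p) eps t0.
Proof.
move=> Dp; have d0 := det_neq0 Dp; exists (Num.sg (det p)), (t p).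
have sdet : smooth_on D det.
  by apply: smoothB => //; apply: smoothM => //; exact: smooth_t.
have cdet : {for p, continuous det}.
  exact/differentiable_continuous/(smooth_diff sdet Dp).
(* The sign of the Jacobian, hence that of the normal, is locally constant. *)
have nsg : \forall q \near p, Num.sg (det q) = Num.sg (det p).
  have [dp|dp|dp] := ltrgt0P (det p).
  - have : \forall q \near p, 0 < det q by exact: (cvgr_gt (det p) cdet 0 dp).
    by apply: filterS => q dq; rewrite !gtr0_sg.
  - have : \forall q \near p, det q < 0 by exact: (cvgr_lt (det p) cdet 0 dp).
    by apply: filterS => q dq; rewrite !ltr0_sg.
  - by rewrite dp eqxx in d0.
set eps := Num.sg (det p) in nsg *.
have eps2 : eps ^+ 2 = 1 by rewrite sqr_sg d0.
have nD : nbhs p D by exact: open_nbhs_nbhs.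
pose V := interior (D `&` [set q | Num.sg (det q) = eps]).
have oV : open V by exact: open_interior.
have VD : V `<=` D by move=> q /interior_subset [].
have Vp : V p by exact: filterI.
have sgV q : V q -> Num.sg (det q) = eps by move=> /interior_subset [].
have sN := smooth_normal oU sz fz.
have NV q : V q -> surface_normal y q = eps *: surface_normal z (tau q).
  by move=> Vq; rewrite normal_pull ?sgV //; exact: VD.
have N1 q i : V q -> partial i (surface_normal y) q = eps *:
    (t q i 0 *: partial 0 (surface_normal z) (tau q) + t q i 1 *: partial 1 (surface_normal z) (tau q)).
  move=> Vq; have Dq := VD q Vq.
  have dN : differentiable (fun r => surface_normal z (tau r)) q.
    apply: differentiable_comp; first exact: (smooth_diff stau Dq).
    exact: (smooth_diff sN (tauU Dq)).
  rewrite (partial_eq_on i oV Vq NV) (@partial_scalev _ _ _ (fun=> eps)); first last.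
  - exact: dN.
  - exact: differentiable_cst.
  rewrite partial_cst scale0r add0r; congr (_ *: _).
  by rewrite -(pull i oV Vq VD sN (fun _ _ => erefl)).
have gV q i j : V q -> first_form y q i j =
    t q i 0 * t q j 0 * first_form z (tau q) 0 0
    + (t q i 0 * t q j 1 + t q i 1 * t q j 0) * first_form z (tau q) 0 1
    + t q i 1 * t q j 1 * first_form z (tau q) 1 1.
  move=> Vq; rewrite /first_form !y_pull; try exact: VD.
  by rewrite !dotvL [dotv (partial 1 z _) (partial 0 z _)]dotvC; ring.
have hV q i j : V q -> second_form y q i j = eps *
    (t q i 0 * t q j 0 * second_form z (tau q) 0 0
    + (t q i 0 * t q j 1 + t q i 1 * t q j 0) * second_form z (tau q) 0 1
    + t q i 1 * t q j 1 * second_form z (tau q) 1 1).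
  move=> Vq; have Uq := tauU (VD q Vq).
  have := second_formC oU sz fz 1 0 Uq; rewrite /second_form N1 // y_pull; last exact: VD.
  by rewrite !dotvL => E; rewrite (oppr_inj E); ring.
have mV q : V q -> mean2 y q = eps * mean2 z (tau q).
  move=> Vq; have Dq := VD q Vq; have a0 := area2_neq0 sz fz (tauU Dq).
  have dq := det_neq0 Dq.
  rewrite /mean2 area2_pull // !gV // !hV //; move: dq a0; rewrite /det /area2 => dq a0.
  by field; rewrite a0 dq.
have KV q : V q -> gauss y q = gauss z (tau q).
  move=> Vq; have Dq := VD q Vq; have a0 := area2_neq0 sz fz (tauU Dq).
  have dq := det_neq0 Dq.
  rewrite /gauss area2_pull // !hV //.
  transitivity (eps ^+ 2 * (det q ^+ 2 * (second_form z (tau q) 0 0 * second_form z (tau q) 1 1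
    - second_form z (tau q) 0 1 ^+ 2)) / (det q ^+ 2 * area2 z (tau q))).
    by congr (_ / _); rewrite /det; ring.
  by rewrite eps2 mul1r -mulf_div divff ?mul1r // expf_neq0.
have sm := smooth_mean2 oU sz fz.
split=> //.
- by split; [exact: yz|exact: NV].
- by move=> i; exact: y_pull.
- by move=> i; exact: N1.
split=> [|||i]; [exact: mV|exact: KV|exact: area2_pull|].
have dm : differentiable (fun r => mean2 z (tau r)) p.
  apply: differentiable_comp; first exact: (smooth_diff stau Dp).
  exact: (smooth_diff sm (tauU Dp)).
rewrite (partial_eq_on i oV Vp mV) (@partial_mul _ _ (fun=> eps)); first last.
- exact: dm.
- exact: differentiable_cst.
rewrite partial_cst mul0r add0r; congr (_ * _).
by rewrite (pull i oV Vp VD sm (fun _ _ => erefl)).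
Qed.

End Pullback.

Lemma same_jet_charts phi psi p p' : A phi -> A psi -> lp_dom phi p -> lp_dom psi p' ->
  phi p = psi p' -> exists eps t, same_jet (x \o phi) (x \o psi) p p' eps t.
Proof.
move=> Aphi Apsi domp domp' pp'.
have [sphi fphi] := immx Aphi; have [spsi fpsi] := immx Apsi.
have ophi := atlas_open_dom atlasA Aphi; have opsi := atlas_open_dom atlasA Apsi.
pose D := lp_dom phi `&` phi @^-1` lp_image psi.
have oD : open D.
  rewrite openE => q [dq iq]; apply: filterI; first exact: open_nbhs_nbhs.
  apply: (continuous_lp_map atlasA Aphi dq).
  by apply: open_nbhs_nbhs; split=> //; exact: (atlas_open_image atlasA Apsi).
have Dphi : D `<=` lp_dom phi by move=> q [].
have Dp : D p by split=> //; rewrite /= pp'; exists p'.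
have := @pullback_jet (x \o phi) (x \o psi) (lp_coord psi \o phi) D (lp_dom psi) oD opsi
  (atlas_transition atlasA Aphi Apsi) (smoothS Dphi sphi) spsi
  (fun q H => fphi q (Dphi q H)) fpsi _ _ p Dp.
rewrite /= pp' (lp_coordK atlasA) //; apply.
  by move=> q [_ iq]; exact: (lp_coord_dom atlasA Apsi iq).
by move=> q [_ iq] /=; rewrite lp_mapK.
Qed.

End ChartChange.

(** * Classification *)

Section Transport.
Context {R : realType}.
Variables (y z : 'rV[R]_2 -> 'rV[R]_3) (p p' : 'rV[R]_2) (eps : R) (t : 'I_2 -> 'I_2 -> R).
Hypothesis jet : same_jet y z p p' eps t.
Hypothesis ay0 : area2 y p != 0.

Let eps1 : eps = 1 \/ eps = -1.
Proof. by have [/eqP + _ _ _ _] := jet; rewrite sqrf_eq1 => /orP[]/eqP; [left|right]. Qed.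

Lemma gradnorm_jet : gradnorm y p = gradnorm z p'.
Proof.
have [e2 _ yE _ [mE _ aE dm]] := jet.
move: ay0; rewrite aE => a0; rewrite /gradnorm aE mE !dm /first_form !yE !dotvL.
have -> : (eps * mean2 z p') ^+ 4 = mean2 z p' ^+ 4.
  by rewrite exprMn (exprM eps 2 2) e2 expr1n mul1r.
rewrite [dotv (partial 1 z p') (partial 0 z p')]dotvC.
set d := t 0 0 * t 1 1 - t 0 1 * t 1 0 in a0 *.
have d0 : d ^+ 2 != 0 by apply: contra_neq a0 => ->; rewrite mul0r.
transitivity (eps ^+ 2 * (d ^+ 2 * (first_form z p' 1 1 * partial 0 (mean2 z) p' ^+ 2
  - 2 * first_form z p' 0 1 * partial 0 (mean2 z) p' * partial 1 (mean2 z) p'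
  + first_form z p' 0 0 * partial 1 (mean2 z) p' ^+ 2))
  / (d ^+ 2 * (area2 z p' * mean2 z p' ^+ 4))).
  by rewrite [d ^+ 2 * (_ * _)]mulrA; congr (_ / _); rewrite /first_form /d; ring.
by rewrite e2 mul1r -mulf_div divff // mul1r.
Qed.

Lemma ruling_jet e s : ruling z p' e s -> ruling y p e (eps * s).
Proof.
have [e2 [_ NE] yE NyE [mE _ _ dm]] := jet; move=> [ee eN eN1 em]; split=> //.
- by rewrite NE dotvZr eN mulr0.
- by move=> l; rewrite NyE !dotvL !eN1; ring.
- by move=> l; rewrite dm mE yE !em !dotvL -[X in _ = X]mul1r -e2; have [->|->] := eps1; ring.
Qed.

Lemma osculating_sphere_jet : osculating_sphere y p = osculating_sphere z p'.
Proof.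
have [_ [yE NE] _ _ [mE _ _ _]] := jet; rewrite /osculating_sphere yE NE mE.
have [->|->] := eps1; first by rewrite scale1r mul1r.
by rewrite scaleN1r mulN1r invrN mulrN scalerN scaleNr opprK normrN.
Qed.

Lemma osculating_cylinder_jet S : osculating_cylinder z p' S -> osculating_cylinder y p S.
Proof.
move=> [e [s [r ->]]]; exists e, (eps * s); split; first exact: ruling_jet.
have [_ [yE NE] _ _ [mE _ _ _]] := jet; rewrite /cylinder_of yE NE mE.
have [->|->] := eps1; first by rewrite scale1r mul1r.
rewrite scaleN1r mulN1r invrN scalerN scaleNr opprK.
by apply/seteqP; split=> u; rewrite /cylinder_about /= sqrrN.
Qed.

Lemma osculating_cone_jet S : osculating_cone z p' S -> osculating_cone y p S.
Proof.
move=> [e [s [r ->]]]; exists e, (eps * s); split; first exact: ruling_jet.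
have [_ [yE NE] _ _ [mE _ _ _]] := jet; rewrite /cone_of yE NE mE.
have [->|->] := eps1; first by rewrite scale1r !mul1r.
rewrite scaleN1r !mulN1r sqrrN mulrNN scalerN scaleNr opprK.
by apply/seteqP; split=> u; rewrite /cone_about /= sqrrN.
Qed.

End Transport.

Section Classification.
Context {R : realType} {M : topologicalType}.
Variables (A : set (@local_param R 2 M)) (x : M -> 'rV[R]_3).
Hypotheses (atlasA : smooth_atlas A) (immx : immersion A x).
Implicit Types (phi psi : @local_param R 2 M).

Let odom phi : A phi -> open (lp_dom phi). Proof. exact: (atlas_open_dom atlasA). Qed.
Let sx phi : A phi -> smooth_on (lp_dom phi) (x \o phi). Proof. by case/immx. Qed.
Let fx phi : A phi -> forall p, lp_dom phi p -> row_free ('J (x \o phi) p).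
Proof. by case/immx. Qed.

Lemma maslovian_normal_bundle :
  maslovian (normal_bundle_atlas A x) (normal_bundle_immersion x) <->
  forall phi, A phi -> forall w, lp_dom phi (lsubmx w) -> maslovian_at (normal_map (x \o phi)) w.
Proof.
have E phi : normal_bundle_immersion x \o normal_param x phi = normal_map (x \o phi).
  by apply/funext => w; rewrite /normal_map unlock.
split=> [H phi Aphi w domw|H _ [phi Aphi <-] w domw].
  by rewrite -E; apply: H; first by exists phi.
by rewrite E; exact: H.
Qed.

Section Forward.
Hypothesis connM : connected [set: M].
Hypothesis maslov : forall phi, A phi -> forall w, lp_dom phi (lsubmx w) ->
  maslovian_at (normal_map (x \o phi)) w.

Let maslov_at phi p : A phi -> lp_dom phi p -> forall w, lsubmx w = p ->
  maslovian_at (normal_map (x \o phi)) w.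
Proof. by move=> Aphi domp w wp; apply: maslov; rewrite ?wp. Qed.

Let m0 phi : A phi -> forall p, lp_dom phi p -> mean2 (x \o phi) p != 0.
Proof.
move=> Aphi p domp.
exact: (maslovian_mean2 (odom Aphi) (sx Aphi) (fx Aphi) domp (maslov_at Aphi domp)).
Qed.

Let a0 phi p : A phi -> lp_dom phi p -> area2 (x \o phi) p != 0.
Proof. by move=> Aphi domp; exact: (area2_neq0 (sx Aphi) (fx Aphi) domp). Qed.

Let grad_m phi (Aphi : A phi) p (domp : lp_dom phi p) :=
  second_form_grad_mean2 (odom Aphi) (sx Aphi) (fx Aphi) domp (maslov_at Aphi domp).

Let grad_K phi (Aphi : A phi) p (domp : lp_dom phi p) :=
  second_form_grad_gauss (odom Aphi) (sx Aphi) (fx Aphi) domp (maslov_at Aphi domp).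

Let jets := same_jet_charts atlasA immx.

Let gradnorm_cst phi psi p p' : A phi -> A psi -> lp_dom phi p -> lp_dom psi p' ->
  gradnorm (x \o phi) p = gradnorm (x \o psi) p'.
Proof.
move=> Aphi Apsi domp domp'.
apply: (chart_glue atlasA (P := fun phi p v => gradnorm (x \o phi) p = v) connM _ _ _ Aphi Apsi domp domp') => //.
- by move=> f q _ _; exists (gradnorm (x \o f) q).
- move=> f f' q q' v v' Af Af' dq dq' qq' <- <-.
  have [eps [t jet]] := jets Af Af' dq dq' qq'.
  exact: (gradnorm_jet jet (a0 Af dq)).
- move=> f q v Af dq <-.
  exact: (gradnorm_near (odom Af) (sx Af) (fx Af) (m0 Af) (grad_m Af) dq).
Qed.

(** A locally constant choice of models is a single model by chart_glue. *)
Let model_part (osc : ('rV[R]_2 -> 'rV[R]_3) -> 'rV[R]_2 -> set 'rV[R]_3 -> Prop)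
    (model : set 'rV[R]_3 -> Prop) phi0 p0 : A phi0 -> lp_dom phi0 p0 ->
  (forall phi p, A phi -> lp_dom phi p -> exists S, osc (x \o phi) p S) ->
  (forall phi p S S', A phi -> lp_dom phi p -> osc (x \o phi) p S -> osc (x \o phi) p S' -> S = S') ->
  (forall phi psi p p' S, A phi -> A psi -> lp_dom phi p -> lp_dom psi p' -> phi p = psi p' ->
    osc (x \o psi) p' S -> osc (x \o phi) p S) ->
  (forall phi p S, A phi -> lp_dom phi p -> osc (x \o phi) p S ->
    \forall q \near p, osc (x \o phi) q S) ->
  (forall phi p S, A phi -> lp_dom phi p -> osc (x \o phi) p S -> S (x (phi p)) /\ model S) ->
  part_of x model.
Proof.
move=> A0 dom0 oex ouniq otrans onear omem.
have [S0 oS0] := oex phi0 p0 A0 dom0.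
exists S0; first by have [] := omem _ _ _ A0 dom0 oS0.
move=> _ [a _ <-].
have : (\bigcup_(f in A) lp_image f) a by rewrite (atlas_cover atlasA).
move=> [phi Aphi [p domp <-]]; have [S oS] := oex phi p Aphi domp.
have -> : S0 = S.
  apply: (chart_glue atlasA (P := fun phi p S => osc (x \o phi) p S) connM _ _ _ A0 Aphi dom0 domp) => //.
  move=> f f' q q' T T' Af Af' dq dq' qq' oT oT'.
  apply: (ouniq f q) => //; exact: (otrans f f' q q').
by have [] := omem _ _ _ Aphi domp oS.
Qed.

Lemma maslovian_classification : [\/ part_of x is_round_sphere,
  part_of x is_circular_cylinder | part_of x is_circular_cone].
Proof.
have [[phi0 [p0 [A0 dom0]]]|empty] := pselect (exists phi p, A phi /\ lp_dom phi p); last first.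
  (* Any sphere contains the empty surface. *)
  constructor 1; exists (round_sphere 0 1); first by exists 0, 1.
  move=> _ [a _ <-].
  have : (\bigcup_(f in A) lp_image f) a by rewrite (atlas_cover atlasA).
  by move=> [phi Aphi [p domp _]]; exfalso; apply: empty; exists phi, p.
have gE phi p : A phi -> lp_dom phi p -> gradnorm (x \o phi) p = gradnorm (x \o phi0) p0.
  by move=> Aphi domp; exact: gradnorm_cst.
have [g0|g0] := eqVneq (gradnorm (x \o phi0) p0) 0; last first.
  have K0 phi : A phi -> forall p, lp_dom phi p -> gauss (x \o phi) p = 0.
    move=> Aphi p domp; apply/eqP/negPn/negP => Kp.
    have Z := gauss_null (odom Aphi) (sx Aphi) (fx Aphi) domp (grad_m Aphi domp).
    have dz l : partial l (mean2 (x \o phi)) p = 0.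
      by have /eqP := Z l; rewrite mulf_eq0 (negbTE Kp) => /eqP.
    move/eqP: g0; apply; rewrite -(gE _ _ Aphi domp) /gradnorm !dz.
    by rewrite expr0n /= !mulr0 subrr addr0 mul0r.
  constructor 3; apply: (model_part (osc := osculating_cone) A0 dom0).
  - move=> phi p Aphi domp.
    exact: (osculating_cone_exists (odom Aphi) (sx Aphi) (fx Aphi) (m0 Aphi) (grad_m Aphi) (K0 _ Aphi) domp).
  - move=> phi p S S' Aphi domp.
    exact: (osculating_cone_unique (odom Aphi) (sx Aphi) (fx Aphi) domp (m0 Aphi domp)).
  - move=> phi psi p p' S Aphi Apsi domp domp' pp'.
    have [eps [t jet]] := jets Aphi Apsi domp domp' pp'; exact: (osculating_cone_jet jet).
  - move=> phi p S Aphi domp.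
    apply: (osculating_cone_near (odom Aphi) (sx Aphi) (fx Aphi) (m0 Aphi) (grad_m Aphi) (K0 _ Aphi) domp).
    by move=> q domq; rewrite gE.
  - move=> phi p S Aphi domp oS; have gp : gradnorm (x \o phi) p != 0 by rewrite gE.
    split; first exact: (mem_osculating_cone (sx Aphi) (fx Aphi) domp (m0 Aphi domp) gp oS).
    exact: (osculating_cone_model (sx Aphi) (fx Aphi) domp (m0 Aphi domp) gp oS).
have g0' phi : A phi -> forall p, lp_dom phi p -> gradnorm (x \o phi) p = 0.
  by move=> Aphi p domp; rewrite gE.
have dm phi : A phi -> forall p l, lp_dom phi p -> partial l (mean2 (x \o phi)) p = 0.
  move=> Aphi p l domp.
  exact: (gradnorm_eq0 (sx Aphi) (fx Aphi) (m0 Aphi) domp (g0' _ Aphi _ domp)).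
have KdK phi : A phi -> forall p l, lp_dom phi p ->
    gauss (x \o phi) p * partial l (gauss (x \o phi)) p = 0.
  move=> Aphi p l domp; apply: (gauss_null (odom Aphi) (sx Aphi) (fx Aphi) domp
    (u := fun l => partial l (gauss (x \o phi)) p)).
  by apply: (grad_K Aphi domp); exact: dm.
have sK phi (Aphi : A phi) := smooth_gauss (odom Aphi) (sx Aphi) (fx Aphi).
have KE phi p : A phi -> lp_dom phi p -> gauss (x \o phi) p ^+ 2 = gauss (x \o phi0) p0 ^+ 2.
  move=> Aphi domp.
  apply: (chart_glue atlasA (P := fun phi p v => gauss (x \o phi) p ^+ 2 = v) connM _ _ _ Aphi A0 domp dom0) => //.
  - by move=> f q _ _; exists (gauss (x \o f) q ^+ 2).
  - move=> f f' q q' v v' Af Af' dq dq' qq' <- <-.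
    by have [eps [t [_ _ _ _ [_ -> _ _]]]] := jets Af Af' dq dq' qq'.
  - move=> f q v Af dq <-.
    apply: (constant_near_real (odom Af) dq (smoothX 2 (odom Af) (sK _ Af))) => r j dr.
    by rewrite (partial_sqr j (smooth_diff (sK _ Af) dr)) -mulrA KdK // mulr0.
have [K0|K0] := eqVneq (gauss (x \o phi0) p0) 0.
  have K0' phi : A phi -> forall p, lp_dom phi p -> gauss (x \o phi) p = 0.
    by move=> Aphi p domp; apply/eqP; rewrite -sqrf_eq0 KE // K0 expr0n.
  constructor 2; apply: (model_part (osc := osculating_cylinder) A0 dom0).
  - move=> phi p Aphi domp.
    exact: (osculating_cylinder_exists (odom Aphi) (sx Aphi) (fx Aphi) (m0 Aphi) (grad_m Aphi) (K0' _ Aphi) domp).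
  - move=> phi p S S' Aphi domp.
    exact: (osculating_cylinder_unique (odom Aphi) (sx Aphi) (fx Aphi) domp (m0 Aphi domp)).
  - move=> phi psi p p' S Aphi Apsi domp domp' pp'.
    have [eps [t jet]] := jets Aphi Apsi domp domp' pp'; exact: (osculating_cylinder_jet jet).
  - move=> phi p S Aphi domp.
    exact: (osculating_cylinder_near (odom Aphi) (sx Aphi) (fx Aphi) (m0 Aphi) (grad_m Aphi)
      (K0' _ Aphi) domp (g0' _ Aphi)).
  - move=> phi p S Aphi domp oS.
    split; first exact: (mem_osculating_cylinder (sx Aphi) (fx Aphi) domp oS).
    exact: (osculating_cylinder_model (m0 Aphi domp) oS).
have K0' phi : A phi -> forall p, lp_dom phi p -> gauss (x \o phi) p != 0.
  by move=> Aphi p domp; rewrite -sqrf_eq0 KE // sqrf_eq0.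
have dK phi : A phi -> forall p l, lp_dom phi p -> partial l (gauss (x \o phi)) p = 0.
  move=> Aphi p l domp; have /eqP := KdK _ Aphi p l domp.
  by rewrite mulf_eq0 (negbTE (K0' _ Aphi _ domp)) => /eqP.
have umb phi : A phi -> forall p, lp_dom phi p ->
    mean2 (x \o phi) p ^+ 2 = 4 * gauss (x \o phi) p.
  move=> Aphi p domp.
  exact: (umbilic_of_constant (odom Aphi) (sx Aphi) (fx Aphi) (dm _ Aphi) (dK _ Aphi) domp (K0' _ Aphi _ domp)).
constructor 1; apply: (model_part (osc := fun y p S => osculating_sphere y p = S) A0 dom0).
- by move=> phi p _ _; exists (osculating_sphere (x \o phi) p).
- by move=> phi p S S' _ _ <-.
- move=> phi psi p p' S Aphi Apsi domp domp' pp' <-.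
  have [eps [t jet]] := jets Aphi Apsi domp domp' pp'; exact: (osculating_sphere_jet jet).
- move=> phi p S Aphi domp <-.
  exact: (osculating_sphere_near (odom Aphi) (sx Aphi) (fx Aphi) (m0 Aphi) (dm _ Aphi) domp (umb _ Aphi)).
- move=> phi p S Aphi domp <-.
  split; first exact: (mem_osculating_sphere (sx Aphi) (fx Aphi) domp).
  exact: (osculating_sphere_model (m0 Aphi domp)).
Qed.

End Forward.

End Classification.

(** * The models have Maslovian normal bundles *)

Section ModelsAreMaslovian.
Context {R : realType}.
Variables (y : 'rV[R]_2 -> 'rV[R]_3) (U : set 'rV[R]_2).
Hypotheses (oU : open U) (sy : smooth_on U y).
Hypothesis (fy : forall p, U p -> row_free ('J y p)).

Local Notation N := (surface_normal y).

(** The square of nu is |B (y - a)|^2, which is constant here. *)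
Let partial_nu a w beta kappa c q l : U q ->
  (forall r, U r -> dotv (quadric_op w beta (y r - a)) (y r - a) = kappa) ->
  0 < c ->
  (forall r, U r -> dotv (quadric_op w beta (y r - a)) (quadric_op w beta (y r - a)) = c) ->
  partial l (quadric_normal y a w beta) q = 0.
Proof.
move=> Uq BY c0 cE; pose nu := quadric_normal y a w beta.
have B0 r : U r -> quadric_op w beta (y r - a) != 0.
  by move=> Ur; rewrite -dotvv_eq0 cE // gt_eqF.
have snu : smooth_on U nu by exact: (smooth_quadric_normal oU sy fy).
have nu2 r : U r -> nu r ^+ 2 = c.
  by move=> Ur; rewrite (quadric_normal_sqr oU sy fy BY Ur) cE.
have n0 : nu q != 0 by rewrite -sqrf_eq0 nu2 // gt_eqF.
have := partial_cst_on l oU Uq nu2; rewrite (partial_sqr l (smooth_diff snu Uq)) => /eqP.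
by rewrite !mulf_eq0 pnatr_eq0 (negbTE n0) => /eqP.
Qed.

Lemma sphere_maslovian (c : 'rV[R]_3) rho : 0 < rho ->
  (forall q, U q -> dotv (y q - c) (y q - c) = rho ^+ 2) ->
  forall z, U (lsubmx z) -> maslovian_at (normal_map y) z.
Proof.
move=> rho0 yE z Uz; pose w : 'rV[R]_3 := unitv 0.
have w1 : dotv w w = 1 by rewrite dotvE3 /w !mxE /=; ring.
have BE v : quadric_op w 0 v = v by rewrite /quadric_op mul0r scale0r subr0.
have r2 : 0 < rho ^+ 2 by rewrite exprn_gt0.
have BY q : U q -> dotv (quadric_op w 0 (y q - c)) (y q - c) = rho ^+ 2.
  by move=> Uq; rewrite BE yE.
have BB q : U q -> dotv (quadric_op w 0 (y q - c)) (quadric_op w 0 (y q - c)) = rho ^+ 2.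
  by move=> Uq; rewrite !BE yE.
have B0 q : U q -> quadric_op w 0 (y q - c) != 0.
  by move=> Uq; rewrite -dotvv_eq0 BB // gt_eqF.
apply: (quadric_maslovian oU sy fy w1 BY B0 (k := 0) Uz) => //.
- by rewrite lexx ler01.
- by rewrite mul0r.
by move=> i; cbv beta; rewrite !(partial_nu _ Uz BY r2 BB); ring.
Qed.

Lemma cylinder_maslovian (w b : 'rV[R]_3) rho : dotv w w = 1 -> 0 < rho ->
  (forall q, U q -> cylinder_about w b rho (y q)) ->
  forall z, U (lsubmx z) -> maslovian_at (normal_map y) z.
Proof.
move=> w1 rho0 yE z Uz.
have r2 : 0 < rho ^+ 2 by rewrite exprn_gt0.
have BY q : U q -> dotv (quadric_op w 1 (y q - b)) (y q - b) = rho ^+ 2.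
  move=> Uq; have := yE q Uq; rewrite /cylinder_about /= /quadric_op; move: (y q - b) => v <-.
  by rewrite dotvBl dotvZl [dotv w _]dotvC; ring.
have BB q : U q -> dotv (quadric_op w 1 (y q - b)) (quadric_op w 1 (y q - b)) = rho ^+ 2.
  move=> Uq; have := yE q Uq; rewrite /cylinder_about /= /quadric_op; move: (y q - b) => v <-.
  by rewrite dotvBl !dotvBr !dotvZl !dotvZr w1 [dotv w v]dotvC; ring.
have B0 q : U q -> quadric_op w 1 (y q - b) != 0.
  by move=> Uq; rewrite -dotvv_eq0 BB // gt_eqF.
apply: (quadric_maslovian oU sy fy w1 BY B0 (k := 1) Uz) => //.
- by rewrite lexx ler01.
- have wN : dotv w (N (lsubmx z)) = 0.
    apply: (mulfI (quadric_normal_neq0 oU sy fy BY B0 Uz)); rewrite mulr0 -dotvZr.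
    rewrite -(quadric_op_normal oU sy fy BY Uz) /quadric_op [LHS]dotvBr dotvZr w1 dotvC; ring.
  by rewrite wN; ring.
by move=> i; cbv beta; rewrite !(partial_nu _ Uz BY r2 BB); ring.
Qed.

Lemma cone_maslovian (w a : 'rV[R]_3) r : dotv w w = 1 -> r != 0 ->
  (forall q, U q -> cone_about w a r (y q)) ->
  forall z, U (lsubmx z) -> maslovian_at (normal_map y) z.
Proof.
move=> w1 r0 yE z Uz; set p := lsubmx z in Uz.
pose beta := 1 + r ^+ 2.
have r2 : 0 < r ^+ 2 by rewrite exprn_even_gt0.
have b0 : beta != 0 by rewrite gt_eqF // ltr_wpDl.
have YY q : U q -> 0 < dotv (y q - a) (y q - a).
  by move=> Uq; rewrite dotv_gt0 subr_eq0; have [] := yE q Uq.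
have Yw q : U q -> beta * dotv (y q - a) w ^+ 2 = dotv (y q - a) (y q - a).
  by move=> Uq; have [] := yE q Uq.
have BY q : U q -> dotv (quadric_op w beta (y q - a)) (y q - a) = 0.
  move=> Uq; have := Yw q Uq; rewrite /quadric_op; move: (y q - a) => v E.
  by rewrite dotvBl dotvZl [dotv w _]dotvC -E; ring.
have BB q : U q -> dotv (quadric_op w beta (y q - a)) (quadric_op w beta (y q - a)) =
    r ^+ 2 * dotv (y q - a) (y q - a).
  move=> Uq; have := Yw q Uq; rewrite /quadric_op; move: (y q - a) => v E.
  rewrite dotvBl !dotvBr !dotvZl !dotvZr w1 [dotv w v]dotvC -E /beta; ring.
have B0 q : U q -> quadric_op w beta (y q - a) != 0.
  by move=> Uq; rewrite -dotvv_eq0 BB // mulf_neq0 ?gt_eqF // YY.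
have nu0 q (Uq : U q) := quadric_normal_neq0 oU sy fy BY B0 Uq.
have nuE q (Uq : U q) := quadric_op_normal oU sy fy BY Uq.
have nu2 q (Uq : U q) := quadric_normal_sqr oU sy fy BY Uq.
(* The vector y - a is tangent; it is in the kernel of the second fundamental
   form, and dual to nu dnu / r^2. *)
have YN q : U q -> dotv (y q - a) (N q) = 0.
  by move=> Uq; apply: (mulfI (nu0 q Uq)); rewrite mulr0 -dotvZr -nuE // dotvC BY.
have sY : smooth_on U (fun q => y q - a).
  by apply: smoothB => //; exact: smooth_cst.
have sN := smooth_normal oU sy fy.
have Y1 l q : U q -> partial l (fun q => y q - a) q = partial l y q.
  by move=> Uq; rewrite partial_sub ?partial_cst ?subr0 //; exact: (smooth_diff sy Uq).
have YN1 l : dotv (y p - a) (partial l N p) = 0.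
  have := partial_cst_on l oU Uz YN.
  rewrite partial_dotv; [|exact: (smooth_diff sY Uz)|exact: (smooth_diff sN Uz)].
  by rewrite Y1 // (tangent_normal sy) // add0r.
have snu : smooth_on U (quadric_normal y a w beta) by exact: (smooth_quadric_normal oU sy fy).
have dnu l : quadric_normal y a w beta p * partial l (quadric_normal y a w beta) p =
    r ^+ 2 * dotv (y p - a) (partial l y p).
  have E : partial l (fun q => quadric_normal y a w beta q ^+ 2) p =
      partial l (fun q => (fun=> r ^+ 2) q * dotv (y q - a) (y q - a)) p.
    by apply: (partial_eq_on l oU Uz) => q Uq; rewrite nu2 // BB.
  have dY := smooth_diff sY Uz.
  have dYY := differentiable_dotv dY dY.
  move: E; rewrite (partial_sqr l (smooth_diff snu Uz)).
  rewrite (partial_mul l (differentiable_cst (r ^+ 2) p) dYY) partial_cst (partial_dotv l dY dY) Y1 //.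
  rewrite [dotv (partial l y p) _]dotvC; rewrite /cst; lra.
apply: (quadric_maslovian oU sy fy w1 BY B0 (k := 1) Uz) => //.
- by rewrite lexx ler01.
- have wN : quadric_normal y a w beta p * dotv w (N p) = - r ^+ 2 * dotv (y p - a) w.
    by rewrite -dotvZr -nuE // /quadric_op dotvBr dotvZr w1 dotvC /beta; ring.
  have n2 : quadric_normal y a w beta p ^+ 2 = r ^+ 2 * beta * dotv (y p - a) w ^+ 2.
    by rewrite nu2 // BB // -mulrA Yw.
  have n20 : quadric_normal y a w beta p ^+ 2 != 0 by rewrite sqrf_eq0 nu0.
  apply: (mulfI n20); rewrite mulr1.
  transitivity (beta * (quadric_normal y a w beta p ^+ 2
     - (quadric_normal y a w beta p * dotv w (N p)) ^+ 2)); first by ring.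
  by rewrite wN n2 /beta; ring.
move=> i; cbv beta; apply: (mulfI (nu0 p Uz)); rewrite mulr0.
have a0 := area2_neq0 sy fy Uz.
have := parseval sy fy (y p - a) (partial i N p) Uz.
rewrite YN1 YN // !(dotv_N1 oU sy fy) // => E.
transitivity (second_form y p i 0 * (first_form y p 1 1 *
    (quadric_normal y a w beta p * partial 0 (quadric_normal y a w beta) p)
    - first_form y p 0 1 * (quadric_normal y a w beta p * partial 1 (quadric_normal y a w beta) p))
  + second_form y p i 1 * (first_form y p 0 0 *
    (quadric_normal y a w beta p * partial 1 (quadric_normal y a w beta) p)
    - first_form y p 0 1 * (quadric_normal y a w beta p * partial 0 (quadric_normal y a w beta) p))).
  by ring.
rewrite !dnu; transitivity (- r ^+ 2 * (area2 y p * 0)); last by ring.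
by rewrite E; ring.
Qed.

End ModelsAreMaslovian.

Theorem theorem1p1 (R : realType) (M : topologicalType)
    (A : set (@local_param R 2 M)) (x : M -> 'rV[R]_3)
    (manM : smooth_manifold A) (connM : connected [set: M])
    (immx : immersion A x) :
  maslovian (normal_bundle_atlas A x) (normal_bundle_immersion x) <->
  [\/ part_of x is_round_sphere,
      part_of x is_circular_cylinder |
      part_of x is_circular_cone].
Proof.
have atlasA := manifold_atlas manM.
rewrite maslovian_normal_bundle; split=> [maslov|model phi Aphi w domw].
  exact: (maslovian_classification atlasA immx connM maslov).
have odom := atlas_open_dom atlasA Aphi; have [sx fx] := immx phi Aphi.
have inx q : range x ((x \o phi) q) by exists (phi q).
case: model => -[S].
- move=> [c [rho [rho0 ->]]] xS; apply: (sphere_maslovian odom sx fx rho0 _ domw) => q _.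
  exact/(round_sphereE _ _ rho0)/xS/inx.
- move=> [rho [rho0 /(congruent_cylinder _ rho0)[v [b [v1 ->]]]]] xS.
  by apply: (cylinder_maslovian odom sx fx v1 rho0 _ domw) => q _; exact/xS/inx.
- move=> [r [r0 /(congruent_cone _ r0)[v [a [v1 ->]]]]] xS.
  by apply: (cone_maslovian odom sx fx v1 r0 _ domw) => q _; exact/xS/inx.
Qed.
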